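(* Let $f\in Symp$. Then $f$ permutes the chain curves $D_s$, $s\in S$, and the induced bijection $f_*:S\to S$, defined by $f(D_s)=D_{f_*(s)}$, is a piecewise linear automorphism of $\mathbf{Z}^2$. The map $f\mapsto f_*$ is a group homomorphism $Symp\to T$ to the Thompson group $T$ of piecewise linear automorphisms of $\mathbf{Z}^2$.
   Context: $Symp$ is the group of birational automorphisms of $\mathbf{CP}^2$ (affine coordinates $x=X/Z$, $y=Y/Z$) preserving the 2-form $\omega=\frac{dx\wedge dy}{xy}$. $S\subset\mathbf{Z}^2$ is the set of vectors with coprime coordinates, and $u\wedge v$ is the antisymmetric bilinear product on $\mathbf{Z}^2$ with $(1,0)\wedge(0,1)=1$. A chain on a surface is a cyclically ordered union of smooth rational curves, each meeting only its two neighbours, transversally in one point. Start with the chain $(X=0)\cup(Y=0)\cup(Z=0)$ on $\mathbf{CP}^2$. When a point is blown up, the new chain is the strict transform of the old chain, together with the exceptional divisor if the blown-up point is an intersection point of two curves of the chain. Curves are identified with their strict transforms. The chain curves arising on all iterated blow-ups of $\mathbf{CP}^2$ are in bijection $s\leftrightarrow D_s$ with $S$: $D_{(1,0)}=(X=0)$, $D_{(0,1)}=(Y=0)$, $D_{(-1,-1)}=(Z=0)$, and the exceptional curve of the blow-up of the intersection point of neighbouring chain curves $D_u,D_v$ is $D_{u+v}$. The equality $f(D_s)=D_{s'}$ means that $f$, viewed as a birational map between suitable iterated blow-ups of $\mathbf{CP}^2$, maps the curve $D_s$ onto the curve $D_{s'}$. A piecewise linear automorphism of $\mathbf{Z}^2$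 is a bijection $g:S\to S$ preserving the cyclic order of $S$ (by direction around the origin) for which there are cyclically ordered (clockwise) $s_1,\dots,s_n\in S$, with indices mod $n$ and $s_{i+1}\wedge s_i=1$ for all $i$, such that the cones $\mathbf{Z}_{\ge0}s_i+\mathbf{Z}_{\ge0}s_{i+1}$ decompose $\mathbf{Z}^2$ and $g(as_i+bs_{i+1})=a\,g(s_i)+b\,g(s_{i+1})$ for all non-negative integers $a,b$ with $as_i+bs_{i+1}\in S$. The Thompson group $T$ is the group of these under composition. *)

(* Defs.v *)
From HB Require Import structures.
From mathcomp Require Import all_boot all_order all_algebra.
From mathcomp Require Import boolp reals.
From mathcomp Require Import complex mpoly ring.

Set Implicit Arguments.
Unset Strict Implicit.
Unset Printing Implicit Defensive.

Import Order.TTheory GRing.Theory Num.Theory.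

Local Open Scope ring_scope.
Local Open Scope quotient_scope.

(* A pair seen as a vector of length 2, the format of arguments of polynomials
   in two variables. *)
Definition vec2 (A : Type) (t : A * A) : 'I_2 -> A :=
  fun i => if i == ord0 then t.1 else t.2.

Local Notation "p %:F" := (@FracField.tofrac _ p).

(* The function field of CP^2; the two variables are x = X/Z and y = Y/Z. *)
Notation ratfun C := {fraction {mpoly C[2]}}.

Fact inv_aux (F : fieldType) (r s : F) :
  s != 0 -> - (r / s) = s * (- r / s ^+ 2).
Proof. by move=> s0; field. Qed.

Fact quot_aux (F : fieldType) (n m a b c d x y : F) : m != 0 ->
  (a * x + b * y) / m + n * (- (c * x + d * y) / m ^+ 2) =
  (a * m - n * c) / m ^+ 2 * x + (b * m - n * d) / m ^+ 2 * y.
Proof. by move=> m0; field. Qed.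

Fact jac_aux (F : comRingType) (p a b c d x y z t : F) :
  p * ((a * x + b * y) * (c * z + d * t) - (a * z + b * t) * (c * x + d * y)) =
  p * (a * d - b * c) * (x * t - z * y).
Proof. by ring. Qed.

Section RationalFunctions.
Variable C : fieldType.
Implicit Types (p q : {mpoly C[2]}) (phi psi : ratfun C).
Implicit Types f g h : ratfun C * ratfun C.

Definition ratC (a : C) : ratfun C := (a%:MP)%:F.

HB.instance Definition _ := GRing.RMorphism.copy ratC
  (@FracField.tofrac {mpoly C[2]} \o @mpolyC 2 C).

Definition rx : ratfun C := ('X_(ord0 : 'I_2))%:F.
Definition ry : ratfun C := ('X_(ord_max : 'I_2))%:F.

(* A representative numerator and denominator (not necessarily in lowest
   terms); see [ratfunE] below. *)
Definition num phi : {mpoly C[2]} := \n_(repr phi).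
Definition den phi : {mpoly C[2]} := \d_(repr phi).

(* p(f1, f2) *)
Definition psubst f p : ratfun C := mmap ratC (vec2 f) p.

HB.instance Definition _ f := GRing.RMorphism.copy (psubst f)
  (mmap ratC (vec2 f)).

(* phi(f1, f2), i.e. phi \o f for the rational map f = (f1, f2).  For f
   dominant it does not depend on the fraction representing phi, see
   [rsubst_frac] below; it is only used for such f. *)
Definition rsubst f phi : ratfun C := psubst f (num phi) / psubst f (den phi).

(* A rational map of CP^2 to itself is given in affine coordinates by a pair
   of rational functions; it is dominant when these are algebraically
   independent. *)
Definition dominant f : Prop := forall p, psubst f p = 0 -> p = 0.

Definition rid : ratfun C * ratfun C := (rx, ry).

Definition rcomp f g : ratfun C * ratfun C := (rsubst g f.1, rsubst g f.2).

Definition birational f : Prop :=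
  dominant f /\ exists g, [/\ dominant g, rcomp f g = rid & rcomp g f = rid].

(* The partial derivative d/dx (i = 0) or d/dy (i = 1), by the quotient rule. *)
Definition rderiv (i : 'I_2) phi : ratfun C :=
  ((num phi)^`M(i) * den phi - num phi * (den phi)^`M(i))%:F
  / (den phi ^+ 2)%:F.

Lemma den_neq0 phi : den phi != 0.
Proof. exact: denom_ratioP. Qed.

Lemma ratfunE phi : phi = (num phi)%:F / (den phi)%:F.
Proof.
apply: (canRL (mulfK _)); first by rewrite tofrac_eq0 den_neq0.
rewrite -{1}[phi]reprK /num /den; move: (repr phi) => r.
unlock FracField.tofrac; rewrite -[LHS]FracField.pi_mul.
apply/eqmodP; rewrite /= FracField.equivfE /FracField.mulf.
have d0 := denom_ratioP r.
rewrite !numden_Ratio ?(oner_neq0, mulr1, mulf_neq0) //.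
by rewrite mulrC.
Qed.

Lemma psubstD f : {morph psubst f : p q / p + q}.
Proof. exact: raddfD. Qed.

Lemma psubstM f : {morph psubst f : p q / p * q}.
Proof. exact: rmorphM. Qed.

Lemma psubst1 f : psubst f 1 = 1.
Proof. exact: rmorph1. Qed.

Lemma psubstC f a : psubst f a%:MP = ratC a.
Proof. exact: mmapC. Qed.

Lemma psubstX f i : psubst f 'X_i = vec2 f i.
Proof. by rewrite /psubst mmapX mmap1U. Qed.

Lemma psubst_ind (P : {mpoly C[2]} -> Prop) :
    (forall a, P a%:MP) -> (forall i, P 'X_i) ->
    (forall p q, P p -> P q -> P (p + q)) ->
    (forall p q, P p -> P q -> P (p * q)) ->
  forall p, P p.
Proof.
move=> PC PX PD PM; elim/mpolyind=> [|a m p _ _ Pp]; first exact: PC.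
apply: (PD _ _ _ Pp); rewrite -mul_mpolyC; apply: (PM _ _ (PC a)).
rewrite mpolyXE_id; apply: big_ind => //= [|i _]; first exact: PC.
by elim: (m i) => [|k IH]; [exact: PC | rewrite exprS; exact: PM].
Qed.

Section Subst.
Variable f : ratfun C * ratfun C.
Hypothesis domf : dominant f.

Lemma psubst_neq0 p : p != 0 -> psubst f p != 0.
Proof. by apply: contra_neq => /domf. Qed.

Lemma rsubst_frac n d : d != 0 ->
  rsubst f (n%:F / d%:F) = psubst f n / psubst f d.
Proof.
move=> d0; rewrite /rsubst; set phi := _ / _.
apply/eqP; rewrite eqr_div ?psubst_neq0 ?den_neq0 // -!psubstM.
apply/eqP; congr (psubst f _); apply/eqP.
rewrite -tofrac_eq !tofracM -eqr_div ?tofrac_eq0 ?den_neq0 //.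
by rewrite -ratfunE.
Qed.

Lemma rsubst_poly p : rsubst f p%:F = psubst f p.
Proof.
rewrite -[p%:F]divr1 -tofrac1 rsubst_frac ?oner_neq0 //.
by rewrite psubst1 divr1.
Qed.

Lemma rsubstC a : rsubst f (ratC a) = ratC a.
Proof. by rewrite rsubst_poly psubstC. Qed.

Lemma rsubstM : {morph rsubst f : phi psi / phi * psi}.
Proof.
move=> phi psi; rewrite [phi in LHS]ratfunE [psi in LHS]ratfunE mulf_div.
rewrite -!tofracM rsubst_frac ?mulf_neq0 ?den_neq0 // !psubstM.
by rewrite -mulf_div.
Qed.

Lemma rsubstD : {morph rsubst f : phi psi / phi + psi}.
Proof.
move=> phi psi; rewrite [phi in LHS]ratfunE [psi in LHS]ratfunE.
rewrite addf_div ?tofrac_eq0 ?den_neq0 // -!tofracM -tofracD.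
rewrite rsubst_frac ?mulf_neq0 ?den_neq0 // !psubstD !psubstM.
by rewrite -addf_div ?psubst_neq0 ?den_neq0.
Qed.

Lemma rsubst0 : rsubst f 0 = 0.
Proof. by rewrite -tofrac0 rsubst_poly raddf0. Qed.

Lemma rsubstN phi : rsubst f (- phi) = - rsubst f phi.
Proof. by apply/eqP; rewrite -addr_eq0 -rsubstD addNr rsubst0. Qed.

Lemma rsubst1 : rsubst f 1 = 1.
Proof. by rewrite -tofrac1 rsubst_poly psubst1. Qed.

Lemma rsubst_eq0 phi : (rsubst f phi == 0) = (phi == 0).
Proof.
apply/idP/eqP=> [|->]; last by rewrite rsubst0.
rewrite /rsubst mulf_eq0 invr_eq0 (negPf (psubst_neq0 (den_neq0 _))) orbF.
by move/eqP/domf=> n0; rewrite [phi]ratfunE n0 tofrac0 mul0r.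
Qed.

Lemma rsubstV phi : rsubst f phi^-1 = (rsubst f phi)^-1.
Proof.
have [->|n0] := eqVneq phi 0; first by rewrite invr0 rsubst0 invr0.
apply: (mulfI (x := rsubst f phi)); first by rewrite rsubst_eq0.
by rewrite -rsubstM !divff ?rsubst_eq0 // rsubst1.
Qed.

Lemma rsubst_psubst g p : rsubst f (psubst g p) = psubst (rcomp g f) p.
Proof.
elim/psubst_ind: p => [a|i|p q IHp IHq|p q IHp IHq].
- by rewrite !psubstC rsubstC.
- by rewrite !psubstX /vec2; case: ifP.
- by rewrite !psubstD rsubstD IHp IHq.
- by rewrite !psubstM rsubstM IHp IHq.
Qed.

Lemma rcomp_dominant g : dominant g -> dominant (rcomp g f).
Proof.
move=> domg p; rewrite -rsubst_psubst => /eqP.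
by rewrite rsubst_eq0 => /eqP /domg.
Qed.

Lemma rsubst_comp g phi : rsubst f (rsubst g phi) = rsubst (rcomp g f) phi.
Proof. by rewrite [rsubst g phi]/rsubst rsubstM rsubstV !rsubst_psubst. Qed.

Lemma rcompA h g : rcomp h (rcomp g f) = rcomp (rcomp h g) f.
Proof. by rewrite /rcomp /= !rsubst_comp. Qed.

Lemma rcomp1f : rcomp rid f = f.
Proof.
rewrite /rcomp /rx /ry !rsubst_poly !psubstX /vec2 /=.
by case: (f).
Qed.

End Subst.

Lemma psubst_id p : psubst rid p = p%:F.
Proof.
elim/psubst_ind: p => [a|i|p q IHp IHq|p q IHp IHq].
- by rewrite psubstC.
- rewrite psubstX /vec2; case: ifP => [/eqP -> //|ni].
  by congr (_%:F); congr 'X__; apply/val_inj; case: i ni => [[|[|[]]]].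
- by rewrite psubstD IHp IHq tofracD.
- by rewrite psubstM IHp IHq tofracM.
Qed.

Lemma rid_dominant : dominant rid.
Proof. by move=> p /eqP; rewrite psubst_id tofrac_eq0 => /eqP. Qed.

Lemma rsubst_id phi : rsubst rid phi = phi.
Proof. by rewrite /rsubst !psubst_id -ratfunE. Qed.

Lemma rcompf1 f : rcomp f rid = f.
Proof. by rewrite /rcomp !rsubst_id; case: f. Qed.

Lemma rderiv_frac i n d : d != 0 ->
  rderiv i (n%:F / d%:F) = (n^`M(i) * d - n * d^`M(i))%:F / (d ^+ 2)%:F.
Proof.
move=> d0; set phi := n%:F / d%:F; rewrite /rderiv.
have e0 := den_neq0 phi.
have E : num phi * d = n * den phi.
  apply/eqP; rewrite -tofrac_eq !tofracM -eqr_div ?tofrac_eq0 //.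
  by rewrite -ratfunE.
apply/eqP; rewrite eqr_div ?tofrac_eq0 ?expf_neq0 // -!tofracM tofrac_eq.
have := congr1 (mderiv i) E; rewrite !mderivM.
move: (num phi) (den phi) (mderiv _ _) (mderiv _ _) (mderiv _ _)
  (mderiv _ _) E => N D D' n' d' N' E E'.
have -> : (N' * D - N * D') * d ^+ 2
   = (N' * d + N * d') * d * D - N * d * (d * D' + D * d') by ring.
by rewrite E E'; apply/eqP; ring.
Qed.

Lemma rderiv_poly i p : rderiv i p%:F = (p^`M(i))%:F.
Proof.
rewrite -[p%:F]divr1 -tofrac1 rderiv_frac ?oner_neq0 //.
by rewrite -mpolyC1 mderivC mulr0 subr0 mpolyC1 mulr1 expr1n tofrac1 divr1.
Qed.

Lemma rderivD i phi psi : rderiv i (phi + psi) = rderiv i phi + rderiv i psi.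
Proof.
rewrite [phi in LHS]ratfunE [psi in LHS]ratfunE.
have d0 := den_neq0 phi; have e0 := den_neq0 psi.
rewrite addf_div ?tofrac_eq0 // -!tofracM -tofracD.
rewrite rderiv_frac ?mulf_neq0 // /rderiv.
rewrite addf_div ?tofrac_eq0 ?expf_neq0 // -!tofracM -tofracD.
rewrite !mderivD !mderivM.
by congr (_%:F / _%:F); ring.
Qed.

Lemma rderivM i phi psi :
  rderiv i (phi * psi) = rderiv i phi * psi + phi * rderiv i psi.
Proof.
have d0 := den_neq0 phi; have e0 := den_neq0 psi.
rewrite [phi]ratfunE [psi]ratfunE.
move: (num phi) (den phi) (num psi) (den psi) d0 e0 => n d m e d0 e0.
rewrite mulf_div -!tofracM !rderiv_frac ?mulf_neq0 // !mulf_div -!tofracM.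
have d2e0 : d ^+ 2 * e != 0 by rewrite mulf_neq0 ?expf_neq0.
have de20 : d * e ^+ 2 != 0 by rewrite mulf_neq0 ?expf_neq0.
rewrite addf_div ?tofrac_eq0 // -!tofracM -tofracD.
apply/eqP; rewrite eqr_div ?tofrac_eq0 ?mulf_neq0 ?expf_neq0 //.
by rewrite -!tofracM tofrac_eq !mderivM; apply/eqP; ring.
Qed.

Lemma rderiv1 i : rderiv i 1 = 0.
Proof. by rewrite -tofrac1 rderiv_poly -mpolyC1 mderivC tofrac0. Qed.

Lemma rderivV i phi : rderiv i phi^-1 = - rderiv i phi / phi ^+ 2.
Proof.
have [->|n0] := eqVneq phi 0.
  rewrite invr0 -tofrac0 rderiv_poly mderiv0 tofrac0.
  by rewrite oppr0 mul0r.
have := rderivM i phi phi^-1; rewrite divff // rderiv1 => /esym/eqP.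
rewrite addrC addr_eq0 => /eqP E; apply: (mulfI n0); rewrite E.
exact: inv_aux.
Qed.

Section ChainRule.
Variable f : ratfun C * ratfun C.
Hypothesis domf : dominant f.

Lemma rderiv_psubst i p :
  rderiv i (psubst f p) = psubst f (p^`M(ord0)) * rderiv i f.1
                        + psubst f (p^`M(ord_max)) * rderiv i f.2.
Proof.
elim/psubst_ind: p => [a|j|p q IHp IHq|p q IHp IHq].
- by rewrite psubstC !mderivC !raddf0 rderiv_poly mderivC tofrac0 !mul0r addr0.
- rewrite psubstX !mderivX !mnm1E /vec2.
  have U (k : 'I_2) : 'X_[U_(k) - U_(k)] = 1 :> {mpoly C[2]}.
    by rewrite -{1}[U_(k)%MM]add0m addmK mpolyX0.
  case: j => [[|[|//]] lj].
    have -> : Ordinal lj = ord0 by exact/val_inj.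
    by rewrite eqxx /= U scale1r scale0r raddf0 psubst1 mul1r mul0r addr0.
  have -> : Ordinal lj = ord_max by exact/val_inj.
  by rewrite eqxx /= U scale1r scale0r raddf0 psubst1 mul1r mul0r add0r.
- by rewrite !(psubstD, rderivD, mderivD) IHp IHq; ring.
- by rewrite !(psubstM, rderivM, mderivM, psubstD) IHp IHq; ring.
Qed.

Lemma rderiv_rsubst i phi :
  rderiv i (rsubst f phi) = rsubst f (rderiv ord0 phi) * rderiv i f.1
                          + rsubst f (rderiv ord_max phi) * rderiv i f.2.
Proof.
have d0 := den_neq0 phi.
have E k : rsubst f (rderiv k phi) =
    (psubst f (num phi)^`M(k) * psubst f (den phi)
     - psubst f (num phi) * psubst f (den phi)^`M(k)) / psubst f (den phi) ^+ 2.
  rewrite /rderiv rsubst_frac ?expf_neq0 // expr2 psubstM.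
  by rewrite psubstD raddfN /= !psubstM.
rewrite !E {1}/rsubst rderivM rderivV !rderiv_psubst.
exact: (quot_aux _ _ _ _ _ _ _ (psubst_neq0 domf d0)).
Qed.

End ChainRule.

Definition jac f : ratfun C :=
  rderiv ord0 f.1 * rderiv ord_max f.2 - rderiv ord_max f.1 * rderiv ord0 f.2.

(* The rational 2-form h dx /\ dy is represented by h.  This is the coefficient
   of its pullback f^*(h dx /\ dy) = (h \o f) df1 /\ df2. *)
Definition pullback f phi : ratfun C := rsubst f phi * jac f.

Lemma pullback_comp f g phi : dominant f -> dominant g ->
  pullback (rcomp f g) phi = pullback g (pullback f phi).
Proof.
move=> domf domg; rewrite /pullback /jac /= !rderiv_rsubst // rsubstM //.
have -> : rsubst g (rderiv ord0 f.1 * rderiv ord_max f.2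
                    - rderiv ord_max f.1 * rderiv ord0 f.2) =
    rsubst g (rderiv ord0 f.1) * rsubst g (rderiv ord_max f.2)
    - rsubst g (rderiv ord_max f.1) * rsubst g (rderiv ord0 f.2).
  by rewrite rsubstD // rsubstN // !rsubstM.
by rewrite rsubst_comp //; exact: jac_aux.
Qed.

Lemma pullback_id phi : pullback rid phi = phi.
Proof.
rewrite /pullback rsubst_id /jac /rid /rx /ry /= !rderiv_poly !mderivX !mnm1E.
have U (k : 'I_2) : 'X_[U_(k) - U_(k)] = 1 :> {mpoly C[2]}.
  by rewrite -{1}[U_(k)%MM]add0m addmK mpolyX0.
by rewrite /= !U !scale1r !scale0r tofrac0 tofrac1 mulr0 subr0 !mulr1.
Qed.

(* The coefficient of dx /\ dy / (x y). *)
Definition omega : ratfun C := 1 / (rx * ry).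

Definition symplectic f : Prop := birational f /\ pullback f omega = omega.

End RationalFunctions.

Record symp (C : fieldType) := Symp {
  symp_map :> ratfun C * ratfun C;
  symp_mapP : `[< symplectic symp_map >] }.

HB.instance Definition _ (C : fieldType) := [isSub of symp C for @symp_map C].
HB.instance Definition _ (C : fieldType) := [Choice of symp C by <:].

Section SympGroup.
Variable C : fieldType.
Implicit Types f g h : symp C.

Lemma sympP f : symplectic f.
Proof. exact/asboolP/symp_mapP. Qed.

Lemma symp_dominant f : dominant f.
Proof. by have [[]] := sympP f. Qed.

Fact symplectic_id : symplectic (rid C).
Proof.
split; last exact: pullback_id.
split; first exact: rid_dominant.
by exists (rid C); split; rewrite ?rcompf1 //; exact: rid_dominant.
Qed.

Fact symplectic_comp f g : symplectic (rcomp f g).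
Proof.
have [[df [f' [df' ff' f'f]]] fo] := sympP f.
have [[dg [g' [dg' gg' g'g]]] go] := sympP g.
split; last by rewrite pullback_comp // fo go.
split; first exact: rcomp_dominant.
exists (rcomp g' f'); split; first exact: rcomp_dominant.
- rewrite -rcompA; last exact: rcomp_dominant.
  by rewrite (rcompA df') gg' rcomp1f.
- rewrite -rcompA; last exact: rcomp_dominant.
  by rewrite (rcompA dg) f'f rcomp1f.
Qed.

Fact symplectic_inv f :
  { g | [/\ symplectic g, rcomp f g = rid C & rcomp g f = rid C] }.
Proof.
apply: cid; have [[df [g [dg fg gf]]] fo] := sympP f.
exists g; split=> //; split; first by split=> //; exists f; split.
by rewrite -[in LHS]fo -pullback_comp // fg pullback_id.
Qed.

Definition symp_one := Symp (asboolT symplectic_id).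
(* The product in Symp is the composition of maps: f * g is f \o g. *)
Definition symp_mul f g := Symp (asboolT (symplectic_comp f g)).
Definition symp_inv f :=
  let: exist _ (And3 gs _ _) := symplectic_inv f in Symp (asboolT gs).

Fact symp_mulA : associative symp_mul.
Proof.
by move=> f g h; apply: val_inj; exact: (rcompA (@symp_dominant h)).
Qed.

Fact symp_mul1 : left_id symp_one symp_mul.
Proof. by move=> f; apply: val_inj; exact: (rcomp1f (@symp_dominant f)). Qed.

Fact symp_mulr1 : right_id symp_one symp_mul.
Proof. by move=> f; apply: val_inj; exact: rcompf1. Qed.

Fact symp_mulVf : left_inverse symp_one symp_inv symp_mul.
Proof.
by move=> f; apply: val_inj; rewrite /= /symp_inv; case: symplectic_inv => ? [].
Qed.

Fact symp_mulfV : right_inverse symp_one symp_inv symp_mul.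
Proof.
by move=> f; apply: val_inj; rewrite /= /symp_inv; case: symplectic_inv => ? [].
Qed.

HB.instance Definition _ :=
  isGroup.Build (symp C) symp_mulA symp_mul1 symp_mulr1 symp_mulVf symp_mulfV.

End SympGroup.

Section BlowUps.
Variable C : fieldType.

(* All surfaces below are covered by affine planes, and are birational to CP^2.
   An affine plane is given by its two coordinates (u, v), which are elements
   of the common function field, and a surface by the set of planes covering
   it. *)
Definition chart : Type := ratfun C * ratfun C.
Definition surface : Type := chart -> Prop.

(* The point with coordinates P.2 in the affine plane P.1. *)
Definition point : Type := chart * (C * C).

(* phi is in the local ring of the point P. *)
Definition regular_at (P : point) (phi : ratfun C) : Prop :=
  exists n d, d.@[vec2 P.2] != 0 /\ phi = psubst P.1 n / psubst P.1 d.

(* Affine planes are glued along the points with the same local ring. *)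
Definition same_point (P Q : point) : Prop :=
  forall phi, regular_at P phi <-> regular_at Q phi.

(* The affine planes (X/Z, Y/Z), (Y/X, Z/X) and (Z/Y, X/Y). *)
Definition cp2 : surface := fun c =>
  [\/ c = (rx C, ry C), c = (ry C / rx C, 1 / rx C)
    | c = (1 / ry C, rx C / ry C)].

(* The blow-up of the affine plane with coordinates (u, v) at (a, b) is the
   union of the affine planes with coordinates
   (u - a, (v - b) / (u - a)) and ((u - a) / (v - b), v - b). *)
Definition blowup_chart1 (P : point) : chart :=
  let: ((u, v), (a, b)) := P in (u - ratC a, (v - ratC b) / (u - ratC a)).
Definition blowup_chart2 (P : point) : chart :=
  let: ((u, v), (a, b)) := P in ((u - ratC a) / (v - ratC b), v - ratC b).

Definition blowup (X : surface) (P : point) : surface := fun c =>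
  (X c /\ forall t, ~ same_point (c, t) P) \/
  exists e t, [/\ X e, same_point (e, t) P
                & c = blowup_chart1 (e, t) \/ c = blowup_chart2 (e, t)].

(* A curve is given by an affine plane (u, v) in which it is the axis u = 0.
   The conditions below only depend on its local ring (that of its generic
   point), which does not change when the curve is replaced by a strict
   transform. *)
Definition curve : Type := chart.

(* phi is in the local ring of D: it is regular at some point of the axis,
   hence at all but finitely many of them. *)
Definition regular_along (D : curve) (phi : ratfun C) : Prop :=
  exists t, regular_at (D, (0, t)) phi.

(* phi is in the maximal ideal of the local ring of D. *)
Definition vanishes_along (D : curve) (phi : ratfun C) : Prop :=
  exists n d, [/\ exists t, d.@[vec2 (0, t)] != 0,
                  forall t, n.@[vec2 (0, t)] = 0
                & phi = psubst D n / psubst D d].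

(* For P and D on the same surface: D passes through P iff the local ring of P
   is contained in that of D. *)
Definition lies_on (P : point) (D : curve) : Prop :=
  forall phi, regular_at P phi -> regular_along D phi.

Definition exceptional (P : point) : curve := blowup_chart1 P.

(* [iterated_blowup X ch]: X is an iterated blow-up of CP^2, and ch is its
   chain, starting anywhere in the cyclic order, each curve D_s of the chain
   being recorded as (s, D_s). *)
Inductive iterated_blowup :
    surface -> seq ((int * int) * curve) -> Prop :=
| IB_cp2 : (* X = 0, Y = 0 and Z = 0 *)
    iterated_blowup cp2 [:: ((1, 0), (rx C, ry C)); ((0, 1), (ry C, rx C));
                            ((-1, -1), (1 / rx C, ry C / rx C))]
| IB_rot X ch k : iterated_blowup X ch -> iterated_blowup X (rot k ch)
| IB_intersection X u D v E ch P :
    iterated_blowup X [:: (u, D), (v, E) & ch] ->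
    X P.1 -> lies_on P D -> lies_on P E ->
    iterated_blowup (blowup X P)
      [:: (u, D), (u + v, exceptional P), (v, E) & ch]
| IB_other X ch P :
    iterated_blowup X ch -> X P.1 ->
    (forall e e', e \in ch -> e' \in ch ->
       lies_on P e.2 -> lies_on P e'.2 -> e = e') ->
    iterated_blowup (blowup X P) ch.

(* The rational map f, written in the affine planes of D and E, is defined at
   the generic point of D, sends D into E, and is not constant on D. *)
Definition maps_curve_onto (f : ratfun C * ratfun C) (D E : curve) : Prop :=
  [/\ vanishes_along D (rsubst f E.1), regular_along D (rsubst f E.2)
    & forall a, ~ vanishes_along D (rsubst f E.2 - ratC a)].

End BlowUps.

(* The set S. *)
Definition primvec : Type := {v : int * int | coprimez v.1 v.2}.

(* D is the curve D_s. *)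
Definition chain_curve (C : fieldType) (s : primvec) (D : curve C) : Prop :=
  exists X ch, iterated_blowup X ch /\ (val s, D) \in ch.

(* f(D_s) = D_s' *)
Definition maps_chain_curve (C : fieldType) (f : ratfun C * ratfun C)
    (s s' : primvec) : Prop :=
  exists D E, [/\ chain_curve s D, chain_curve s' E & maps_curve_onto f D E].

Definition wedge (u v : int * int) : int := u.1 * v.2 - u.2 * v.1.

(* Turning counterclockwise from a one meets b, then c, before returning to a.
   Of the three angles from a to b, from b to c and from c to a, in [0, 2 pi[,
   none is 0 and the sum is 2 pi (rather than 4 pi) iff at least two of them
   are in ]0, pi[. *)
Definition counterclockwise (a b c : primvec) : bool :=
  let ab := 0 < wedge (val a) (val b) in
  let bc := 0 < wedge (val b) (val c) in
  let ca := 0 < wedge (val c) (val a) in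
  [|| ab && bc, bc && ca | ca && ab].

Definition clockwise (a b c : primvec) : bool := counterclockwise c b a.

(* The vector a s_i + b s_(i+1), the index i + 1 being taken modulo n. *)
Definition cone_vec (n : nat) (s : 'I_n -> primvec) (i : 'I_n) (a b : nat)
    : int * int :=
  val (s i) *+ a + val (s (ordS i)) *+ b.

(* The cones spanned by s_i and s_(i+1) decompose Z^2: they cover it, and the
   interior of a cone does not meet the other cones. *)
Definition cones_decompose (n : nat) (s : 'I_n -> primvec) : Prop :=
  (forall w : int * int, exists i a b, w = cone_vec s i a b) /\
  (forall i j a b a' b', (0 < a)%N -> (0 < b)%N ->
     cone_vec s i a b = cone_vec s j a' b' -> i = j).

Definition piecewise_linear (g : primvec -> primvec) : Prop :=
  [/\ bijective g,
      forall a b c, counterclockwise (g a) (g b) (g c) = counterclockwise a b c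
    & exists (n : nat) (s : 'I_n -> primvec),
      [/\ forall i j k : 'I_n, (i < j < k)%N -> clockwise (s i) (s j) (s k),
          forall i, wedge (val (s (ordS i))) (val (s i)) = 1,
          cones_decompose s
        & forall i a b (w : primvec), val w = cone_vec s i a b ->
            val (g w) = cone_vec (g \o s) i a b]].

Record thompson := Thompson {
  thompson_map :> primvec -> primvec;
  thompson_mapP : piecewise_linear thompson_map }.

(* Main.v *)
Require Import Defs.
From HB Require Import structures.
From mathcomp Require Import all_boot all_order all_algebra.
From mathcomp Require Import boolp reals.
From mathcomp Require Import complex mpoly.
From mathcomp Require Import zify ring.

Set Implicit Arguments.
Unset Strict Implicit.
Unset Printing Implicit Defensive.

Import Order.TTheory GRing.Theory Num.Theory.

Local Open Scope ring_scope.

(** A chain curve D_s is, as far as rational functions are concerned, the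
    monomial valuation v_s, whose value at x^i y^j is s.1 * i + s.2 * j, and
    f_*(s) has to be (v_s(f_1), v_s(f_2)), the values of v_s \o f^* at x and y.

    That v_s \o f^* is again a monomial valuation is the heart of the matter.
    Write d phi /\ d psi = {phi, psi} omega.  A monomial valuation v satisfies
    v {phi, psi} >= v(phi) + v(psi), because the bracket of two monomials is a
    multiple of their product, and f^* preserves the bracket because f
    preserves omega.  Hence nu = v_s \o f^* satisfies the same inequality, and
    the polynomials with nu >= k are stable under x d/dx = {-, y} / y and
    y d/dy = {x, -} / x.  In characteristic 0 such a space of polynomials is
    spanned by monomials, so that nu is the monomial valuation with the same
    values at x and y ([rval_rsubst]).  Functoriality follows
    ([trop_comp]).

    The map w |-> (v_w(f_1), v_w(f_2)) is given by differences of minima of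
    finitely many linear forms, hence linear on the cones of a sufficiently fine unimodular
    fan, obtained by inserting mediants ([fan_sep]).  On each cone f_1 and f_2
    have leading Laurent monomials of exponents e and e'; comparing leading
    terms in {f_1, f_2} = f_1 f_2 gives e /\ e' = 1, so that the linear map is
    unimodular and positively oriented ([trop_linear]).  An injective map that
    is linear and positively oriented on the cones of a fan preserves the
    cyclic order: the images of the cones follow each other without overlap,
    so that they wind once around the origin ([ccw_sorted]).

    What remains is to identify the local ring of any curve D_s of any iterated
    blow-up with the valuation ring of v_s ([chain_curve_represents]).  By
    induction on the blow-ups, a point of two neighbouring chain curves D_u and
    D_v has the local ring of the origin of the affine toric plane of the cone
    spanned by u and v; blowing it up subdivides the cone, whereas the
    monomial valuations nonnegative on the local ring of any other point are
    collinear, and this is inherited by the points over it ([iterated_blowup_inv]).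
    Blowing up toric corners only, along Euclid's algorithm, produces every
    D_s ([chain_curve_exists]). *)

Local Notation "p %:F" := (@FracField.tofrac _ p).

(* Conversion must not unfold fractions to their chosen representatives. *)
#[global] Opaque num den rsubst rderiv.

(** * Monomial valuations *)

Definition wt (w : int * int) (m : 'X_{1..2}) : int :=
  w.1 * (m ord0)%:Z + w.2 * (m ord_max)%:Z.

Lemma wtD w m1 m2 : wt w (m1 + m2)%MM = wt w m1 + wt w m2.
Proof. by rewrite /wt !mnmDE !PoszD; ring. Qed.

Lemma wt0 w : wt w 0%MM = 0.
Proof. by rewrite /wt !mnm0E !mulr0. Qed.

Definition pval (C : fieldType) (w : int * int) (p : {mpoly C[2]}) : int :=
  \big[Order.min/wt w (mlead p)]_(m <- msupp p) wt w m.

(** The monomial valuation with values w.1 at x and w.2 at y.  At 0, where a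
    valuation is infinite, it takes a finite default value. *)
HB.lock Definition rval (C : fieldType) (w : int * int) (phi : ratfun C) : int :=
  pval w (num phi) - pval w (den phi).

Section MonomialValuation.
Variable C : fieldType.
Implicit Types (p q n d : {mpoly C[2]}) (phi psi : ratfun C) (w : int * int).

Lemma pval_le w p m : m \in msupp p -> pval w p <= wt w m.
Proof.
rewrite /pval; elim: (msupp p) => // a s IH.
rewrite inE big_cons ge_min => /orP[/eqP->|/IH->]; first by rewrite lexx.
by rewrite orbT.
Qed.

Lemma pval_attained w p : p != 0 ->
  exists2 m, m \in msupp p & wt w m = pval w p.
Proof.
move=> p0; rewrite /pval.
have: forall s, {subset s <= msupp p} -> exists2 m, m \in msupp p
    & wt w m = \big[Order.min/wt w (mlead p)]_(m <- s) wt w m.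
  elim=> [_|a s IH sub].
    by exists (mlead p); rewrite ?mlead_supp ?big_nil.
  have [|m ms Em] := IH; first by move=> x xs; apply: sub; rewrite inE xs orbT.
  rewrite big_cons minEle; case: ifP => _; last by exists m.
  by exists a => //; apply: sub; rewrite inE eqxx.
by move/(_ _ (fun _ => id)).
Qed.

Lemma pval_ge w p k : p != 0 ->
  (k <= pval w p) <-> (forall m, m \in msupp p -> k <= wt w m).
Proof.
move=> p0; split=> [kp m /(pval_le w)|H]; first exact: le_trans.
by have [m mp <-] := pval_attained w p0; exact: H.
Qed.

Definition pge w k p : Prop := forall m, m \in msupp p -> k <= wt w m.

Lemma pge_coef w k p : pge w k p <-> forall m, wt w m < k -> p@_m = 0.
Proof.
split=> [H m lt|H m].
  by apply: memN_msupp_eq0; apply: contraTN lt => /H; rewrite -leNgt.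
by rewrite mcoeff_msupp => n0; rewrite leNgt; apply: contraNN n0 => /H ->.
Qed.

Lemma pgeD w k p q : pge w k p -> pge w k q -> pge w k (p + q).
Proof.
by move=> /pge_coef P /pge_coef Q; apply/pge_coef=> m lt; rewrite mcoeffD P // Q // addr0.
Qed.

Lemma pgeN w k p : pge w k p -> pge w k (- p).
Proof.
by move=> /pge_coef P; apply/pge_coef=> m lt; rewrite mcoeffN P // oppr0.
Qed.

Lemma pgeB w k p q : pge w k p -> pge w k q -> pge w k (p - q).
Proof. by move=> P Q; apply/pgeD/pgeN. Qed.

Lemma pgeM w k l p q : pge w k p -> pge w l q -> pge w (k + l) (p * q).
Proof.
move=> P Q m /msuppM_le /allpairsP [[a b] /= [ap bq ->]].
by rewrite wtD lerD // ?P ?Q.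
Qed.

Lemma pge_le w k l p : k <= l -> pge w l p -> pge w k p.
Proof. by move=> kl P m /P; exact: le_trans. Qed.

Definition part w k p : {mpoly C[2]} :=
  \sum_(m <- msupp p | wt w m == k) p@_m *: 'X_[m].

Lemma mcoeff_part w k p m : (part w k p)@_m = if wt w m == k then p@_m else 0.
Proof.
rewrite /part raddf_sum /=.
under eq_bigr do rewrite mcoeffZ mcoeffX.
have [mp|mp] := boolP (m \in msupp p); last first.
  rewrite big1_seq ?(memN_msupp_eq0 mp) ?if_same // => x /andP[_ xp].
  by case: eqP => [xm|]; rewrite ?mulr0 //; rewrite -xm xp in mp.
rewrite big_mkcond (bigD1_seq m) ?msupp_uniq //= eqxx mulr1 big1_seq ?addr0 //.
by move=> x /andP[/negPf -> _]; rewrite mulr0 if_same.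
Qed.

Lemma part_rest w k p : pge w k p -> pge w (k + 1) (p - part w k p).
Proof.
move/pge_coef=> P; apply/pge_coef=> m; rewrite ltzD1 => lt.
rewrite mcoeffB mcoeff_part; case: eqP => [_|/eqP ne]; first by rewrite subrr.
by rewrite P ?subrr // lt_neqAle ne.
Qed.

Lemma part_pge w k p : pge w k (part w k p).
Proof.
by apply/pge_coef => m lt; rewrite mcoeff_part; case: eqP lt => // ->; rewrite ltxx.
Qed.

Lemma part_neq0 w p : p != 0 -> part w (pval w p) p != 0.
Proof.
move=> p0; have [m mp wm] := pval_attained w p0.
apply/eqP => /(congr1 (mcoeff m)); rewrite mcoeff_part wm eqxx mcoeff0 => /eqP.
by rewrite mcoeff_eq0 mp.
Qed.

Lemma pval_pge w p : pge w (pval w p) p.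
Proof. by move=> m; exact: pval_le. Qed.

Lemma pge_pval w k p : p != 0 -> pge w k p -> k <= pval w p.
Proof. by move=> p0 P; apply/pval_ge. Qed.

(** The lowest parts multiply, and their product is nonzero because the
    polynomials form an integral domain. *)
Lemma pvalM w p q : p != 0 -> q != 0 -> pval w (p * q) = pval w p + pval w q.
Proof.
move=> p0 q0; set k := pval w p; set l := pval w q.
have pq0 : p * q != 0 by rewrite mulf_neq0.
apply/le_anti/andP; split; last first.
  by apply: pge_pval => //; apply: pgeM; exact: pval_pge.
set P := part w k p; set Q := part w l q.
have PQ0 : P * Q != 0 by rewrite mulf_neq0 ?part_neq0.
have R : pge w (k + l + 1) (p * q - P * Q).
  have -> : p * q - P * Q = (p - P) * q + P * (q - Q) by ring.
  apply: pgeD.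
    rewrite addrAC; apply: pgeM; last exact: pval_pge.
    exact/part_rest/pval_pge.
  by rewrite -addrA; apply: pgeM; [exact: part_pge | exact/part_rest/pval_pge].
have /pval_attained -/(_ w) [m mPQ _] := PQ0.
have wm : wt w m = k + l.
  have /allpairsP [[a b] /= [aP bQ ->]] := msuppM_le mPQ.
  move: aP bQ; rewrite wtD !mcoeff_msupp !mcoeff_part.
  case: (wt w a =P k) => [->|]; case: (wt w b =P l) => [->|] //; by rewrite eqxx.
rewrite -wm; apply: pval_le.
rewrite mcoeff_msupp -[p * q](subrK (P * Q)) mcoeffD.
rewrite (proj1 (pge_coef _ _ _) R) ?add0r -?mcoeff_msupp //.
by rewrite wm ltzD1.
Qed.

Lemma pvalC w (a : C) : a != 0 -> pval w a%:MP = 0.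
Proof.
move=> a0; have c0 : a%:MP != 0 :> {mpoly C[2]} by rewrite mpolyC_eq0.
have [m + <-] := pval_attained w c0.
by rewrite msuppC (negPf a0) inE => /eqP ->; rewrite wt0.
Qed.

Lemma pval1 w : pval w (1 : {mpoly C[2]}) = 0.
Proof. by rewrite -mpolyC1 pvalC ?oner_neq0. Qed.

Lemma pvalX w m : pval w ('X_[m] : {mpoly C[2]}) = wt w m.
Proof.
have c0 : 'X_[m] != 0 :> {mpoly C[2]}.
  by rewrite -msupp_eq0 msuppX.
have [m' + <-] := pval_attained w c0.
by rewrite msuppX inE => /eqP ->.
Qed.

Lemma rval_frac w n d : n != 0 -> d != 0 ->
  rval w (n%:F / d%:F) = pval w n - pval w d.
Proof.
move=> n0 d0; set phi := n%:F / d%:F.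
have phi0 : phi != 0 by rewrite mulf_neq0 ?invr_eq0 ?tofrac_eq0.
have e0 := den_neq0 phi.
have m0 : num phi != 0.
  by apply: contraNneq phi0 => m0; rewrite [phi]ratfunE m0 tofrac0 mul0r.
have E : num phi * d = n * den phi.
  apply/eqP; rewrite -tofrac_eq !tofracM -eqr_div ?tofrac_eq0 //.
  by rewrite -ratfunE.
have := congr1 (pval w) E; rewrite !pvalM // rval.unlock.
by move=> H; apply/eqP; rewrite subr_eq addrAC eq_sym subr_eq H.
Qed.

Lemma ratfun_ind (P : ratfun C -> Prop) :
  P 0 -> (forall n d, n != 0 -> d != 0 -> P (n%:F / d%:F)) -> forall phi, P phi.
Proof.
move=> P0 PF phi; rewrite [phi]ratfunE.
have [->|n0] := eqVneq (num phi) 0; first by rewrite tofrac0 mul0r.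
exact/PF/den_neq0.
Qed.

Lemma rval_poly w p : p != 0 -> rval w p%:F = pval w p.
Proof.
move=> p0; rewrite -[p%:F]divr1 -tofrac1 rval_frac ?oner_neq0 //.
by rewrite pval1 subr0.
Qed.

Lemma rvalM w phi psi : phi != 0 -> psi != 0 ->
  rval w (phi * psi) = rval w phi + rval w psi.
Proof.
elim/ratfun_ind: phi => [|n d n0 d0]; first by rewrite eqxx.
elim/ratfun_ind: psi => [|m e m0 e0]; first by rewrite eqxx.
move=> _ _; rewrite mulf_div -!tofracM !rval_frac ?mulf_neq0 // !pvalM //.
by ring.
Qed.

Lemma rval1 w : rval w (1 : ratfun C) = 0.
Proof. by rewrite -tofrac1 rval_poly ?oner_neq0 // pval1. Qed.

Lemma rvalV w phi : phi != 0 -> rval w phi^-1 = - rval w phi.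
Proof.
move=> p0; have q0 : phi^-1 != 0 by rewrite invr_eq0.
by apply/eqP; rewrite -addr_eq0 -(rvalM w q0 p0) (mulVf p0) rval1.
Qed.

Lemma rvalC w (a : C) : a != 0 -> rval w (ratC a) = 0.
Proof. by move=> a0; rewrite /ratC rval_poly ?mpolyC_eq0 // pvalC. Qed.

Lemma rx_neq0 : rx C != 0.
Proof. by rewrite tofrac_eq0 -msupp_eq0 msuppX. Qed.

Lemma ry_neq0 : ry C != 0.
Proof. by rewrite tofrac_eq0 -msupp_eq0 msuppX. Qed.

Lemma rval_rx w : rval w (rx C) = w.1.
Proof.
rewrite rval_poly -?(tofrac_eq0 'X_ord0) ?rx_neq0 // pvalX /wt !mnm1E /=.
by rewrite mulr1 mulr0 addr0.
Qed.

Lemma rval_ry w : rval w (ry C) = w.2.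
Proof.
rewrite rval_poly -?(tofrac_eq0 'X_ord_max) ?ry_neq0 // pvalX /wt !mnm1E /=.
by rewrite mulr1 mulr0 add0r.
Qed.

(** The fractional ideals of the valuation; in contrast to an inequality on
    rval, membership holds at 0. *)
Definition rge w (k : int) phi : Prop := phi != 0 -> k <= rval w phi.

Lemma rge0 w k : rge w k 0.
Proof. by rewrite /rge eqxx. Qed.

Lemma rge_rval w phi : rge w (rval w phi) phi.
Proof. by rewrite /rge lexx. Qed.

Lemma rge_poly w k p : pge w k p -> rge w k p%:F.
Proof.
by move=> P; rewrite /rge tofrac_eq0 => p0; rewrite rval_poly // pge_pval.
Qed.

Lemma rge_fracE w k n d : n != 0 -> d != 0 ->
  rge w k (n%:F / d%:F) <-> k <= pval w n - pval w d.
Proof.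
move=> n0 d0; rewrite /rge (rval_frac w n0 d0) mulf_eq0 invr_eq0 !tofrac_eq0.
by rewrite (negPf n0) (negPf d0); split=> // /(_ isT).
Qed.

Lemma rge_frac w k l n d : d != 0 ->
  pge w k n -> pval w d = l -> rge w (k - l) (n%:F / d%:F).
Proof.
move=> d0 P <-; have [->|n0] := eqVneq n 0.
  by rewrite tofrac0 mul0r; exact: rge0.
by apply/rge_fracE => //; rewrite lerD2r pge_pval.
Qed.

Lemma rge_le w k l phi : k <= l -> rge w l phi -> rge w k phi.
Proof. by move=> kl P /P; exact: le_trans. Qed.

Lemma rgeM w k l phi psi : rge w k phi -> rge w l psi ->
  rge w (k + l) (phi * psi).
Proof.
move=> P Q; rewrite /rge mulf_eq0 negb_or => /andP[p0 q0].
by rewrite (rvalM w p0 q0); exact: lerD (P p0) (Q q0).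
Qed.

Lemma rgeD w k phi psi : rge w k phi -> rge w k psi -> rge w k (phi + psi).
Proof.
elim/ratfun_ind: phi => [|n d n0 d0]; first by rewrite add0r.
elim/ratfun_ind: psi => [|m e m0 e0]; first by rewrite addr0.
have dF : d%:F != 0 by rewrite tofrac_eq0.
have eF : e%:F != 0 by rewrite tofrac_eq0.
move=> /(rge_fracE _ _ n0 d0) P /(rge_fracE _ _ m0 e0) Q.
rewrite (addf_div _ _ dF eF) -!tofracM -tofracD.
have -> : k = k + pval w (d * e) - pval w (d * e) by rewrite addrK.
apply: rge_frac; rewrite ?mulf_neq0 //; rewrite pvalM //.
apply: pgeD.
  apply: pge_le (pgeM (pval_pge w (p := n)) (pval_pge w (p := e))).
  by rewrite addrA lerD2r -lerBrDr.
apply: pge_le (pgeM (pval_pge w (p := m)) (pval_pge w (p := d))).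
by rewrite addrCA addrC lerD2r -lerBrDr.
Qed.

Lemma rgeC w (a : C) : rge w 0 (ratC a).
Proof.
have [->|a0] := eqVneq a 0; first by rewrite raddf0; exact: rge0.
by move=> _; rewrite rvalC.
Qed.

Lemma rgeN w k phi : rge w k phi -> rge w k (- phi).
Proof.
move=> P; have -> : - phi = ratC (-1) * phi by rewrite rmorphN1 mulN1r.
by rewrite -[k]add0r; apply: rgeM P; exact: rgeC.
Qed.

Lemma rgeB w k phi psi : rge w k phi -> rge w k psi -> rge w k (phi - psi).
Proof. by move=> P Q; apply/rgeD/rgeN. Qed.

Lemma rge_sum w k (I : eqType) (s : seq I) (F : I -> ratfun C) :
  (forall i, i \in s -> rge w k (F i)) -> rge w k (\sum_(i <- s) F i).
Proof.
move=> H; rewrite big_seq; apply: big_ind; [exact: rge0 | exact: rgeD | exact: H].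
Qed.

Lemma rge_divr w k phi psi : psi != 0 ->
  rge w k (phi * psi) -> rge w (k - rval w psi) phi.
Proof.
move=> p0 H f0; have := H (mulf_neq0 f0 p0).
by rewrite (rvalM w f0 p0) lerBlDr.
Qed.

(** * The Poisson bracket *)

(** x d/dx for i = 0, and y d/dy for i = 1: these preserve weights. *)
Definition pdlog (i : 'I_2) p : {mpoly C[2]} := 'X_i * p^`M(i).

Definition rdlog (i : 'I_2) phi : ratfun C := ('X_i : {mpoly C[2]})%:F * rderiv i phi.

Lemma mcoeff_pdlog i p m : (pdlog i p)@_m = p@_m *+ m i.
Proof.
rewrite /pdlog; have [mi|mi] := posnP (m i); last first.
  have [k ->] : exists k, m = (U_(i) + k)%MM.
    exists (m - U_(i))%MM; rewrite addmC submK //.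
    by apply/mnm_lepP => j; rewrite mnm1E; case: eqP => [<-|].
  by rewrite ['X_i * _]mulrC mcoeffMX mcoeff_mderiv [(_ + k)%MM]addmC mnmDE mnm1E eqxx addn1.
rewrite mi mulr0n; apply: memN_msupp_eq0; rewrite ['X_i * _]mulrC (perm_mem (msuppMX _ _)).
apply/negP => /mapP [k _ /mnmP /(_ i)].
by rewrite mnmDE mnm1E eqxx mi.
Qed.

Lemma rdlog_poly i p : rdlog i p%:F = (pdlog i p)%:F.
Proof. by rewrite /rdlog rderiv_poly -tofracM. Qed.

Lemma rdlogM i phi psi : rdlog i (phi * psi) = rdlog i phi * psi + phi * rdlog i psi.
Proof. by rewrite /rdlog rderivM; ring. Qed.

Lemma pge_pdlog w k i p : pge w k p -> pge w k (pdlog i p).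
Proof.
by move=> /pge_coef P; apply/pge_coef=> m lt; rewrite mcoeff_pdlog P // mul0rn.
Qed.

Lemma rge_rdlog w k i phi : rge w k phi -> rge w k (rdlog i phi).
Proof.
elim/ratfun_ind: phi => [_|n d n0 d0].
  by rewrite -tofrac0 rdlog_poly /pdlog mderiv0 mulr0; exact: rge0.
move=> /(rge_fracE _ _ n0 d0) H.
rewrite /rdlog rderiv_frac // mulrA -tofracM.
have -> : 'X_i * (n^`M(i) * d - n * d^`M(i)) = pdlog i n * d - n * pdlog i d.
  by rewrite /pdlog; ring.
apply: rge_le H _.
have -> : pval w n - pval w d = pval w n + pval w d - (pval w d + pval w d).
  by ring.
apply: rge_frac; rewrite ?expf_neq0 //; last by rewrite expr2 pvalM.
by apply: pgeB; apply: pgeM; do ?apply: pge_pdlog; exact: pval_pge.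
Qed.

(** The bracket of the symplectic form: d phi /\ d psi = brk phi psi * omega. *)
Definition brk phi psi : ratfun C :=
  rdlog ord0 phi * rdlog ord_max psi - rdlog ord_max phi * rdlog ord0 psi.

Lemma rge_brk w k l phi psi : rge w k phi -> rge w l psi ->
  rge w (k + l) (brk phi psi).
Proof. by move=> P Q; apply: rgeB; apply: rgeM; exact: rge_rdlog. Qed.

Lemma rdlog_rx : (rdlog ord0 (rx C) = rx C) * (rdlog ord_max (rx C) = 0).
Proof.
rewrite /rx !rdlog_poly /pdlog !mderivX !mnm1E /=; split; last first.
  by rewrite scale0r mulr0 tofrac0.
rewrite (_ : U_(ord0) - U_(ord0) = 0)%MM ?mpolyX0 ?scale1r ?mulr1 //.
by rewrite -{1}[U_(ord0)%MM]add0m addmK.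
Qed.

Lemma rdlog_ry : (rdlog ord0 (ry C) = 0) * (rdlog ord_max (ry C) = ry C).
Proof.
rewrite /ry !rdlog_poly /pdlog !mderivX !mnm1E /=; split.
  by rewrite scale0r mulr0 tofrac0.
rewrite (_ : U_(ord_max) - U_(ord_max) = 0)%MM ?mpolyX0 ?scale1r ?mulr1 //.
by rewrite -{1}[U_(ord_max)%MM]add0m addmK.
Qed.

Lemma brk_ry phi : brk phi (ry C) = rdlog ord0 phi * ry C.
Proof. by rewrite /brk !rdlog_ry mulr0 subr0. Qed.

Lemma brk_rx phi : brk (rx C) phi = rx C * rdlog ord_max phi.
Proof. by rewrite /brk !rdlog_rx mul0r subr0. Qed.

End MonomialValuation.

(** * Transport of monomial valuations *)

(** The values at x and y of the pullback of the monomial valuation w. *)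
Definition trop (C : fieldType) (f : ratfun C * ratfun C) (w : int * int) :=
  (rval w f.1, rval w f.2).

Section Transport.
Variable C : fieldType.
Implicit Types (p : {mpoly C[2]}) (phi psi : ratfun C) (w : int * int).
Implicit Types (f g : ratfun C * ratfun C).

Lemma natr_pchar0_inj (F : fieldType) : [pchar F] =i pred0 ->
  injective (fun n : nat => n%:R : F).
Proof.
move=> /pcharf0P H m n; wlog le : m n / (m <= n)%N => [W|].
  by case: (leqP m n) => [/W //|/ltnW/W I /esym/I ->].
move=> /eqP; rewrite eq_sym -subr_eq0 -natrB // H subn_eq0 => nm.
by apply/eqP; rewrite eqn_leq le.
Qed.

Lemma ord2 (i : 'I_2) : i = ord0 \/ i = ord_max.
Proof.
case: i => [[|[|//]] li]; [left|right]; exact/val_inj.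
Qed.

Lemma rsubst_rx f : dominant f -> rsubst f (rx C) = f.1.
Proof. by move=> domf; rewrite (rsubst_poly domf) psubstX. Qed.

Lemma rsubst_ry f : dominant f -> rsubst f (ry C) = f.2.
Proof. by move=> domf; rewrite (rsubst_poly domf) psubstX. Qed.

Lemma psubstB f p q : psubst f (p - q) = psubst f p - psubst f q.
Proof. exact: raddfB. Qed.

Lemma psubst_monomial f (m : 'X_{1..2}) :
  psubst f 'X_[m] = f.1 ^+ m ord0 * f.2 ^+ m ord_max.
Proof.
rewrite /psubst mmapX /mmap1 big_ord_recl big_ord1 /vec2 /=.
by congr (_ * _ ^+ m _); exact/val_inj.
Qed.

Lemma psubst_mpolyE f p :
  psubst f p = \sum_(m <- msupp p) ratC p@_m * psubst f 'X_[m].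
Proof.
rewrite {1}[p]mpolyE raddf_sum; apply: eq_bigr => m _.
by rewrite -mul_mpolyC -[LHS]/(psubst f _) psubstM psubstC.
Qed.

Lemma rvalX w phi k : phi != 0 -> rval w (phi ^+ k) = rval w phi * k%:Z.
Proof.
move=> p0; elim: k => [|k IH]; first by rewrite expr0 rval1 mulr0.
by rewrite exprS (rvalM w p0 (expf_neq0 k p0)) IH intS mulrDr mulr1.
Qed.

Section Symplectic.
Variable f : ratfun C * ratfun C.
Hypothesis domf : dominant f.

Lemma dominant_neq0 : (f.1 != 0) * (f.2 != 0).
Proof.
split; first by rewrite -(rsubst_rx domf) (rsubst_eq0 domf) rx_neq0.
by rewrite -(rsubst_ry domf) (rsubst_eq0 domf) ry_neq0.
Qed.

Lemma rval_psubstX w m : rval w (psubst f 'X_[m]) = wt (trop f w) m.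
Proof.
have [f1 f2] := dominant_neq0.
rewrite psubst_monomial (rvalM w (expf_neq0 _ f1) (expf_neq0 _ f2)).
by rewrite (rvalX w _ f1) (rvalX w _ f2).
Qed.

Lemma psubstX_neq0 (m : 'X_{1..2}) : psubst f 'X_[m] != 0.
Proof. by apply: (psubst_neq0 domf); rewrite -msupp_eq0 msuppX. Qed.

Hypothesis char0 : [pchar C] =i pred0.
Hypothesis brkf : brk f.1 f.2 = f.1 * f.2.

(** The chain rule, the hypothesis saying that f preserves the form. *)
Lemma rsubst_brk phi psi :
  rsubst f (brk phi psi) = brk (rsubst f phi) (rsubst f psi).
Proof.
rewrite /brk /rdlog -/(rx C) -/(ry C) !(rderiv_rsubst domf).
move: (rderiv ord0 phi) (rderiv ord_max phi) => a b.
move: (rderiv ord0 psi) (rderiv ord_max psi) => c d.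
rewrite (rsubstD domf) (rsubstN domf) !(rsubstM domf) (rsubst_rx domf) (rsubst_ry domf).
move: (rsubst f a) (rsubst f b) (rsubst f c) (rsubst f d) => {}a {}b {}c {}d.
move: brkf; rewrite /brk /rdlog -/(rx C) -/(ry C) => E.
transitivity (f.1 * f.2 * (a * d - b * c)); first by ring.
by rewrite -E; ring.
Qed.

(** The elements of valuation at least k are stable under x d/dx and y d/dy,
    since these are brackets with a coordinate, divided by the other one. *)
Lemma rge_rsubst_rdlog w k i phi :
  rge w k (rsubst f phi) -> rge w k (rsubst f (rdlog i phi)).
Proof.
have [f1 f2] := dominant_neq0.
move=> H.
have [->|->] := ord2 i.
  rewrite (_ : k = k + rval w f.2 - rval w f.2); last by rewrite addrK.
  apply: (rge_divr f2); rewrite -[X in _ * X](rsubst_ry domf) -(rsubstM domf) -brk_ry.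
  rewrite rsubst_brk (rsubst_ry domf); exact: rge_brk H (@rge_rval _ _ _).
rewrite (_ : k = rval w f.1 + k - rval w f.1); last by rewrite addrC addKr.
apply: (rge_divr f1); rewrite -[X in _ * X](rsubst_rx domf) -(rsubstM domf).
rewrite mulrC -brk_rx rsubst_brk (rsubst_rx domf); exact: rge_brk (@rge_rval _ _ _) H.
Qed.

(** Monomials are the common eigenvectors of x d/dx and y d/dy, and distinct
    ones are separated by the eigenvalues in characteristic 0; a stable
    subspace contains the monomials of each of its elements.  The induction
    kills one monomial m' of p at a time. *)
Lemma rge_psubst_support w k p :
  rge w k (psubst f p) -> forall m, m \in msupp p -> k <= wt (trop f w) m.
Proof.
have [s] := ubnP (size (msupp p)); elim: s p => // s IH p sp Hp m mp.
have [/hasP [m' m'p /= m'm]|/hasPn one] := boolP (has (predC1 m) (msupp p)).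
  have [i mi] : exists i, m i != m' i.
    apply/existsP; rewrite -negb_forall; apply: contraNN m'm => /forallP H.
    by apply/eqP/mnmP => i; apply/esym/eqP/H.
  set q := pdlog i p - (m' i)%:R *: p.
  have qE k' : q@_k' = p@_k' * ((k' i)%:R - (m' i)%:R).
    by rewrite mcoeffB mcoeff_pdlog mcoeffZ mulrBr mulr_natr (mulrC p@_k' (m' i)%:R).
  have sq : {subset msupp q <= rem m' (msupp p)}.
    move=> x; rewrite mcoeff_msupp qE mulf_eq0 negb_or -mcoeff_msupp.
    case/andP=> xp xm; rewrite (mem_rem_uniq _ (msupp_uniq p)) inE xp andbT.
    by apply: contraNneq xm => ->; rewrite subrr.
  apply: (IH q).
  - apply: leq_ltn_trans (uniq_leq_size (msupp_uniq q) sq) _.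
    by rewrite size_rem // -ltnS prednK //; case: (msupp p) m'p.
  - rewrite /q -mul_mpolyC psubstB psubstM psubstC; apply: rgeB.
      rewrite -(rsubst_poly domf) -rdlog_poly.
      by apply: rge_rsubst_rdlog; rewrite (rsubst_poly domf).
    by rewrite -[k]add0r; apply: rgeM Hp; exact: rgeC.
  rewrite mcoeff_msupp qE mulf_eq0 negb_or -mcoeff_msupp mp subr_eq0.
  by apply: contraNneq mi => /(natr_pchar0_inj char0) ->.
have c0 : p@_m != 0 by rewrite -mcoeff_msupp.
have E : psubst f p = ratC p@_m * psubst f 'X_[m].
  rewrite psubst_mpolyE (bigD1_seq m mp (msupp_uniq p)) /= big1_seq ?addr0 // => x.
  by case/andP=> xm /one; rewrite /= xm.
have C0 : ratC p@_m != 0 by rewrite fmorph_eq0.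
have X0 := psubstX_neq0 m.
have := Hp; rewrite /rge E => /(_ (mulf_neq0 C0 X0)).
by rewrite (rvalM w C0 X0) (rvalC w c0) add0r rval_psubstX.
Qed.

Lemma rval_psubst w p : p != 0 -> rval w (psubst f p) = pval (trop f w) p.
Proof.
move=> p0; have F0 := psubst_neq0 domf p0.
apply/le_anti/andP; split.
  by apply: (pge_pval p0); apply: rge_psubst_support => _.
have: rge w (pval (trop f w) p) (psubst f p); last exact.
rewrite psubst_mpolyE; apply: rge_sum => m mp.
rewrite -[pval _ _]add0r; apply: rgeM; first exact: rgeC.
by move=> _; rewrite rval_psubstX pval_le.
Qed.

(** A valuation compatible with the bracket is monomial, by
    [rge_psubst_support]; that of phi |-> rval w (rsubst f phi) is inherited
    from rval w. *)
Theorem rval_rsubst w phi : phi != 0 ->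
  rval w (rsubst f phi) = rval (trop f w) phi.
Proof.
elim/ratfun_ind: phi => [|n d n0 d0 _]; first by rewrite eqxx.
have N0 := psubst_neq0 domf n0; have D0 := psubst_neq0 domf d0.
have D0' : (psubst f d)^-1 != 0 by rewrite invr_eq0.
rewrite (rsubst_frac domf n d0) (rval_frac _ n0 d0).
by rewrite (rvalM w N0 D0') (rvalV w D0) (rval_psubst w n0) (rval_psubst w d0).
Qed.

Lemma rge_rsubst w k phi : rge w k (rsubst f phi) <-> rge (trop f w) k phi.
Proof.
rewrite /rge (rsubst_eq0 domf); split=> H p0; have := H p0.
  by rewrite (rval_rsubst w p0).
by rewrite (rval_rsubst w p0).
Qed.

Lemma trop_comp g w : g.1 != 0 -> g.2 != 0 ->
  trop (rcomp g f) w = trop g (trop f w).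
Proof.
by move=> g1 g2; rewrite /trop /= (rval_rsubst w g1) (rval_rsubst w g2).
Qed.

End Symplectic.

Lemma trop_id w : trop (rid C) w = w.
Proof. by rewrite /trop rval_rx rval_ry; case: w. Qed.

(** Invariance of dx /\ dy / (x y), multiplied by x y f_1 f_2. *)
Lemma symplectic_brk f : symplectic f -> brk f.1 f.2 = f.1 * f.2.
Proof.
case=> [[domf _]]; rewrite /pullback /omega (rsubstM domf) (rsubst1 domf).
rewrite (rsubstV domf) (rsubstM domf) (rsubst_rx domf) (rsubst_ry domf).
have [f1 f2] := dominant_neq0 domf.
have x0 := rx_neq0 C; have y0 := ry_neq0 C.
rewrite /brk /rdlog -/(rx C) -/(ry C) => E.
transitivity (rx C * ry C * jac f); first by rewrite /jac; ring.
rewrite !mul1r in E; rewrite -[jac f](mulVKf (mulf_neq0 f1 f2)) E.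
by rewrite mulrCA (divff (mulf_neq0 x0 y0)) mulr1.
Qed.

End Transport.

(** * Unimodular fans of the plane *)

Definition lin (p : int * int) (a : int) (q : int * int) (b : int) : int * int :=
  (p.1 * a + q.1 * b, p.2 * a + q.2 * b).

(** Cramer's rule in a unimodular basis. *)
Lemma coneE p q w : wedge p q = 1 -> w = lin p (wedge w q) q (wedge p w).
Proof.
case: p q w => [p1 p2] [q1 q2] [w1 w2]; rewrite /lin /wedge /= => E.
by congr pair; rewrite -[LHS]mulr1 -E; ring.
Qed.

Lemma linC p a q b : lin p a q b = lin q b p a.
Proof. by rewrite /lin ![p.1 * a + _]addrC ![p.2 * a + _]addrC. Qed.

Lemma wedge_linl p a q b w : wedge (lin p a q b) w = a * wedge p w + b * wedge q w.
Proof. by rewrite /lin /wedge /=; ring. Qed.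

Lemma wedge_linr p a q b w : wedge w (lin p a q b) = a * wedge w p + b * wedge w q.
Proof. by rewrite /lin /wedge /=; ring. Qed.

Lemma wedgexx p : wedge p p = 0.
Proof. by rewrite /wedge mulrC subrr. Qed.

Lemma wedgeN p q : wedge q p = - wedge p q.
Proof. by rewrite /wedge; ring. Qed.

Lemma wedgeDl p q w : wedge (p + q) w = wedge p w + wedge q w.
Proof. by rewrite /wedge /=; ring. Qed.

Lemma wedgeDr p q w : wedge w (p + q) = wedge w p + wedge w q.
Proof. by rewrite /wedge /=; ring. Qed.

Lemma lin_inj p q a b a' b' : wedge p q = 1 ->
  lin p a q b = lin p a' q b' -> a = a' /\ b = b'.
Proof.
move=> pq E; have := congr1 (wedge^~ q) E; have := congr1 (wedge p) E.
by rewrite !wedge_linl !wedge_linr !wedgexx pq; lia.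
Qed.

Definition prim (v : int * int) : bool := coprimez v.1 v.2.

Lemma wedge_prim p q : wedge p q = 1 -> prim p /\ prim q.
Proof.
rewrite /wedge => E; split; apply/coprimezP.
  by exists (q.2, - q.1) => /=; lia.
by exists (- p.2, p.1) => /=; lia.
Qed.

Lemma prim_scale p a : 0 <= a -> prim (p.1 * a, p.2 * a) -> a = 1.
Proof.
move=> a0 /coprimezP [[u v] /= E].
have {E} : a * (u * p.1 + v * p.2) = 1 by rewrite -E; ring.
move: (_ + _) => x E; have [x0|x0] := lerP x 0; first by nia.
have [a1|a1] := lerP a 1; first by nia.
by nia.
Qed.

Lemma prim_neq0 p : prim p -> p != 0.
Proof. by apply: contraTneq => ->. Qed.

(** The cone spanned by p and q, without the ray of q: the coordinates of w in
    the basis are wedge w q and wedge p w. *)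
Definition incone (p q w : int * int) : bool :=
  (0 < wedge w q) && (0 <= wedge p w).

Lemma incone_mediant p q w : wedge p q = 1 ->
  incone p q w = incone p (p + q) w || incone (p + q) q w.
Proof.
move=> pq; rewrite /incone !wedgeDl !wedgeDr (wedgeN p w) (wedgeN w q).
move: (wedge p w) (wedge w q) => A B.
lia.
Qed.

Lemma incone_mediant_disjoint p q w : wedge p q = 1 ->
  ~~ (incone p (p + q) w && incone (p + q) q w).
Proof.
move=> pq; rewrite /incone !wedgeDl !wedgeDr (wedgeN p w) (wedgeN w q).
by move: (wedge _ _) (wedge _ _) => A B; lia.
Qed.

(** The rays t 0, ..., t (n - 1) in counterclockwise order, with t n = t 0:
    the half-open cones between consecutive ones partition the plane. *)
Definition fan (n : nat) (t : nat -> int * int) : Prop :=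
  [/\ t n = t 0%N, forall i, (i < n)%N -> wedge (t i) (t i.+1) = 1,
      forall w, w != 0 -> exists2 i, (i < n)%N & incone (t i) (t i.+1) w
    & forall w i j, (i < n)%N -> (j < n)%N ->
        incone (t i) (t i.+1) w -> incone (t j) (t j.+1) w -> i = j].

(** Inserts the mediant of any two consecutive rays. *)
Definition refine (t : nat -> int * int) (i : nat) : int * int :=
  if odd i then t i./2 + t i./2.+1 else t i./2.

Lemma refine_even t i : refine t i.*2 = t i.
Proof. by rewrite /refine odd_double doubleK. Qed.

Lemma refine_odd t i : refine t i.*2.+1 = t i + t i.+1.
Proof. by rewrite /refine /= odd_double uphalf_double. Qed.

Lemma refine_evenS t i : refine t i.*2.+2 = t i.+1.
Proof. by rewrite -doubleS refine_even. Qed.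

Definition refineE := (refine_even, refine_evenS, refine_odd).

Lemma half_cases i : i = i./2.*2 \/ i = i./2.*2.+1.
Proof.
have := odd_double_half i; case: (odd i) => <-; [right|left];
  by rewrite ?add0n ?add1n /= ?uphalf_double ?doubleK.
Qed.

Lemma fan_refine n t : fan n t -> fan n.*2 (refine t).
Proof.
case=> tn t1 tc tu.
have W i : (i < n.*2)%N -> (i./2 < n)%N by lia.
split.
- by rewrite refine_even -[0%N in RHS]double0 refine_even.
- move=> i /W; have [-> |->] := half_cases i; rewrite ?doubleK ?[(_.*2.+1)./2]uphalf_double.
    by move=> /t1 E; rewrite !refineE wedgeDr wedgexx E.
  by move=> /t1 E; rewrite !refineE wedgeDl wedgexx E.
- move=> w /tc [i ilt]; rewrite (incone_mediant _ (t1 i ilt)) => /orP[H|H].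
    by exists i.*2; rewrite ?ltn_double // !refineE.
  by exists i.*2.+1; rewrite ?refineE // -doubleS; lia.
have C w i : (i < n.*2)%N -> incone (refine t i) (refine t i.+1) w ->
    incone (t i./2) (t i./2.+1) w.
  move=> /W /t1 E; have [-> |->] := half_cases i.
    by rewrite !refineE doubleK (incone_mediant _ E) => ->.
  by rewrite !refineE /= uphalf_double (incone_mediant _ E) => ->; rewrite orbT.
move=> w i j ilt jlt Hi Hj.
have hij := tu _ _ _ (W _ ilt) (W _ jlt) (C _ _ ilt Hi) (C _ _ jlt Hj).
have D := incone_mediant_disjoint w (t1 _ (W _ ilt)).
move: Hi Hj; have [-> |->] := half_cases i; have [-> |->] := half_cases j;
  rewrite !refineE hij // => Hi Hj; rewrite hij in D.
- by rewrite Hi Hj in D.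
- by rewrite Hi Hj in D.
Qed.

Definition dot (w d : int * int) : int := w.1 * d.1 + w.2 * d.2.

Lemma dotDl p q d : dot (p + q) d = dot p d + dot q d.
Proof. by rewrite /dot /=; ring. Qed.

(** The linear form d does not change sign on the cone spanned by p and q. *)
Definition sep (d p q : int * int) : Prop := 0 <= dot p d * dot q d.

Lemma sep_refine n t d : (forall i, (i < n)%N -> sep d (t i) (t i.+1)) ->
  forall i, (i < n.*2)%N -> sep d (refine t i) (refine t i.+1).
Proof.
move=> H i ilt; have /H : (i./2 < n)%N by lia.
have [-> |->] := half_cases i; rewrite ?doubleK /= ?uphalf_double !refineE.
  by rewrite /sep dotDl; nia.
by rewrite /sep dotDl; nia.
Qed.

(** Repeated subdivision separates the signs of one more linear form, and keeps
    those already separated. *)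
Lemma fan_sep1 n t d : fan n t -> exists m u, [/\ fan m u,
  forall i, (i < m)%N -> sep d (u i) (u i.+1) &
  forall d', (forall i, (i < n)%N -> sep d' (t i) (t i.+1)) ->
    forall i, (i < m)%N -> sep d' (u i) (u i.+1)].
Proof.
(* On a cone where d takes the values a > 0 > b, the mediant has the value
   a + b, so that |a| + |b| decreases on the half where d changes sign. *)
pose bd N t i := sep d (t i) (t i.+1) \/ `|dot (t i) d| + `|dot (t i.+1) d| <= N%:Z.
have [N] : exists N, forall i, (i < n)%N -> bd N t i.
  pose h (i : 'I_n) := absz (`|dot (t i) d| + `|dot (t i.+1) d|).
  exists (\max_i h i)%N => i ilt; right.
  have: (h (Ordinal ilt) <= \max_i h i)%N by exact: leq_bigmax.
  by rewrite {1}/h /=; lia.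
elim: N n t => [|N IH] n t H F.
  exists n, t; split=> // i /H [//|]; rewrite /sep; lia.
have [|m [u [Fu S P]]] := IH _ _ _ (fan_refine F).
  move=> i ilt; have /H : (i./2 < n)%N by lia.
  rewrite /bd; have [-> |->] := half_cases i; rewrite ?doubleK /= ?uphalf_double !refineE.
    by rewrite /sep !dotDl; case=> ?; [left; nia|]; nia.
  by rewrite /sep !dotDl; case=> ?; [left; nia|]; nia.
exists m, u; split=> // d' Hd'; apply: P; exact: sep_refine.
Qed.

Lemma fan_sep n t (F : seq (int * int)) : fan n t -> exists m u, fan m u /\
  forall d, d \in F -> forall i, (i < m)%N -> sep d (u i) (u i.+1).
Proof.
elim: F n t => [|d F IH] n t H; first by exists n, t.
have [m [u [Fu S]]] := IH _ _ H.
have [k [v [Fv Sd P]]] := fan_sep1 d Fu.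
exists k, v; split=> // d'; rewrite inE => /orP[/eqP -> //|/S]; exact: P.
Qed.

Definition cp2_fan : nat -> int * int := nth (1, 0) [:: (1, 0); (0, 1); (-1, -1)].

Lemma fan_cp2 : fan 3 cp2_fan.
Proof.
split=> //.
- by case=> [|[|[|]]].
- move=> [a b] w0.
  have [H|H] := boolP ((0 < a) && (0 <= b)).
    by exists 0%N => //; rewrite /incone /wedge /=; lia.
  have [H'|H'] := boolP ((a <= 0) && (a < b)).
    by exists 1%N => //; rewrite /incone /wedge /=; lia.
  exists 2%N => //; rewrite /incone /wedge /=.
  have: (a != 0) || (b != 0).
    by apply: contraNT w0; rewrite negb_or !negbK => /andP[/eqP -> /eqP ->].
  lia.
- move=> [a b] [|[|[|//]]] [|[|[|//]]] // _ _; rewrite /incone /wedge /=; lia.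
Qed.

(** * The cyclic order *)

Lemma ccw_rot a b c : counterclockwise a b c = counterclockwise b c a.
Proof. by rewrite /counterclockwise; do 3!case: (0 < _). Qed.

Lemma ccw_asym a b c : counterclockwise a b c -> ~~ counterclockwise c b a.
Proof.
rewrite /counterclockwise.
rewrite (wedgeN (val a) (val b)) (wedgeN (val b) (val c)) (wedgeN (val c) (val a)).
by move: (wedge _ _) (wedge _ _) (wedge _ _) => x y z; lia.
Qed.

Lemma ccw_distinct a b c : counterclockwise a b c -> [/\ a <> b, b <> c & a <> c].
Proof.
rewrite /counterclockwise => H.
split=> E; move: H; rewrite E wedgexx.
- by rewrite (wedgeN (val b) (val c)); move: (wedge _ _) => x; lia.
- by rewrite (wedgeN (val a) (val c)); move: (wedge _ _) => x; lia.
- by rewrite (wedgeN (val b) (val c)); move: (wedge _ _) => x; lia.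
Qed.

Lemma ccw_trans o a b c : counterclockwise o a b -> counterclockwise o b c ->
  counterclockwise o a c.
Proof.
rewrite /counterclockwise.
rewrite (wedgeN (val o) (val b)) (wedgeN (val o) (val c)).
(* the Pluecker relation between the four vectors decides all the signs *)
have: wedge (val o) (val a) * wedge (val b) (val c)
    - wedge (val o) (val b) * wedge (val a) (val c)
    + wedge (val o) (val c) * wedge (val a) (val b) = 0 by rewrite /wedge; ring.
move: (wedge (val o) (val a)) (wedge (val b) (val c)) (wedge (val o) (val b))
  (wedge (val a) (val c)) (wedge (val o) (val c)) (wedge (val a) (val b)).
move=> oa bc ob ac oc ab E.
nia.
Qed.

Lemma pairMn (v : int * int) k : v *+ k = (v.1 * k%:Z, v.2 * k%:Z).
Proof.
elim: k => [|k IH]; first by rewrite mulr0n !mulr0.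
by rewrite mulrS IH intS !mulrDr !mulr1; case: v {IH}.
Qed.

Lemma cone_vecE n (t : 'I_n -> primvec) i a b :
  cone_vec t i a b = lin (val (t i)) a%:Z (val (t (ordS i))) b%:Z.
Proof. by rewrite /cone_vec !pairMn. Qed.

Section CyclicOrder.
Variables (n : nat) (t : 'I_n -> primvec).
Hypothesis t1 : forall i, wedge (val (t i)) (val (t (ordS i))) = 1.
Hypothesis t_disj : forall i j (a b a' b' : nat), (0 < a)%N -> (0 < b)%N ->
  cone_vec t i a b = cone_vec t j a' b' -> i = j.

(** Two cones with the same first ray overlap. *)
Lemma rays_inj : injective t.
Proof.
have aux i j : t i = t j -> 0 <= wedge (val (t (ordS j))) (val (t (ordS i))) ->
    j = i.
  (* with u = t i = t j one has t (j + 1) = t (i + 1) + k u, so that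
     u + t (j + 1) is interior to the cone i when k >= 0 *)
  move=> ij; set k := wedge _ _ => k0.
  have E : val (t (ordS j)) = lin (val (t i)) k (val (t (ordS i))) 1.
    rewrite [LHS](coneE _ (t1 i)) -/k; congr lin; rewrite ij; exact: t1.
  apply/esym/(t_disj (a := `|k|.+1) (b := 1) (a' := 1) (b' := 1)) => //.
  rewrite !cone_vecE E -ij /lin /=; congr pair; lia.
move=> i j ij.
have [k0|k0] := lerP 0 (wedge (val (t (ordS j))) (val (t (ordS i)))).
  by rewrite (aux i j).
by apply: aux (esym ij) _; rewrite wedgeN; lia.
Qed.

(** A primitive vector that comes neither between t i and t (i + 1) nor on one of
    these rays comes after t (i + 1), as its two coordinates in this basis are
    not both nonnegative. *)
Lemma ccw_next i j : j != i -> j != ordS i ->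
  counterclockwise (t i) (t (ordS i)) (t j).
Proof.
move=> ji jSi; rewrite /counterclockwise t1 /= andbT.
apply: contraT; rewrite !negb_or => /and3P[bc _ ca].
set a := val (t i) in ca *; set b := val (t (ordS i)) in bc *.
set c := val (t j) in bc ca *.
have [x0 y0] : 0 <= wedge c b /\ 0 <= wedge a c.
  by rewrite (wedgeN b c) (wedgeN c a); lia.
have cE : c = lin a (wedge c b) b (wedge a c) by apply/coneE/t1.
have pr u : prim (val (t u)) by exact: (valP (t u)).
have [x1|x1] := eqVneq (wedge c b) 0.
  have c1 : wedge a c = 1.
    apply: (@prim_scale b) => //.
    by have := pr j; rewrite -/c {1}cE x1 /lin !mulr0 !add0r.
  case/eqP: jSi; apply/rays_inj/val_inj; rewrite -/c -/b cE x1 c1 /lin.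
  by rewrite !mulr0 !add0r !mulr1 -surjective_pairing.
have [y1|y1] := eqVneq (wedge a c) 0.
  have c1 : wedge c b = 1.
    apply: (@prim_scale a) => //.
    by have := pr j; rewrite -/c {1}cE y1 /lin !mulr0 !addr0.
  case/eqP: ji; apply/rays_inj/val_inj; rewrite -/c -/a cE y1 c1 /lin.
  by rewrite !mulr0 !addr0 !mulr1 -surjective_pairing.
case/eqP: ji; apply/esym/(t_disj (a := `|wedge c b|) (b := `|wedge a c|) (a' := 1) (b' := 0)).
- by rewrite absz_gt0.
- by rewrite absz_gt0.
rewrite !cone_vecE -/a -/b -/c !gez0_abs // -cE /lin !mulr0 !addr0 !mulr1.
exact: surjective_pairing.
Qed.

(** Disjoint consecutive positively oriented cones wind once around the
    origin: t (k + 1) follows t k in the cyclic order, and one concludes by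
    transitivity. *)
Lemma ccw_sorted (i j k : 'I_n) : (i < j < k)%N ->
  counterclockwise (t i) (t j) (t k).
Proof.
have S (u v : 'I_n) : val v = u.+1 -> ordS u = v.
  by move=> E; apply/val_inj; rewrite /= -E modn_small ?ltn_ord.
have aux (x y : 'I_n) : (i < x)%N -> val y = x.+1 -> counterclockwise (t i) (t x) (t y).
  move=> ix /= E; rewrite -(S _ _ E) ccw_rot; apply: ccw_next.
    by rewrite -val_eqE /=; lia.
  by rewrite (S _ _ E) -val_eqE /=; lia.
move=> /andP[ij]; have [d] := ubnP (val k); elim: d k => // d IH k kd jk.
have [E|E] := eqVneq (val k) j.+1; first exact: aux.
have lt : (k.-1 < n)%N by apply: leq_ltn_trans (leq_pred _) (ltn_ord k).
apply: ccw_trans (IH (Ordinal lt) _ _) (aux (Ordinal lt) k _ _); move: kd jk E => /=; lia.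
Qed.

End CyclicOrder.

Definition unimodular_on (G : int * int -> int * int) (p q : int * int) : Prop :=
  (forall a b : nat, G (lin p a%:Z q b%:Z) = lin (G p) a%:Z (G q) b%:Z) /\
  wedge (G p) (G q) = 1.

(** The finitely many linear forms F are the ties between monomials. *)
Definition tropically_linear (G : int * int -> int * int) : Prop :=
  exists F : seq (int * int), forall p q, wedge p q = 1 ->
    (forall d, d \in F -> sep d p q) -> unimodular_on G p q.

Section Assemble.
Variables (G : int * int -> int * int) (g : primvec -> primvec).
Hypothesis gE : forall s, val (g s) = G (val s).
Hypothesis G_inj : injective G.
Hypothesis G_lin : tropically_linear G.

(** The linear forms vanishing on the vectors of L are added to those of G: a
    form that vanishes in the interior of a cone changes sign there, so that
    the vectors of L are rays of the fan. *)
Lemma adapted_fan (L : seq primvec) : exists n (t : 'I_n -> primvec),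
  [/\ forall i, wedge (val (t i)) (val (t (ordS i))) = 1,
      cones_decompose t,
      forall i, unimodular_on G (val (t i)) (val (t (ordS i)))
    & forall a, a \in L -> exists i, t i = a].
Proof.
have [F GF] := G_lin.
pose perp (v : primvec) := (- (val v).2, (val v).1).
have [n [u [Fu Su]]] := fan_sep (F ++ map perp L) fan_cp2.
have [un u1 uc ud] := Fu.
pose x0 : primvec := exist (fun v : int * int => coprimez v.1 v.2) (1, 0) isT.
pose t (i : 'I_n) : primvec := insubd x0 (u i).
have n0 : (0 < n)%N.
  by have [//|i lt _] := uc (1, 0); exact: leq_ltn_trans lt.
have pu i : (i < n)%N -> prim (u i) by move=> /u1/wedge_prim[].
have tE i : val (t i) = u i by rewrite val_insubd; move: (pu i (ltn_ord i)); rewrite /prim => ->.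
have tSE (i : 'I_n) : val (t (ordS i)) = u i.+1.
  rewrite tE /=; have [lt|] := ltnP i.+1 n; first by rewrite modn_small.
  move=> ge; have -> : i.+1 = n by apply/eqP; rewrite eqn_leq ge ltn_ord.
  by rewrite modnn un.
exists n, t; split.
- by move=> i; rewrite tSE tE; exact: u1.
- split=> [w|i j a b a' b' a0 b0].
    have [->|w0] := eqVneq w 0.
      by exists (Ordinal n0), 0%N, 0%N; rewrite cone_vecE /lin !mulr0.
    have [i lt /andP[A B]] := uc _ w0.
    exists (Ordinal lt), `|wedge w (u i.+1)|%N, `|wedge (u i) w|%N.
    rewrite cone_vecE tSE tE !gez0_abs //; last exact: ltW.
    exact/coneE/u1.
  rewrite !cone_vecE !tSE !tE => E.
  have [I J] := (u1 _ (ltn_ord i), u1 _ (ltn_ord j)).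
  have Hi : incone (u i) (u i.+1) (lin (u i) a (u i.+1) b).
    by rewrite /incone wedge_linl wedge_linr !wedgexx I; lia.
  have [a'0|a'0] := posnP a'; last first.
    apply/val_inj/(ud _ _ _ (ltn_ord i) (ltn_ord j) Hi); rewrite E.
    by rewrite /incone wedge_linl wedge_linr !wedgexx J; lia.
  (* on the last ray of the cone j, hence in the next half-open cone *)
  have b'0 : (0 < b')%N.
    rewrite lt0n; apply/negP => /eqP b'0; move: Hi.
    by rewrite E a'0 b'0 /lin !mulr0 /incone /wedge /= !mul0r !mulr0.
  have vE : u (ordS j) = u j.+1 by rewrite -tE tSE.
  have Hj : incone (u (ordS j)) (u (ordS j).+1) (lin (u i) a (u i.+1) b).
    rewrite E a'0 -vE /incone wedge_linl wedge_linr wedgexx (u1 _ (ltn_ord _)).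
    by rewrite !mul0r mulr0 addr0 add0r lexx andbT; lia.
  have ij := ud _ _ _ (ltn_ord i) (ltn_ord _) Hi Hj.
  (* so the common vector is on the first ray of the cone i *)
  have [_ b00] : a%:Z = b'%:Z /\ b%:Z = 0.
    apply: (lin_inj I); rewrite E a'0 -vE -ij.
    by rewrite /lin !mulr0 !addr0 !add0r.
  by move: b0; lia.
- move=> i; rewrite tSE tE; apply: GF; first exact: u1.
  by move=> d dF; apply: Su => //; rewrite mem_cat dF.
move=> a aL.
have pa : prim (val a) by exact: (valP a).
have [i lt /andP[A B]] := uc _ (prim_neq0 pa); exists (Ordinal lt).
have := Su (perp a) _ i lt; rewrite mem_cat map_f // orbT => /(_ isT).
have dE w : dot w (perp a) = wedge (val a) w.
  by rewrite /dot /perp /wedge /=; ring.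
rewrite /sep !dE (wedgeN (u i)) => S.
have B0 : wedge (u i) (val a) = 0.
  by move: S A B; nia.
have aE := coneE (val a) (u1 i lt).
have A1 : wedge (val a) (u i.+1) = 1.
  apply: (@prim_scale (u i)); first exact: ltW.
  by have := pa; rewrite {1}aE B0 /lin !mulr0 !addr0.
apply/val_inj; rewrite tE /= aE A1 B0 /lin !mulr0 !addr0 !mulr1.
by case: (u i).
Qed.

Lemma image_disjoint n (t : 'I_n -> primvec) :
  (forall i, unimodular_on G (val (t i)) (val (t (ordS i)))) ->
  cones_decompose t ->
  forall i j (a b a' b' : nat), (0 < a)%N -> (0 < b)%N ->
    cone_vec (g \o t) i a b = cone_vec (g \o t) j a' b' -> i = j.
Proof.
move=> U [_ D] i j a b a' b' a0 b0; rewrite !cone_vecE /= !gE.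
by rewrite -!(proj1 (U _)) -!cone_vecE => /G_inj; exact: D.
Qed.

(** Choose a fan with the rays a, b and c: its image under G satisfies the
    hypotheses of [ccw_sorted]. *)
Lemma preserves_ccw a b c :
  counterclockwise a b c -> counterclockwise (g a) (g b) (g c).
Proof.
have [n [t [t1 tD tU tL]]] := adapted_fan [:: a; b; c].
have [i <-] : exists i, t i = a by apply: tL; rewrite !inE eqxx.
have [j <-] : exists i, t i = b by apply: tL; rewrite !inE eqxx orbT.
have [k <-] : exists i, t i = c by apply: tL; rewrite !inE eqxx !orbT.
have [_ tI] := tD.
have W (x y z : 'I_n) : (x < y < z)%N ->
    counterclockwise (g (t x)) (g (t y)) (g (t z)).
  apply: (@ccw_sorted n (g \o t)) => [u|]; last exact: image_disjoint.
  by rewrite /= !gE; exact: (proj2 (tU u)).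
have Z (x y z : 'I_n) : (x < y < z)%N -> counterclockwise (t x) (t y) (t z).
  exact: ccw_sorted t1 tI _ _ _.
move=> H; have [ij jk ik] := ccw_distinct H.
have {}ij : val i != j by apply: contra_notN ij => /eqP/val_inj ->.
have {}jk : val j != k by apply: contra_notN jk => /eqP/val_inj ->.
have {}ik : val i != k by apply: contra_notN ik => /eqP/val_inj ->.
(* the reversed cyclic orders of i, j, k are impossible *)
have R (x y z : 'I_n) : counterclockwise (t x) (t y) (t z) -> ~~ (z < y < x)%N.
  by move/ccw_asym; apply: contraNN; exact: Z.
have [H1 H2] : counterclockwise (t j) (t k) (t i) /\ counterclockwise (t k) (t i) (t j).
  by rewrite -ccw_rot H ccw_rot.
have [] : (i < j < k)%N \/ (j < k < i)%N \/ (k < i < j)%N.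
- by move: ij jk ik (R _ _ _ H) (R _ _ _ H1) (R _ _ _ H2) => /=; clear; lia.
- exact: W.
by case=> /W; [rewrite -ccw_rot | rewrite ccw_rot].
Qed.

End Assemble.

(** The cyclic order is reflected because the inverse preserves it as well. *)
Theorem piecewise_linear_of G G' (g g' : primvec -> primvec) :
  (forall s, val (g s) = G (val s)) -> (forall s, val (g' s) = G' (val s)) ->
  cancel G G' -> cancel G' G -> tropically_linear G -> tropically_linear G' ->
  piecewise_linear g.
Proof.
move=> gE gE' GK GK' Gl Gl'.
have gK : cancel g g' by move=> s; apply/val_inj; rewrite gE' gE GK.
have gK' : cancel g' g by move=> s; apply/val_inj; rewrite gE gE' GK'.
split.
- by exists g'.
- move=> a b c; apply/idP/idP; last exact: preserves_ccw gE (can_inj GK) Gl _ _ _.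
  move/(preserves_ccw gE' (can_inj GK') Gl').
  by rewrite !gK.
(* the rays of an adapted fan are counterclockwise, hence the reversal *)
have [n [t [t1 [tC tD] tU _]]] := adapted_fan Gl [::].
have rS (i : 'I_n) : ordS (rev_ord (ordS i)) = rev_ord i.
  apply/val_inj; have ni := ltn_ord i; rewrite /=.
  have [lt|ge] := ltnP i.+1 n.
    by rewrite (modn_small lt) modn_small; lia.
  have -> : i.+1 = n by lia.
  by rewrite modnn; have -> : (n - 1).+1 = n; [lia|rewrite modnn; lia].
pose s i := t (rev_ord i).
have cE i a b : cone_vec s i a b = cone_vec t (rev_ord (ordS i)) b a.
  by rewrite !cone_vecE linC /s rS.
exists n, s; split.
- move=> i j k ijk; rewrite /clockwise; apply: (ccw_sorted t1 tD) => /=.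
  by have := ltn_ord k; lia.
- by move=> i; rewrite /s -(t1 (rev_ord (ordS i))) rS.
- split=> [w|i j a b a' b' a0 b0].
    have [i [a [b ->]]] := tC w.
    exists (ord_pred (rev_ord i)), b, a.
    by rewrite cE ord_predK rev_ordK.
  rewrite !cE => /(tD _ _ _ _ _ _ b0 a0) /rev_ord_inj.
  exact: (can_inj (@ordSK n)).
move=> i a b w; rewrite !cE gE => ->.
rewrite (cone_vecE t) (proj1 (tU _)) !cone_vecE /= !gE linC.
by rewrite /s rS.
Qed.

(** * Tropicalizations of symplectic maps are piecewise linear *)

Section Leading.
Variable C : fieldType.
Implicit Types (P : {mpoly C[2]}) (p q w : int * int) (m : 'X_{1..2}).

Definition mdiff m m' : int * int :=
  ((m ord0)%:Z - (m' ord0)%:Z, (m ord_max)%:Z - (m' ord_max)%:Z).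

Lemma dot_mdiff w m m' : dot w (mdiff m m') = wt w m - wt w m'.
Proof. by rewrite /dot /mdiff /wt /=; ring. Qed.

Lemma wt_lin p a q b m : wt (lin p a q b) m = a * wt p m + b * wt q m.
Proof. by rewrite /wt /lin /=; ring. Qed.

(** m has the least weight in P for all the valuations of the cone. *)
Definition leads p q P m : Prop := m \in msupp P /\
  forall m', m' \in msupp P -> wt p m <= wt p m' /\ wt q m <= wt q m'.

Definition mdiffs P : seq (int * int) :=
  [seq mdiff m m' | m <- msupp P, m' <- msupp P].

(** A monomial of least weight for p + q: the differences of weights do not
    change sign on the cone, so that it has the least weight for p and q too. *)
Lemma leads_exists p q P : P != 0 ->
  (forall d, d \in mdiffs P -> sep d p q) -> exists m, leads p q P m.
Proof.
move=> P0 S; have [m mP E] := pval_attained (lin p 1 q 1) P0.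
exists m; split=> // m' m'P.
have := S (mdiff m' m); rewrite allpairs_f // => /(_ isT).
have := pval_le (lin p 1 q 1) m'P; rewrite -E !wt_lin /sep !dot_mdiff.
by move: (wt p m) (wt p m') (wt q m) (wt q m') => a b c d; nia.
Qed.

Lemma leads_pval p q P m (a b : nat) : leads p q P m ->
  pval (lin p a%:Z q b%:Z) P = a%:Z * wt p m + b%:Z * wt q m.
Proof.
move=> [mP H]; have P0 : P != 0.
  by apply: contraTneq mP => ->; rewrite msupp0.
rewrite -wt_lin; apply/le_anti/andP; split; first exact: pval_le.
apply: pge_pval => // m' /H [A B]; rewrite !wt_lin.
by apply: lerD; apply: ler_wpM2l.
Qed.

(** Inside the cone the leading monomial is alone of least weight, so that it
    is an approximate eigenvector of x d/dx and y d/dy. *)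
Lemma leads_pdlog p q P m i : wedge p q = 1 -> leads p q P m ->
  pge (lin p 1 q 1) (pval (lin p 1 q 1) P + 1) (pdlog i P - (m i)%:R *: P).
Proof.
move=> pq L; have [mP H] := L; rewrite (leads_pval 1 1 L) => m'.
rewrite mcoeff_msupp mcoeffB mcoeff_pdlog mcoeffZ -(mulr_natl P@_m' (m' i)) -mulrBl.
rewrite mulf_eq0 negb_or -mcoeff_msupp => /andP[ne m'P].
have [A B] := H _ m'P; rewrite wt_lin !mul1r.
suff: wt p m' + wt q m' != wt p m + wt q m by lia.
apply: contraNneq ne => E.
have {A B E} [A B] : wt p m = wt p m' /\ wt q m = wt q m' by lia.
suff -> : m = m' by rewrite subrr.
have [E0 E1] : (m ord0)%:Z = m' ord0 /\ (m ord_max)%:Z = m' ord_max.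
  have E0 : ((m ord0)%:Z - (m' ord0)%:Z) * wedge p q =
      q.2 * (wt p m - wt p m') - p.2 * (wt q m - wt q m').
    by rewrite /wt /wedge; ring.
  have E1 : ((m ord_max)%:Z - (m' ord_max)%:Z) * wedge p q =
      p.1 * (wt q m - wt q m') - q.1 * (wt p m - wt p m').
    by rewrite /wt /wedge; ring.
  by move: E0 E1; rewrite A B pq !subrr !mulr0 !mulr1; lia.
by apply/mnmP => j; have [->|->] := ord2 j; lia.
Qed.

End Leading.

Section TropicalLinearity.
Variable C : fieldType.
Hypothesis char0 : [pchar C] =i pred0.
Implicit Types (p q w e : int * int) (phi : ratfun C).

Definition comp2 e (i : 'I_2) : int := if i == ord0 then e.1 else e.2.

(** phi behaves like a constant multiple of the Laurent monomial of exponent e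
    on the cone spanned by p and q: for its valuations, and, up to terms of
    higher valuation at the interior vector p + q, for x d/dx and y d/dy. *)
Definition leadr p q phi e : Prop :=
  (forall a b : nat, rval (lin p a%:Z q b%:Z) phi = a%:Z * dot p e + b%:Z * dot q e) /\
  forall i, rge (lin p 1 q 1) (rval (lin p 1 q 1) phi + 1)
    (rdlog i phi - ratC (comp2 e i)%:~R * phi).

(** e is the difference of the leading exponents of the numerator and the
    denominator, logarithmic derivatives being additive. *)
Lemma leadr_exists p q phi : wedge p q = 1 -> phi != 0 ->
  (forall d, d \in mdiffs (num phi) ++ mdiffs (den phi) -> sep d p q) ->
  exists e, leadr p q phi e.
Proof.
move=> pq phi0 S.
have E := ratfunE phi; have d0 := den_neq0 phi.
have n0 : num phi != 0.
  by apply: contraNneq phi0 => n0; rewrite E n0 tofrac0 mul0r.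
have [m Lm] : exists m, leads p q (num phi) m.
  by apply: (leads_exists n0) => d dF; apply: S; rewrite mem_cat dF.
have [m' Lm'] : exists m, leads p q (den phi) m.
  by apply: (leads_exists d0) => d dF; apply: S; rewrite mem_cat dF orbT.
have V w : rval w phi = pval w (num phi) - pval w (den phi).
  by rewrite [in LHS]E (rval_frac w n0 d0).
exists (mdiff m m'); split=> [a b|i].
  by rewrite V (leads_pval a b Lm) (leads_pval a b Lm') !dot_mdiff; ring.
set w := lin p 1 q 1.
have Rm := rge_poly (leads_pdlog (i := i) pq Lm).
have Rm' := rge_poly (leads_pdlog (i := i) pq Lm').
rewrite -?/w in Rm Rm' *.
set n := num phi in E n0 Lm V Rm *; set d := den phi in E d0 Lm' V Rm' *.
have dF : d%:F != 0 by rewrite tofrac_eq0.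
have nE : n%:F = phi * d%:F by rewrite E mulfVK.
have -> : rval w phi + 1 = pval w n + 1 - rval w d%:F.
  by rewrite V (rval_poly w d0); ring.
apply: (rge_divr dF).
have zE (P : {mpoly C[2]}) (k : 'X_{1..2}) :
    ((k i)%:R *: P)%:F = ratC (k i)%:R * P%:F by rewrite -mul_mpolyC tofracM.
have -> : ratC (comp2 (mdiff m m') i)%:~R = ratC (m i)%:R - ratC (m' i)%:R :> ratfun C.
  by have [->|->] := ord2 i; rewrite -rmorphB /comp2 /= rmorphB.
have -> : (rdlog i phi - (ratC (m i)%:R - ratC (m' i)%:R) * phi) * d%:F =
    (pdlog i n - (m i)%:R *: n)%:F - phi * (pdlog i d - (m' i)%:R *: d)%:F.
  rewrite !tofracB !zE -!rdlog_poly nE rdlogM; ring.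
apply: (rgeB Rm).
have -> : pval w n + 1 = rval w phi + (pval w d + 1) by rewrite V; ring.
exact: rgeM (@rge_rval _ _ _) Rm'.
Qed.

Lemma intr_pchar0_inj (z : int) : z%:~R = 0 :> C -> z = 0.
Proof.
move/pcharf0P: char0 => H.
case: z => k; first by rewrite -pmulrn => /eqP; rewrite H => /eqP ->.
by rewrite NegzE mulrNz -pmulrn => /eqP; rewrite oppr_eq0 H.
Qed.

(** The brackets of the leading monomials are the leading monomials of the
    brackets, and brk f.1 f.2 = f.1 * f.2. *)
Lemma leadr_det (f : ratfun C * ratfun C) p q e e' :
  f.1 != 0 -> f.2 != 0 -> brk f.1 f.2 = f.1 * f.2 ->
  leadr p q f.1 e -> leadr p q f.2 e' -> wedge e e' = 1.
Proof.
move=> f1 f2 brkf [_ R] [_ R']; set w := lin p 1 q 1 in R R' *.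
have F0 := mulf_neq0 f1 f2.
have S i : rge w (rval w f.2) (rdlog i f.2) by apply/rge_rdlog/rge_rval.
pose c (e : int * int) i : ratfun C := ratC (comp2 e i)%:~R.
have T i : rge w (rval w f.1) (c e i * f.1).
  by rewrite -[rval w _]add0r; apply: rgeM (@rge_rval _ _ _); exact: rgeC.
have H : rge w (rval w f.1 + rval w f.2 + 1) (ratC (1 - wedge e e')%:~R * (f.1 * f.2)).
  have -> : ratC (1 - wedge e e')%:~R * (f.1 * f.2) =
      (rdlog ord0 f.1 - c e ord0 * f.1) * rdlog ord_max f.2
      + c e ord0 * f.1 * (rdlog ord_max f.2 - c e' ord_max * f.2)
      - ((rdlog ord_max f.1 - c e ord_max * f.1) * rdlog ord0 f.2
      + c e ord_max * f.1 * (rdlog ord0 f.2 - c e' ord0 * f.2)).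
    transitivity (brk f.1 f.2
       - (c e ord0 * c e' ord_max - c e ord_max * c e' ord0) * (f.1 * f.2)).
      rewrite brkf -{2}[f.1 * f.2]mul1r -mulrBl; congr (_ * _).
      rewrite /c -!rmorphM -rmorphB -(rmorph1 (@ratC C)) -rmorphB; congr ratC.
      by rewrite /comp2 /wedge /= !rmorphB !rmorphM rmorph1.
    by rewrite /brk; ring.
  have X i j : rge w (rval w f.1 + rval w f.2 + 1)
      ((rdlog i f.1 - c e i * f.1) * rdlog j f.2).
    by rewrite addrAC; apply: rgeM (R i) (S j).
  have Y i j : rge w (rval w f.1 + rval w f.2 + 1)
      (c e i * f.1 * (rdlog j f.2 - c e' j * f.2)).
    by rewrite -addrA; apply: rgeM (T i) (R' j).
  by apply: rgeB; apply: rgeD.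
have [z0|z0] := eqVneq ((1 - wedge e e')%:~R : C) 0.
  by move/intr_pchar0_inj: z0 => /eqP; rewrite subr_eq0 => /eqP <-.
have Z0 : ratC (1 - wedge e e')%:~R != 0 :> ratfun C by rewrite fmorph_eq0.
have := H (mulf_neq0 Z0 F0); rewrite (rvalM w Z0 F0) (rvalC w z0).
by rewrite (rvalM w f1 f2) add0r -subr_ge0 opprD addNKr.
Qed.

(** On a cone where f_1 and f_2 have leading exponents e and e', trop f is the
    linear map with rows e and e', of determinant wedge e e' = 1. *)
Theorem trop_linear (f : ratfun C * ratfun C) :
  f.1 != 0 -> f.2 != 0 -> brk f.1 f.2 = f.1 * f.2 ->
  tropically_linear (trop f).
Proof.
move=> f1 f2 brkf.
exists ((mdiffs (num f.1) ++ mdiffs (den f.1)) ++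
        (mdiffs (num f.2) ++ mdiffs (den f.2))) => p q pq S.
have [e L] : exists e, leadr p q f.1 e.
  by apply: (leadr_exists pq f1) => d dF; apply: S; rewrite mem_cat dF.
have [e' L'] : exists e, leadr p q f.2 e.
  by apply: (leadr_exists pq f2) => d dF; apply: S; rewrite mem_cat dF orbT.
have det := leadr_det f1 f2 brkf L L'.
have lin10 : lin p 1 q 0 = p by rewrite /lin !mulr0 !addr0 !mulr1 -surjective_pairing.
have lin01 : lin p 0 q 1 = q by rewrite /lin !mulr0 !add0r !mulr1 -surjective_pairing.
have Ep : trop f p = (dot p e, dot p e').
  rewrite /trop -{1 2}lin10 (proj1 L 1%N 0%N) (proj1 L' 1%N 0%N).
  by rewrite !mul0r !mul1r !addr0.
have Eq : trop f q = (dot q e, dot q e').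
  rewrite /trop -{1 2}lin01 (proj1 L 0%N 1%N) (proj1 L' 0%N 1%N).
  by rewrite !mul0r !mul1r !add0r.
split=> [a b|].
  rewrite Ep Eq /trop (proj1 L) (proj1 L') /lin /=.
  by congr pair; ring.
rewrite Ep Eq; transitivity (wedge p q * wedge e e').
  by rewrite /wedge /dot /=; ring.
by rewrite pq det.
Qed.

End TropicalLinearity.

(** * Affine charts *)

Section Charts.
Variable C : fieldType.
Implicit Types (p n d : {mpoly C[2]}) (phi psi : ratfun C).
Implicit Types e f g h : ratfun C * ratfun C.

Lemma psubst_Xl e : psubst e 'X_ord0 = e.1.
Proof. by rewrite psubstX. Qed.

Lemma psubst_Xr e : psubst e 'X_ord_max = e.2.
Proof. by rewrite psubstX. Qed.

Lemma psubst0 e : psubst e 0 = 0.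
Proof. exact: raddf0. Qed.

Lemma psubstXn e p k : psubst e (p ^+ k) = psubst e p ^+ k.
Proof. exact: rmorphXn. Qed.

(** phi is in the field generated by the coordinates of e. *)
Definition fracs e phi : Prop := exists n d,
  psubst e d != 0 /\ phi = psubst e n / psubst e d.

Lemma fracs_poly e n : fracs e (psubst e n).
Proof. by exists n, 1; rewrite psubst1 oner_neq0 divr1. Qed.

Lemma fracsM e phi psi : fracs e phi -> fracs e psi -> fracs e (phi * psi).
Proof.
move=> [n [d [d0 ->]]] [m [c [c0 ->]]]; exists (n * m), (d * c).
by rewrite !psubstM mulf_div; split; [exact: (mulf_neq0 d0 c0) | reflexivity].
Qed.

Lemma fracsD e phi psi : fracs e phi -> fracs e psi -> fracs e (phi + psi).
Proof.
move=> [n [d [d0 ->]]] [m [c [c0 ->]]]; exists (n * c + m * d), (d * c).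
rewrite psubstD !psubstM (addf_div _ _ d0 c0).
by split; [exact: (mulf_neq0 d0 c0) | reflexivity].
Qed.

Lemma fracsV e phi : fracs e phi -> fracs e phi^-1.
Proof.
move=> [n [d [d0 ->]]]; rewrite invf_div.
have [->|n0] := eqVneq (psubst e n) 0.
  by rewrite invr0 mulr0 -(psubst0 e); exact: fracs_poly.
by exists d, n; split; [exact: n0 | reflexivity].
Qed.

Lemma fracsC e a : fracs e (ratC a).
Proof. by rewrite -(psubstC e); exact: fracs_poly. Qed.

Lemma fracs_l e : fracs e e.1.
Proof. by rewrite -psubst_Xl; exact: fracs_poly. Qed.

Lemma fracs_r e : fracs e e.2.
Proof. by rewrite -psubst_Xr; exact: fracs_poly. Qed.

Lemma fracs_psubst e f n : fracs e f.1 -> fracs e f.2 -> fracs e (psubst f n).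
Proof.
move=> f1 f2; elim/psubst_ind: n => [a|i|p q P Q|p q P Q].
- by rewrite psubstC; exact: fracsC.
- by have [->|->] := ord2 i; rewrite ?psubst_Xl ?psubst_Xr.
- by rewrite psubstD; exact: fracsD.
- by rewrite psubstM; exact: fracsM.
Qed.

Lemma fracs_trans e f phi : fracs e f.1 -> fracs e f.2 -> fracs f phi -> fracs e phi.
Proof.
move=> f1 f2 [n [d [_ ->]]].
by apply: fracsM; [|apply: fracsV]; exact: fracs_psubst.
Qed.

Lemma fracs_rid phi : fracs (rid C) phi.
Proof.
exists (num phi), (den phi); rewrite !psubst_id tofrac_eq0; split.
  exact: den_neq0.
exact: ratfunE.
Qed.

(** The affine plane of e is birational to CP^2. *)
Definition coords e : Prop := dominant e /\ forall phi, fracs e phi.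

Lemma coords_of e f : coords f -> dominant e -> fracs e f.1 -> fracs e f.2 -> coords e.
Proof.
move=> [_ H] dome e1 e2; split; first exact: dome.
by move=> phi; exact: fracs_trans e1 e2 (H phi).
Qed.

Lemma coords_rid : coords (rid C).
Proof. split; [exact: rid_dominant | exact: fracs_rid]. Qed.

(** If a rational map g with common denominator d has a right inverse h, any
    relation between its coordinates, cleared of denominators and evaluated at
    h, is a relation between x and y. *)
Lemma dominant_of_inverse g h d n1 n2 :
  d%:F != 0 -> g.1 = n1%:F / d%:F -> g.2 = n2%:F / d%:F ->
  psubst h d != 0 -> psubst h n1 = rx C * psubst h d ->
  psubst h n2 = ry C * psubst h d -> dominant g.
Proof.
move=> d0 g1 g2 hd0 h1 h2 p pg.
have [N [Q [QE hQ]]] : exists N Q, Q%:F = d%:F ^+ N * psubst g p /\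
    psubst h Q = psubst h d ^+ N * p%:F.
  elim/psubst_ind: p {pg} => [a|i|p q [N [Q [E F]]] [M [R [E' F']]]
                                 |p q [N [Q [E F]]] [M [R [E' F']]]].
  - by exists 0%N, a%:MP; rewrite !psubstC !expr0 !mul1r.
  - have [->|->] := ord2 i.
      exists 1%N, n1; rewrite psubst_Xl !expr1 g1 h1 mulrC (mulfVK d0).
      by split; [reflexivity | exact: mulrC].
    exists 1%N, n2; rewrite psubst_Xr !expr1 g2 h2 mulrC (mulfVK d0).
    by split; [reflexivity | exact: mulrC].
  - exists (N + M)%N, (d ^+ M * Q + d ^+ N * R).
    rewrite !tofracD !psubstD !tofracM !psubstM !psubstXn !tofracXn E F E' F' !exprD.
    by split; ring.
  - exists (N + M)%N, (Q * R).
    rewrite !tofracM !psubstM E F E' F' !exprD.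
    by split; ring.
move: QE; rewrite pg mulr0 => /eqP; rewrite tofrac_eq0 => /eqP Q0.
move: hQ; rewrite Q0 psubst0 => /esym/eqP; rewrite mulf_eq0.
by rewrite (negPf (expf_neq0 N hd0)) tofrac_eq0 => /eqP.
Qed.

Lemma ratC_eq0 (a : C) : (ratC a == 0 :> ratfun C) = (a == 0).
Proof. by rewrite fmorph_eq0. Qed.

Lemma ratC0 : ratC 0 = 0 :> ratfun C.
Proof. exact: rmorph0. Qed.

Definition swap (T : Type) (t : T * T) : T * T := (t.2, t.1).

Lemma dominant_swap e : dominant e -> dominant (swap e).
Proof.
move=> dome; have -> : swap e = rcomp (ry C, rx C) e.
  by rewrite /rcomp /= (rsubst_rx dome) (rsubst_ry dome).
apply: (rcomp_dominant dome).
apply: (@dominant_of_inverse _ (ry C, rx C) 1 'X_ord_max 'X_ord0).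
- by rewrite tofrac1 oner_neq0.
- by rewrite tofrac1 divr1.
- by rewrite tofrac1 divr1.
- by rewrite psubst1 oner_neq0.
- by rewrite psubst1 mulr1 psubst_Xr.
- by rewrite psubst1 mulr1 psubst_Xl.
Qed.

Lemma coords_swap e : coords e -> coords (swap e).
Proof.
move=> ce; apply: (coords_of ce (dominant_swap (proj1 ce))).
  exact: fracs_r.
exact: fracs_l.
Qed.

Lemma blowup_chart1E (P : point C) : blowup_chart1 P =
  (P.1.1 - ratC P.2.1, (P.1.2 - ratC P.2.2) / (P.1.1 - ratC P.2.1)).
Proof. by case: P => [[u v] [a b]]. Qed.

Lemma blowup_chart2E (P : point C) :
  blowup_chart2 P = swap (blowup_chart1 (swap P.1, swap P.2)).
Proof. by case: P => [[u v] [a b]]. Qed.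

Lemma dominant_sub_neq0 e a : dominant e -> e.1 - ratC a != 0.
Proof.
move=> dome; rewrite -(psubst_Xl e) -(psubstC e) -psubstB.
apply: (psubst_neq0 dome); apply/eqP => /(congr1 (mcoeff U_(ord0))) /eqP.
by rewrite mcoeffB mcoeffXU mcoeffC mnm1_eq0 mulr0 subr0 mcoeff0 oner_eq0.
Qed.

(** The inverse of a blow-up is (x, y) |-> (x + a, x y + b). *)
Lemma dominant_blowup (P : point C) : dominant P.1 -> dominant (blowup_chart1 P).
Proof.
case: P => [e [a b]] dome; rewrite blowup_chart1E.
have -> : (e.1 - ratC a, (e.2 - ratC b) / (e.1 - ratC a)) =
    rcomp (rx C - ratC a, (ry C - ratC b) / (rx C - ratC a)) e.
  rewrite /rcomp /= (rsubstM dome) (rsubstV dome) !(rsubstD dome) !(rsubstN dome).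
  by rewrite !(rsubstC dome) (rsubst_rx dome) (rsubst_ry dome).
apply: (rcomp_dominant dome).
have d0 : ('X_ord0 - a%:MP)%:F != 0 :> ratfun C.
  rewrite tofracB; exact: (dominant_sub_neq0 a (@rid_dominant C)).
apply: (@dominant_of_inverse _ (rx C + ratC a, rx C * ry C + ratC b)
  ('X_ord0 - a%:MP) (('X_ord0 - a%:MP) ^+ 2) ('X_ord_max - b%:MP)).
- exact: d0.
- by rewrite tofracXn expr2 (mulfK d0) tofracB.
- by rewrite !tofracB.
- by rewrite psubstB psubst_Xl psubstC /= addrK rx_neq0.
- by rewrite psubstXn psubstB psubst_Xl psubstC /= addrK expr2.
- by rewrite !psubstB psubst_Xl psubst_Xr !psubstC /= !addrK mulrC.
Qed.

Lemma coords_blowup (P : point C) : coords P.1 -> coords (blowup_chart1 P).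
Proof.
move=> ce; have dome := proj1 ce; apply: (coords_of ce (dominant_blowup dome)).
  have -> : P.1.1 = (blowup_chart1 P).1 + ratC P.2.1 by rewrite blowup_chart1E /= subrK.
  by apply: fracsD; [exact: fracs_l | exact: fracsC].
have -> : P.1.2 = (blowup_chart1 P).1 * (blowup_chart1 P).2 + ratC P.2.2.
  by rewrite blowup_chart1E /= mulrC (mulfVK (dominant_sub_neq0 _ dome)) subrK.
apply: fracsD; last exact: fracsC.
by apply: fracsM; [exact: fracs_l | exact: fracs_r].
Qed.

Definition mono (m : int * int) : ratfun C := rx C ^ m.1 * ry C ^ m.2.

Lemma mono_neq0 m : mono m != 0.
Proof. by apply: mulf_neq0; apply: expfz_neq0; [exact: rx_neq0 | exact: ry_neq0]. Qed.

Lemma rvalXz w phi (k : int) : phi != 0 -> rval w (phi ^ k) = rval w phi * k.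
Proof.
move=> p0; case: k => k; first by rewrite -exprnP (rvalX w k p0).
by rewrite NegzE -exprnN (rvalV w (expf_neq0 _ p0)) (rvalX w _ p0) mulrN.
Qed.

Lemma rval_mono w m : rval w (mono m) = dot w m.
Proof.
have x0 := rx_neq0 C; have y0 := ry_neq0 C.
transitivity (rval w (rx C ^ m.1) + rval w (ry C ^ m.2)).
  exact: (rvalM w (expfz_neq0 m.1 x0) (expfz_neq0 m.2 y0)).
by rewrite (rvalXz w m.1 x0) (rvalXz w m.2 y0) rval_rx rval_ry.
Qed.

Lemma monoM m m' : mono m * mono m' = mono (m + m').
Proof.
rewrite /mono /= (expfzDr m.1 m'.1 (rx_neq0 C)) (expfzDr m.2 m'.2 (ry_neq0 C)).
exact: mulrACA.
Qed.

Lemma monoXz m (k : int) : mono m ^ k = mono (m.1 * k, m.2 * k).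
Proof. transitivity ((rx C ^ m.1) ^ k * (ry C ^ m.2) ^ k); first exact: expfzMl.
by congr (_ * _); exact: exprz_exp. Qed.

Lemma fracsXz e phi (k : int) : fracs e phi -> fracs e (phi ^ k).
Proof.
have X (n : nat) psi : fracs e psi -> fracs e (psi ^+ n).
  move=> H; elim: n => [|n IH]; first by rewrite expr0 -(psubst1 e); exact: fracs_poly.
  by rewrite exprS; exact: fracsM.
case: k => k H; first by rewrite -exprnP; exact: X.
by rewrite NegzE -exprnN; exact/fracsV/X.
Qed.

(** The affine toric plane of the unimodular cone spanned by p and q; its
    coordinates are dual to p and q. *)
Definition toric (p q : int * int) : chart C :=
  (mono (q.2, - q.1), mono (- p.2, p.1)).

Lemma rval_toric1 (p q s : int * int) : rval s (toric p q).1 = wedge s q.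
Proof. by rewrite rval_mono /dot /wedge /=; ring. Qed.

Lemma rval_toric2 (p q s : int * int) : rval s (toric p q).2 = wedge p s.
Proof. by rewrite rval_mono /dot /wedge /=; ring. Qed.

(** The monomial map h of exponents (p.1, q.1) and (p.2, q.2) is inverse to the
    chart; the exponent N clears the denominators. *)
Lemma coords_toric (p q : int * int) : wedge p q = 1 -> coords (toric p q).
Proof.
move=> pq; have [x0 y0] := (rx_neq0 C, ry_neq0 C).
have xE : rx C = mono (1, 0) by rewrite /mono expr1z expr0z mulr1.
have yE : ry C = mono (0, 1) by rewrite /mono expr1z expr0z mul1r.
apply: (coords_of coords_rid); last first.
- have -> : (rid C).2 = (toric p q).1 ^ p.2 * (toric p q).2 ^ q.2.
    rewrite /= !monoXz monoM yE; congr (mono (_, _)) => /=; first by ring.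
    by rewrite -pq /wedge; ring.
  by apply: fracsM; apply: fracsXz; [exact: fracs_l | exact: fracs_r].
- have -> : (rid C).1 = (toric p q).1 ^ p.1 * (toric p q).2 ^ q.1.
    rewrite /= !monoXz monoM xE; congr (mono (_, _)) => /=; last by ring.
    by rewrite -pq /wedge; ring.
  by apply: fracsM; apply: fracsXz; [exact: fracs_l | exact: fracs_r].
pose N : int := (`|p.1| + `|p.2| + `|q.1| + `|q.2|)%N.
pose M (i j : int) : {mpoly C[2]} := 'X_ord0 ^+ absz (N + i) * 'X_ord_max ^+ absz (N + j).
have ME i j : 0 <= N + i -> 0 <= N + j -> (M i j)%:F = mono (N + i, N + j).
  by move=> i0 j0; rewrite /M tofracM !tofracXn !exprnP (gez0_abs i0) (gez0_abs j0).
pose h := (mono (p.1, q.1), mono (p.2, q.2)).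
have hME i j : 0 <= N + i -> 0 <= N + j -> psubst h (M i j) =
    mono (p.1 * (N + i) + p.2 * (N + j), q.1 * (N + i) + q.2 * (N + j)).
  move=> i0 j0; rewrite /M psubstM !psubstXn psubst_Xl psubst_Xr !exprnP.
  by rewrite (gez0_abs i0) (gez0_abs j0) !monoXz monoM.
have [Nq Nq' Np Np'] : [/\ 0 <= N + q.2, 0 <= N + - q.1, 0 <= N + - p.2 & 0 <= N + p.1].
  by rewrite /N; split; lia.
have N0 : 0 <= N + 0 by [].
have pq1 : p.1 * q.2 - p.2 * q.1 = 1 by exact: pq.
apply: (@dominant_of_inverse _ h (M 0 0) (M q.2 (- q.1)) (M (- p.2) p.1)).
- by rewrite (ME _ _ N0 N0) mono_neq0.
- rewrite (ME _ _ N0 N0) (ME _ _ Nq Nq'); apply: (mulIf (mono_neq0 (N + 0, N + 0))).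
  rewrite (mulfVK (mono_neq0 _)) /= monoM; congr (mono (_, _)) => /=; ring.
- rewrite (ME _ _ N0 N0) (ME _ _ Np Np'); apply: (mulIf (mono_neq0 (N + 0, N + 0))).
  rewrite (mulfVK (mono_neq0 _)) /= monoM; congr (mono (_, _)) => /=; ring.
- by rewrite (hME _ _ N0 N0) mono_neq0.
- rewrite (hME _ _ N0 N0) (hME _ _ Nq Nq') xE monoM; congr (mono (_, _)) => /=.
    by rewrite -pq1; ring.
  by ring.
- rewrite (hME _ _ N0 N0) (hME _ _ Np Np') yE monoM; congr (mono (_, _)) => /=.
    by ring.
  by rewrite -pq1; ring.
Qed.

Lemma toric_blowup1 (p q : int * int) : blowup_chart1 (toric p q, (0, 0)) = toric (p + q) q.
Proof.
rewrite blowup_chart1E /= ratC0 !subr0 /toric; congr pair.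
rewrite -[X in _ / X]/(mono _) -exprN1 monoXz monoM; congr (mono (_, _)) => /=; ring.
Qed.

Lemma toric_blowup2 (p q : int * int) : blowup_chart2 (toric p q, (0, 0)) = toric p (p + q).
Proof.
rewrite blowup_chart2E blowup_chart1E /swap /= ratC0 !subr0 /toric; congr pair.
rewrite -[X in _ / X]/(mono _) -exprN1 monoXz monoM; congr (mono (_, _)) => /=; ring.
Qed.

End Charts.

(** * Local rings of points *)

Fact slope_aux (F : fieldType) (u v a b : F) : u != 0 ->
  v / u - b = u^-1 * (v - a * b) - (u^-1 * b) * (u - a).
Proof. by move=> u0; field. Qed.

Section LocalRings.
Variable C : fieldType.
Implicit Types (P Q : point C) (phi psi : ratfun C) (n d : {mpoly C[2]}).
Implicit Types (e : chart C).

(** phi is in the maximal ideal of the local ring of P. *)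
Definition van_at P phi : Prop := exists n d,
  [/\ d.@[vec2 P.2] != 0, n.@[vec2 P.2] = 0 & phi = psubst P.1 n / psubst P.1 d].

Lemma eval_l (t : C * C) : ('X_ord0 : {mpoly C[2]}).@[vec2 t] = t.1.
Proof. by rewrite mevalXU. Qed.

Lemma eval_r (t : C * C) : ('X_ord_max : {mpoly C[2]}).@[vec2 t] = t.2.
Proof. by rewrite mevalXU. Qed.

Section Dominant.
Variable P : point C.
Hypothesis domP : dominant P.1.

Lemma psubst_eval_neq0 d : d.@[vec2 P.2] != 0 -> psubst P.1 d != 0.
Proof.
by move=> d0; apply: (psubst_neq0 domP); apply: contraNneq d0 => ->; rewrite meval0.
Qed.

Lemma reg_poly n : regular_at P (psubst P.1 n).
Proof. by exists n, 1; rewrite meval1 oner_neq0 psubst1 divr1. Qed.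

Lemma regC a : regular_at P (ratC a).
Proof. by rewrite -(psubstC P.1); exact: reg_poly. Qed.

Lemma regD phi psi : regular_at P phi -> regular_at P psi -> regular_at P (phi + psi).
Proof.
move=> [n [d [d0 ->]]] [m [c [c0 ->]]]; exists (n * c + m * d), (d * c).
rewrite mevalM psubstD !psubstM; split; first exact: mulf_neq0.
exact: (addf_div _ _ (psubst_eval_neq0 d0) (psubst_eval_neq0 c0)).
Qed.

Lemma regM phi psi : regular_at P phi -> regular_at P psi -> regular_at P (phi * psi).
Proof.
move=> [n [d [d0 ->]]] [m [c [c0 ->]]]; exists (n * m), (d * c).
by rewrite mevalM !psubstM; split; [exact: mulf_neq0 | exact: mulf_div].
Qed.

Lemma regB phi psi : regular_at P phi -> regular_at P psi -> regular_at P (phi - psi).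
Proof.
move=> H K; have -> : phi - psi = phi + ratC (-1) * psi by rewrite rmorphN1 mulN1r.
by apply: (regD H); apply: regM K; exact: regC.
Qed.

Lemma van_reg phi : van_at P phi -> regular_at P phi.
Proof. by move=> [n [d [d0 _ E]]]; exists n, d. Qed.

Lemma vanD phi psi : van_at P phi -> van_at P psi -> van_at P (phi + psi).
Proof.
move=> [n [d [d0 n0 ->]]] [m [c [c0 m0 ->]]]; exists (n * c + m * d), (d * c).
rewrite mevalM psubstD !psubstM mevalD !mevalM n0 m0 !mul0r addr0.
split; [exact: mulf_neq0 | reflexivity |].
exact: (addf_div _ _ (psubst_eval_neq0 d0) (psubst_eval_neq0 c0)).
Qed.

Lemma vanMr phi psi : regular_at P phi -> van_at P psi -> van_at P (phi * psi).
Proof.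
move=> [n [d [d0 ->]]] [m [c [c0 m0 ->]]]; exists (n * m), (d * c).
rewrite !mevalM m0 mulr0 !psubstM.
by split; [exact: mulf_neq0 | reflexivity | exact: mulf_div].
Qed.

Lemma vanB phi psi : van_at P phi -> van_at P psi -> van_at P (phi - psi).
Proof.
move=> H K; have -> : phi - psi = phi + ratC (-1) * psi by rewrite rmorphN1 mulN1r.
by apply: (vanD H); apply: vanMr K; exact: regC.
Qed.

Lemma van_const a : van_at P (ratC a) -> a = 0.
Proof.
move=> [n [d [d0 n0 E]]]; have D0 := psubst_eval_neq0 d0.
have {}E : psubst P.1 (a%:MP * d - n) = 0.
  by rewrite psubstB psubstM psubstC E (mulfVK D0) subrr.
have := congr1 (meval (vec2 P.2)) (domP E).
rewrite mevalB mevalM mevalC n0 subr0 meval0 => /eqP.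
by rewrite mulf_eq0 (negPf d0) orbF => /eqP.
Qed.

Lemma van1 : ~ van_at P 1.
Proof. by rewrite -(rmorph1 (@ratC C)) => /van_const/eqP; rewrite oner_eq0. Qed.

Lemma reg_inv phi : regular_at P phi -> ~ van_at P phi ->
  phi != 0 /\ regular_at P phi^-1.
Proof.
move=> [n [d [d0 E]]] nv.
have n0 : n.@[vec2 P.2] != 0 by apply/negP => /eqP n0; apply: nv; exists n, d.
split; last by exists d, n; rewrite E invf_div.
rewrite E; apply: (mulf_neq0 (psubst_eval_neq0 n0)).
by rewrite invr_eq0; exact: psubst_eval_neq0.
Qed.

Lemma reg_value phi : regular_at P phi -> exists a, van_at P (phi - ratC a).
Proof.
move=> [n [d [d0 ->]]]; have D0 := psubst_eval_neq0 d0.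
exists (n.@[vec2 P.2] / d.@[vec2 P.2]).
exists (n - (n.@[vec2 P.2] / d.@[vec2 P.2])%:MP * d), d; split; first exact: d0.
  by rewrite mevalB mevalM mevalC (mulfVK d0) subrr.
by rewrite psubstB psubstM psubstC mulrBl (mulfK D0).
Qed.

Lemma van_l : van_at P (P.1.1 - ratC P.2.1).
Proof.
exists ('X_ord0 - P.2.1%:MP), 1; rewrite meval1 oner_neq0 mevalB eval_l mevalC subrr.
by rewrite psubst1 divr1 psubstB psubst_Xl psubstC.
Qed.

Lemma van_r : van_at P (P.1.2 - ratC P.2.2).
Proof.
exists ('X_ord_max - P.2.2%:MP), 1; rewrite meval1 oner_neq0 mevalB eval_r mevalC subrr.
by rewrite psubst1 divr1 psubstB psubst_Xr psubstC.
Qed.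

Lemma van_unit phi psi : regular_at P psi -> phi * psi = 1 -> ~ van_at P phi.
Proof. by move=> K E /(vanMr K); rewrite mulrC E; exact: van1. Qed.

(** The coordinates generate the maximal ideal. *)
Lemma van_decomp phi : van_at P phi -> exists A B,
  [/\ regular_at P A, regular_at P B &
      phi = A * (P.1.1 - ratC P.2.1) + B * (P.1.2 - ratC P.2.2)].
Proof.
have key n : exists A B, n = (n.@[vec2 P.2])%:MP + A * ('X_ord0 - P.2.1%:MP)
    + B * ('X_ord_max - P.2.2%:MP).
  elim/psubst_ind: n => [a|i|p q [A [B E]] [A' [B' E']]|p q [A [B E]] [A' [B' E']]].
  - by exists 0, 0; rewrite mevalC !mul0r !addr0.
  - have [->|->] := ord2 i.
      by exists 1, 0; rewrite eval_l mul1r mul0r addr0 addrC subrK.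
    by exists 0, 1; rewrite eval_r mul1r mul0r addr0 addrC subrK.
  - by exists (A + A'), (B + B'); rewrite mevalD mpolyCD {1}E {1}E'; ring.
  exists (A * q + (p.@[vec2 P.2])%:MP * A'), (B * q + (p.@[vec2 P.2])%:MP * B').
  rewrite mevalM mpolyCM.
  move: E E'; move: (p.@[_]%:MP) (q.@[_]%:MP) ('X_ord0 - _) ('X_ord_max - _).
  move=> pt qt x y E E'.
  transitivity ((pt + A * x + B * y - pt) * q + pt * (qt + A' * x + B' * y)).
    by rewrite -E -E'; ring.
  by ring.
move=> [n [d [d0 n0 ->]]]; have [A [B E]] := key n.
exists (psubst P.1 A / psubst P.1 d), (psubst P.1 B / psubst P.1 d).
split; [by exists A, d | by exists B, d |].
rewrite n0 mpolyC0 add0r in E.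
rewrite {1}E psubstD !psubstM !psubstB psubst_Xl psubst_Xr !psubstC.
by rewrite mulrDl ![_ / psubst _ _]mulrC !mulrA.
Qed.

End Dominant.

(** The local ring of Q contains the values of all polynomials in the
    coordinates of P, with the same residue as at P, hence the inverses of those
    that are nonzero at P. *)
Lemma reg_sub P Q : dominant P.1 -> dominant Q.1 ->
  van_at Q (P.1.1 - ratC P.2.1) -> van_at Q (P.1.2 - ratC P.2.2) ->
  (forall phi, regular_at P phi -> regular_at Q phi) /\
  (forall phi, van_at P phi -> van_at Q phi).
Proof.
move=> domP domQ H1 H2.
have key n : van_at Q (psubst P.1 n - ratC (n.@[vec2 P.2])).
  have reg m : van_at Q (psubst P.1 m - ratC (m.@[vec2 P.2])) -> regular_at Q (psubst P.1 m).
    move=> K; rewrite -[psubst _ _](subrK (ratC (m.@[vec2 P.2]))).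
    by apply: (regD domQ (van_reg K)); exact: regC.
  elim/psubst_ind: n => [a|i|p q Hp Hq|p q Hp Hq].
  - rewrite psubstC mevalC subrr -(ratC0 C).
    by exists 0, 1; rewrite meval0 meval1 oner_neq0 psubst0 mul0r ratC0.
  - by have [->|->] := ord2 i; rewrite ?psubst_Xl ?psubst_Xr ?eval_l ?eval_r.
  - have -> : psubst P.1 (p + q) - ratC (p + q).@[vec2 P.2] =
        (psubst P.1 p - ratC p.@[vec2 P.2]) + (psubst P.1 q - ratC q.@[vec2 P.2]).
      by rewrite psubstD mevalD rmorphD; ring.
    exact: (vanD domQ Hp Hq).
  - have -> : psubst P.1 (p * q) - ratC (p * q).@[vec2 P.2] =
        psubst P.1 q * (psubst P.1 p - ratC p.@[vec2 P.2])
        + ratC p.@[vec2 P.2] * (psubst P.1 q - ratC q.@[vec2 P.2]).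
      by rewrite psubstM mevalM rmorphM; ring.
    apply: (vanD domQ); apply: vanMr; [exact: reg | exact: Hp | exact: regC | exact: Hq].
have reg n : regular_at Q (psubst P.1 n).
  rewrite -[psubst _ _](subrK (ratC (n.@[vec2 P.2]))).
  by apply: (regD domQ (van_reg (key n))); exact: regC.
have inv d : d.@[vec2 P.2] != 0 -> regular_at Q (psubst P.1 d)^-1.
  move=> d0; apply: (proj2 (reg_inv domQ (reg d) _)) => K.
  have := vanB domQ K (key d); rewrite opprB addrC subrK => /(van_const domQ) E.
  by rewrite E eqxx in d0.
split=> [phi [n [d [d0 ->]]]|phi [n [d [d0 n0 ->]]]].
  exact: regM (reg n) (inv d d0).
rewrite mulrC; apply: vanMr (inv d d0) _.
by have := key n; rewrite n0 ratC0 subr0.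
Qed.

Lemma same_point_of P Q : dominant P.1 -> dominant Q.1 ->
  van_at Q (P.1.1 - ratC P.2.1) -> van_at Q (P.1.2 - ratC P.2.2) ->
  van_at P (Q.1.1 - ratC Q.2.1) -> van_at P (Q.1.2 - ratC Q.2.2) ->
  same_point P Q.
Proof.
move=> domP domQ Q1 Q2 P1 P2 phi; split.
  exact: (proj1 (reg_sub domP domQ Q1 Q2)).
exact: (proj1 (reg_sub domQ domP P1 P2)).
Qed.

Lemma same_point_sym P Q : same_point P Q -> same_point Q P.
Proof. by move=> H phi; split=> /H. Qed.

Lemma same_point_trans P Q R : same_point P Q -> same_point Q R -> same_point P R.
Proof. by move=> H K phi; split=> [/H/K | /K/H]. Qed.

(** The maximal ideal consists of the non-units, hence is determined by the
    local ring. *)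
Lemma van_iff P phi : dominant P.1 -> van_at P phi <->
  regular_at P phi /\ forall psi, regular_at P psi -> phi * psi <> 1.
Proof.
move=> domP; split=> [H|[H K]].
  split=> [|psi K E]; first exact: van_reg.
  by have Z := van_unit domP K; exact: (Z _ E).
apply: contrapT => nv; have [n0 I] := reg_inv domP H nv.
exact: K I (divff n0).
Qed.

Lemma same_point_van P Q phi : dominant P.1 -> dominant Q.1 -> same_point P Q ->
  van_at P phi <-> van_at Q phi.
Proof.
move=> domP domQ S.
split=> /van_iff [//|H K]; apply/van_iff => //; split; first exact/S.
- by move=> psi /S/K.
- exact: (proj2 (S _) H).
- by move=> psi /S/K.
Qed.

Lemma same_point_swap P : dominant P.1 -> same_point (swap P.1, swap P.2) P.
Proof.
move=> domP; apply: (@same_point_of (swap P.1, swap P.2) P).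
- exact: (dominant_swap domP).
- exact: domP.
- exact: van_r.
- exact: van_l.
- exact: (@van_r (swap P.1, swap P.2)).
- exact: (@van_l (swap P.1, swap P.2)).
Qed.

(** ** Points of a blow-up *)

Section Blowup.
Variable P : point C.
Hypothesis domP : dominant P.1.
Let U := P.1.1 - ratC P.2.1.
Let V := P.1.2 - ratC P.2.2.

Let U0 : U != 0 := dominant_sub_neq0 P.2.1 domP.

Let chartE : blowup_chart1 P = (U, V / U).
Proof. exact: blowup_chart1E. Qed.

Let domB := dominant_blowup domP.

(** The blow-up is a morphism. *)
Lemma blowup_over b :
  (forall phi, regular_at P phi -> regular_at (blowup_chart1 P, (0, b)) phi) /\
  (forall phi, van_at P phi -> van_at (blowup_chart1 P, (0, b)) phi).
Proof.
set Q := (_, _).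
have vU : van_at Q U.
  by have := van_l Q; rewrite /= chartE /= ratC0 subr0.
apply: (reg_sub domP (domB : dominant Q.1)) => //.
have -> : P.1.2 - ratC P.2.2 = V / U * U by rewrite (mulfVK U0).
apply: vanMr vU; rewrite -(_ : Q.1.2 = V / U) -?psubst_Xr; first exact: reg_poly.
by rewrite psubst_Xr /= chartE.
Qed.

(** Off the exceptional curve u - a is invertible, and with it the change of
    coordinates. *)
Lemma blowup_away a b : a != 0 -> exists2 t, t != P.2 &
  same_point (blowup_chart1 P, (a, b)) (P.1, t).
Proof.
move=> a0; exists (P.2.1 + a, P.2.2 + a * b).
  rewrite -pair_eqE /= negb_and; apply/orP; left.
  by rewrite -subr_eq0 addrC addKr.
set Q := (_, (a, b)); set R := (P.1, _).
have domQ : dominant Q.1 := domB; have domR : dominant R.1 := domP.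
have QU : Q.1.1 = U by rewrite /= chartE.
have QW : Q.1.2 = V / U by rewrite /= chartE.
have rU : regular_at R U.
  by rewrite /U -[P.1.1]/(R.1.1) -psubst_Xl; apply: (regB domR (reg_poly _ _)); exact: regC.
have vU : van_at R (U - ratC a).
  have := van_l R; rewrite /= rmorphD /=; congr (van_at R _).
  by rewrite /U; ring.
have vV : van_at R (V - ratC (a * b)).
  have := van_r R; rewrite /= rmorphD /=; congr (van_at R _).
  by rewrite /V; ring.
have iU : regular_at R U^-1.
  apply: (proj2 (reg_inv domR rU _)) => K; have := vanB domR K vU.
  by rewrite opprB addrC subrK => /(van_const domR) E; rewrite E eqxx in a0.
have vQU : van_at Q (U - ratC a) by have := van_l Q; rewrite QU.
have vQW : van_at Q (V / U - ratC b) by have := van_r Q; rewrite QW.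
have rQU : regular_at Q U by rewrite -QU -psubst_Xl; exact: reg_poly.
apply: (same_point_of domQ domR).
- by rewrite QU.
- rewrite QW; have -> : V / U - ratC Q.2.2 =
      U^-1 * (V - ratC (a * b)) - (U^-1 * ratC b) * (U - ratC a).
    by rewrite rmorphM; exact: slope_aux U0.
  apply: (vanB domR); apply: vanMr => //.
  by apply: (regM iU); exact: regC.
- have -> : R.1.1 - ratC R.2.1 = U - ratC a by rewrite /= rmorphD /= /U; ring.
  exact: vQU.
have -> : R.1.2 - ratC R.2.2 = U * (V / U - ratC b) + ratC b * (U - ratC a).
  rewrite mulrBr mulrCA (divff U0) mulr1 /= rmorphD rmorphM /= /V.
  by ring.
apply: (vanD domQ); apply: vanMr => //; exact: regC.
Qed.

Variable P' : point C.
Hypothesis domP' : dominant P'.1.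
Hypothesis PP' : same_point P P'.
Let U' := P'.1.1 - ratC P'.2.1.
Let V' := P'.1.2 - ratC P'.2.2.

Lemma blowup_slopes b : regular_at (blowup_chart1 P, (0, b)) (U' / U) /\
  regular_at (blowup_chart1 P, (0, b)) (V' / U).
Proof.
set Q := (_, _); have domQ : dominant Q.1 := domB.
have [regQ _] := blowup_over b.
have W : regular_at Q (V / U).
  by rewrite -(_ : Q.1.2 = V / U) -?psubst_Xr; [exact: reg_poly | rewrite psubst_Xr /= chartE].
have key phi : van_at P phi -> regular_at Q (phi / U).
  move=> /(van_decomp) [A [B [rA rB ->]]]; rewrite -/U -/V.
  have -> : (A * U + B * V) / U = A + B * (V / U) by rewrite mulrDl (mulfK U0) mulrA.
  by apply: (regD domQ); [exact: regQ | apply: regM W; exact: regQ].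
split; apply: key; apply/(same_point_van _ domP domP' PP'); [exact: van_l | exact: van_r].
Qed.

(** U is a combination of U' and V', so that U' / U and V' / U do not both
    vanish at a point of the exceptional curve. *)
Lemma blowup_dichotomy b : ~ van_at (blowup_chart1 P, (0, b)) (U' / U) \/
  ~ van_at (blowup_chart1 P, (0, b)) (V' / U).
Proof.
set Q := (_, _); have domQ : dominant Q.1 := domB.
have [//|/contrapT vU] := pselect (~ van_at Q (U' / U)); first by left.
right=> vV; apply: (van1 domQ).
have : van_at P' U by apply/(same_point_van _ domP domP' PP'); exact: van_l.
move=> /(van_decomp) [A [B [rA rB E]]]; rewrite -/U' -/V' in E.
have -> : 1 = A * (U' / U) + B * (V' / U) by rewrite !mulrA -mulrDl -E (divff U0).
have [regQ _] := blowup_over b.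
by apply: (vanD domQ); apply: vanMr => //; exact/regQ/PP'.
Qed.

End Blowup.

(** The blow-up does not depend on the coordinates (U', V') chosen at the point:
    at a point where U' / U is a unit, V' / U' = (V' / U) / (U' / U) is regular
    and takes some value b'. *)
Lemma blowup_transfer P P' b : dominant P.1 -> dominant P'.1 -> same_point P P' ->
  ~ van_at (blowup_chart1 P, (0, b))
      ((P'.1.1 - ratC P'.2.1) / (P.1.1 - ratC P.2.1)) ->
  exists b', same_point (blowup_chart1 P, (0, b)) (blowup_chart1 P', (0, b')).
Proof.
move=> domP domP' PP'.
set U := P.1.1 - _; set U' := P'.1.1 - _.
pose V := P.1.2 - ratC P.2.2; pose V' := P'.1.2 - ratC P'.2.2.
set Q := (blowup_chart1 P, _); have domQ : dominant Q.1 := dominant_blowup domP.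
have U0 : U != 0 := dominant_sub_neq0 _ domP.
have U'0 : U' != 0 := dominant_sub_neq0 _ domP'.
move=> nv; have [rU' rV'] := blowup_slopes domP domP' PP' b.
rewrite -/U -/U' -/V' -/Q in rU' rV' nv.
have [_ iU'] := reg_inv domQ rU' nv; rewrite invf_div in iU'.
have rW : regular_at Q (V' / U').
  have -> : V' / U' = V' / U * (U / U') by rewrite mulrA (mulfVK U0).
  exact: regM.
have [b' vb'] := reg_value domQ rW; exists b'.
set Q' := (blowup_chart1 P', _); have domQ' : dominant Q'.1 := dominant_blowup domP'.
have QE : Q.1 = (U, V / U) by exact: blowup_chart1E.
have Q'E : Q'.1 = (U', V' / U') by exact: blowup_chart1E.
have vQU : van_at Q U by have := van_l Q; rewrite QE /= ratC0 subr0.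
have vQU' : van_at Q (U').
  have -> : U' = U' / U * U by rewrite (mulfVK U0).
  exact: vanMr.
have [sub subv] : (forall phi, regular_at Q' phi -> regular_at Q phi) /\
    (forall phi, van_at Q' phi -> van_at Q phi).
  by apply: (reg_sub domQ' domQ); rewrite Q'E //= ratC0 subr0.
have [rU rV] := blowup_slopes domP' domP (same_point_sym PP') b'.
rewrite -/U -/U' -/V -/Q' in rU rV.
have nvU : ~ van_at Q' (U / U').
  move/subv; apply: (van_unit domQ rU').
  by rewrite mulrA (mulfVK U'0) (divff U0).
have [_ iU] := reg_inv domQ' rU nvU; rewrite invf_div in iU.
have rW' : regular_at Q' (V / U).
  have -> : V / U = V / U' * (U' / U) by rewrite mulrA (mulfVK U'0).
  exact: regM.
have [c vc] := reg_value domQ' rW'.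
have vQ'U' : van_at Q' U' by have := van_l Q'; rewrite Q'E /= ratC0 subr0.
have vQ'U : van_at Q' U.
  have -> : U = U / U' * U' by rewrite (mulfVK U'0).
  exact: vanMr.
have cb : c = b.
  have := van_r Q; rewrite QE /= => /(vanB domQ (subv _ vc)).
  rewrite opprB addrC addrA subrK -rmorphB => /(van_const domQ) /eqP.
  by rewrite subr_eq0 => /eqP ->.
apply: (same_point_of domQ domQ').
- by rewrite QE /= ratC0 subr0.
- by rewrite QE /= -cb.
- by rewrite Q'E /= ratC0 subr0.
- by rewrite Q'E.
Qed.

End LocalRings.

(** * Local rings of curves *)

Fact pow_aux (F : fieldType) (u x y : F) (j b : nat) : u != 0 ->
  u ^+ (j.+1 + b) * x / (u ^+ b * y) = u * (u ^+ j * x / y).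
Proof.
move=> u0; rewrite exprD exprS [_ * u ^+ b * x]mulrAC [u ^+ b * y]mulrC -mulf_div.
by rewrite divff ?expf_neq0 // mulr1 !mulrA.
Qed.

Fact pow_cancel (F : fieldType) (u x y : F) (b : nat) : u != 0 ->
  u ^+ b * x / (u ^+ b * y) = x / y.
Proof. by move=> u0; rewrite -mulf_div divff ?expf_neq0 // mul1r. Qed.

Section Curves.
Variable C : fieldType.
Implicit Types (p q : {poly C}) (n d : {mpoly C[2]}) (phi : ratfun C).
Implicit Types (D : curve C) (w s : int * int).

(** The restriction of d to the axis u = 0. *)
Definition axis d : {poly C} := mmap (@polyC C) (vec2 (0, 'X)) d.

HB.instance Definition _ := GRing.RMorphism.copy axis
  (mmap (@polyC C) (vec2 (0, 'X))).

Lemma axis_C a : axis a%:MP = a%:P.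
Proof. exact: mmapC. Qed.

Lemma axis_l : axis 'X_ord0 = 0.
Proof. by rewrite /axis mmapX mmap1U. Qed.

Lemma axis_r : axis 'X_ord_max = 'X.
Proof. by rewrite /axis mmapX mmap1U. Qed.

Lemma axisB d n : axis (d - n) = axis d - axis n.
Proof. exact: rmorphB. Qed.

Lemma axisM d n : axis (d * n) = axis d * axis n.
Proof. exact: rmorphM. Qed.

Lemma horner_axis d t : (axis d).[t] = d.@[vec2 (0, t)].
Proof.
elim/psubst_ind: d => [a|i|p q P Q|p q P Q].
- by rewrite axis_C hornerC mevalC.
- have [->|->] := ord2 i.
    by rewrite axis_l horner0 eval_l.
  by rewrite axis_r hornerX eval_r.
- by rewrite rmorphD hornerD mevalD; congr (_ + _).
- by rewrite rmorphM hornerM mevalM; congr (_ * _).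
Qed.

(** A polynomial on the axis, as a function of v alone. *)
Definition extend p : {mpoly C[2]} := (map_poly (@mpolyC 2 C) p).['X_ord_max].

Lemma extendC a : extend a%:P = a%:MP.
Proof. by rewrite /extend map_polyC hornerC. Qed.

Lemma extendX : extend 'X = 'X_ord_max.
Proof. by rewrite /extend map_polyX hornerX. Qed.

Lemma extendD p q : extend (p + q) = extend p + extend q.
Proof. by rewrite /extend rmorphD hornerD. Qed.

Lemma extendM p q : extend (p * q) = extend p * extend q.
Proof. by rewrite /extend rmorphM hornerM. Qed.

Lemma axis_decomp d : exists q : {mpoly C[2]}, d = extend (axis d) + 'X_ord0 * q.
Proof.
elim/psubst_ind: d => [a|i|p q [A E] [B E']|p q [A E] [B E']].
- by exists 0; rewrite axis_C extendC mulr0 addr0.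
- have [->|->] := ord2 i.
    by exists 1; rewrite axis_l -(polyC0 C) extendC mpolyC0 add0r mulr1.
  by exists 0; rewrite axis_r extendX mulr0 addr0.
- exists (A + B); rewrite rmorphD extendD.
  by rewrite {1}E {1}E'; ring.
exists (A * q + extend (axis p) * B); rewrite rmorphM extendM.
move: E E'; move: (extend (axis p)) (extend (axis q)) ('X_ord0) => a b x E E'.
transitivity ((a + x * A - a) * q + a * (b + x * B)); last by ring.
by rewrite -E -E'; ring.
Qed.

Lemma psubst_extend e p : psubst e (extend p) = (map_poly (@ratC C) p).[e.2].
Proof.
elim/poly_ind: p => [|p c IH].
  by rewrite -(polyC0 C) extendC psubstC map_polyC hornerC.
rewrite extendD extendM extendX extendC psubstD psubstM psubstC psubst_Xr IH.
by rewrite rmorphD rmorphM /= map_polyX map_polyC /= hornerD hornerM hornerX hornerC.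
Qed.

Lemma axis_factor d : d != 0 ->
  exists k d1, d = 'X_ord0 ^+ k * d1 /\ axis d1 != 0.
Proof.
have [m] := ubnP (msize d); elim: m d => // m IH d dm d0.
have [a0|a0] := eqVneq (axis d) 0; last by exists 0%N, d; rewrite expr0 mul1r.
have [q E] := axis_decomp d; rewrite a0 -(polyC0 C) extendC mpolyC0 add0r in E.
have q0 : q != 0 by apply: contraNneq d0 => q0; rewrite E q0 mulr0.
have x0 : 'X_ord0 != 0 :> {mpoly C[2]} by rewrite -msupp_eq0 msuppX.
have [|k [d1 [E1 n1]]] := IH q _ q0.
  by move: dm; rewrite E msizeM // msizeX mdeg1 /= add1n ltnS.
by exists k.+1, d1; rewrite E {1}E1 exprS mulrA.
Qed.

Hypothesis char0 : [pchar C] =i pred0.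

Lemma poly_nonroot p : p != 0 -> exists t, p.[t] != 0.
Proof.
move=> p0; apply: contrapT => H.
pose rs : seq C := [seq i%:R | i <- iota 0 (size p)].
have : (size rs < size p)%N.
  apply: max_poly_roots => //; last first.
    by rewrite (map_inj_uniq (natr_pchar0_inj char0)) iota_uniq.
  by apply/allP => t _; apply/negPn/negP => nt; apply: H; exists t.
by rewrite size_map size_iota ltnn.
Qed.

Lemma axis_neq0P d : axis d != 0 <-> exists t, d.@[vec2 (0, t)] != 0.
Proof.
split=> [/poly_nonroot [t]|[t]]; rewrite -?horner_axis; first by exists t; rewrite -horner_axis.
by apply: contraNneq => ->; rewrite horner0.
Qed.

Lemma regular_alongP D phi : regular_along D phi <->
  exists n d, axis d != 0 /\ phi = psubst D n / psubst D d.
Proof.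
split=> [[t [n [d [d0 E]]]]|[n [d [/axis_neq0P [t d0] E]]]].
  by exists n, d; split; [apply/axis_neq0P; exists t | exact: E].
by exists t, n, d.
Qed.

Lemma vanishes_alongP D phi : vanishes_along D phi <->
  exists (q d : {mpoly C[2]}), axis d != 0 /\ phi = D.1 * (psubst D q / psubst D d).
Proof.
split=> [[n [d [/axis_neq0P d0 n0 E]]]|[q [d [/axis_neq0P d0 E]]]].
  have [q nE] := axis_decomp n.
  have a0 : axis n = 0.
    apply/eqP/negPn/negP => /poly_nonroot [t]; rewrite horner_axis n0 eqxx.
    by [].
  exists q, d; split; first exact: d0.
  rewrite E mulrA; congr (_ / _).
  by rewrite {1}nE a0 -(polyC0 C) extendC mpolyC0 add0r psubstM psubst_Xl.
exists ('X_ord0 * q), d; split; first exact: d0.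
  by move=> t; rewrite mevalM eval_l mul0r.
by rewrite E psubstM psubst_Xl mulrA.
Qed.

(** The local ring of the curve is a discrete valuation ring with uniformizer
    D.1: factor the powers of D.1 out of a numerator and a denominator. *)
Lemma curve_cases D phi : coords D -> phi != 0 ->
  [\/ vanishes_along D phi, regular_along D phi /\ regular_along D phi^-1
    | vanishes_along D phi^-1].
Proof.
move=> [domD /(_ phi) [n [d [D0 E]]]] phi0.
have d0 : d != 0 by apply: contraNneq D0 => ->; rewrite psubst0.
have n0 : n != 0 by apply: contraNneq phi0 => n0; rewrite E n0 psubst0 mul0r.
have [k [n1 [nE n10]]] := axis_factor n0.
have [l [d1 [dE d10]]] := axis_factor d0.
have u0 : D.1 != 0 by exact: (fst (dominant_neq0 domD)).
have {}E : phi = D.1 ^+ k * psubst D n1 / (D.1 ^+ l * psubst D d1).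
  by rewrite E nE dE !psubstM !psubstXn psubst_Xl.
have pos j a b c d' : axis d' != 0 ->
    a = D.1 ^+ (j.+1 + b) * psubst D c / (D.1 ^+ b * psubst D d') ->
    vanishes_along D a.
  move=> d'0 ->; apply/vanishes_alongP; exists ('X_ord0 ^+ j * c), d'; split; first exact: d'0.
  by rewrite psubstM psubstXn psubst_Xl; exact: pow_aux u0.
have [kl|lk|kl] := ltngtP k l.
- apply: Or33; apply: (pos (l - k).-1 _ k d1 n1) => //.
  by rewrite E invf_div; congr (_ ^+ _ * _ / _); lia.
- apply: Or31; apply: (pos (k - l).-1 _ l n1 d1) => //.
  by rewrite E; congr (_ ^+ _ * _ / _); lia.
apply: Or32; have {}E : phi = psubst D n1 / psubst D d1.
  by rewrite E kl; exact: pow_cancel u0.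
split; apply/regular_alongP; first by exists n1, d1.
by exists d1, n1; rewrite E invf_div.
Qed.

(** The local ring of D is the valuation ring of the monomial valuation s. *)
Definition represents s D : Prop :=
  [/\ coords D, forall phi, regular_along D phi <-> rge s 0 phi
    & forall phi, vanishes_along D phi <-> rge s 1 phi].

(** A discrete valuation ring contained in another one, with its maximal ideal
    in the other maximal ideal, is equal to it: the inverse of a function
    outside of the former vanishes along D, hence has a positive valuation. *)
Lemma represents_of s D : coords D ->
  (forall phi, regular_along D phi -> rge s 0 phi) -> rge s 1 D.1 -> represents s D.
Proof.
move=> cD R U.
have V phi : vanishes_along D phi -> rge s 1 phi.
  move/vanishes_alongP => [q [d [d0 ->]]]; rewrite -[1]addr0; apply: (rgeM U).
  by apply: R; apply/regular_alongP; exists q, d.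
have van0 : vanishes_along D 0.
  by apply/vanishes_alongP; exists 0, 1; rewrite rmorph1 oner_neq0 psubst0 mul0r mulr0.
have van_reg phi : vanishes_along D phi -> regular_along D phi.
  move/vanishes_alongP => [q [d [d0 ->]]]; apply/regular_alongP.
  by exists ('X_ord0 * q), d; rewrite psubstM psubst_Xl mulrA.
split; [exact: cD | move=> phi; split; first exact: R | move=> phi; split; first exact: V].
  have [->|phi0] := eqVneq phi 0; first by move=> _; exact: van_reg.
  case: (curve_cases cD phi0) => [/van_reg H _|[H _] _|/V]; [exact: H | exact: H |].
  rewrite /rge invr_eq0 (rvalV s phi0) => /(_ phi0) A /(_ phi0) B.
  by exfalso; lia.
have [->|phi0] := eqVneq phi 0; first by move=> _; exact: van0.
case: (curve_cases cD phi0) => [H _|[_ /R]|/V]; first exact: H.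
all:
  rewrite /rge invr_eq0 (rvalV s phi0) => /(_ phi0) A /(_ phi0) B; exfalso; lia.
Qed.

Hypothesis closedC : forall p, (1 < size p)%N -> exists x, root p x.

Lemma not_rge1 w phi : rge w 0 phi -> ~ rge w 1 phi -> phi != 0 /\ rval w phi = 0.
Proof.
move=> P N; have phi0 : phi != 0.
  by apply/eqP => E; apply: N; rewrite E; exact: rge0.
split; [exact: phi0 | apply/le_anti/andP; split; last exact: P].
by rewrite leNgt; apply/negP => H; apply: N => _; rewrite -gtz0_ge1.
Qed.

Section TranscendentalResidue.
Variables (w : int * int) (D : curve C).
Hypothesis wU : rge w 1 D.1.
Hypothesis wW : rge w 0 D.2.
Hypothesis wWa : forall a, ~ rge w 1 (D.2 - ratC a).

(** Over an algebraically closed field a polynomial in v is a product of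
    factors v - a, all of valuation 0. *)
Lemma rval_residue p : p != 0 ->
  (map_poly (@ratC C) p).[D.2] != 0 /\ rval w (map_poly (@ratC C) p).[D.2] = 0.
Proof.
have [m] := ubnP (size p); elim: m p => // m IH p pm p0.
have [p1|p1] := leqP (size p) 1.
  have pE := size1_polyC p1; rewrite pE map_polyC hornerC.
  have c0 : p`_0 != 0 by apply: contraNneq p0 => c0; rewrite pE c0 polyC0.
  by split; [rewrite ratC_eq0 | exact: rvalC].
have [x /factor_theorem [q pE]] := closedC p1.
have q0 : q != 0 by apply: contraNneq p0 => q0; rewrite pE q0 mul0r.
have [|Q0 Qv] := IH q _ q0.
  by move: pm; rewrite pE size_Mmonic ?monicXsubC // size_XsubC; lia.
have [X0 Xv] := not_rge1 (rgeB wW (@rgeC _ w x)) (@wWa x).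
have -> : (map_poly (@ratC C) p).[D.2] = (map_poly (@ratC C) q).[D.2] * (D.2 - ratC x).
  by rewrite pE rmorphM /= rmorphB /= map_polyX map_polyC hornerM hornerXsubC.
split; first exact: (mulf_neq0 Q0 X0).
by rewrite (rvalM w Q0 X0) Qv Xv.
Qed.

Lemma rge_psubst n : rge w 0 (psubst D n).
Proof.
have wU0 : rge w 0 D.1 by exact: rge_le wU.
elim/psubst_ind: n => [a|i|p q P Q|p q P Q].
- by rewrite psubstC; exact: rgeC.
- case: (ord2 i) => ->; first by rewrite psubst_Xl; exact: wU0.
  by rewrite psubst_Xr; exact: wW.
- by rewrite psubstD; exact: rgeD.
- by rewrite psubstM -[0 : int]addr0; exact: rgeM.
Qed.

(** If u has positive valuation and the residue of v is transcendental, then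
    the valuation of a polynomial in u and v is determined by u. *)
Lemma regular_along_rge phi : regular_along D phi -> rge w 0 phi.
Proof.
move/regular_alongP => [n [d [d0 E]]].
have [Z0 Zv] := rval_residue d0.
have [q dE] := axis_decomp d.
have [d0' dv] : psubst D d != 0 /\ rval w (psubst D d) = 0.
  apply: not_rge1; first exact: rge_psubst.
  rewrite dE psubstD psubst_extend psubstM psubst_Xl => H.
  have : rge w 1 (map_poly (@ratC C) (axis d)).[D.2].
    rewrite -[_.[_]](addrK (D.1 * psubst D q)); apply: (rgeB H).
    by rewrite -[1]addr0; apply: (rgeM wU); exact: rge_psubst.
  by rewrite /rge Zv => /(_ Z0).
have -> : 0 = 0 - rval w (psubst D d) by rewrite dv.
by apply: (rge_divr d0'); rewrite E (mulfVK d0'); exact: rge_psubst.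
Qed.

End TranscendentalResidue.

(** ** Curves of the toric charts *)

Lemma mono_poly (m : int * int) : 0 <= m.1 -> 0 <= m.2 ->
  exists k : 'X_{1..2}, mono C m = 'X_[k]%:F /\ forall w, wt w k = dot w m.
Proof.
move=> m1 m2; exists [multinom (if i == ord0 then absz m.1 else absz m.2) | i < 2].
split=> [|w].
  by rewrite -psubst_id psubst_monomial !mnmE /= !exprnP (gez0_abs m1) (gez0_abs m2).
by rewrite /wt !mnmE /= (gez0_abs m1) (gez0_abs m2).
Qed.

(** In the numerator of x^i y^j - a the two monomials are distinct and have the
    same weight, so that they do not cancel. *)
Lemma mono_residue w m a : m != 0 -> dot w m = 0 -> ~ rge w 1 (mono C m - ratC a).
Proof.
move=> m0 wm H; pose N : int := (`|m.1| + `|m.2|)%N.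
have [||k [kE kw]] := @mono_poly (m + (N, N)); try by rewrite /N /=; lia.
have [||l [lE lw]] := @mono_poly (N, N); try by rewrite /N /=; lia.
have kl : k != l.
  apply: contraNneq m0 => kl; apply/eqP.
  have K (w' : int * int) : dot w' m = 0.
    by have := kw w'; rewrite kl lw /dot /=; lia.
  by have := K (1, 0); have := K (0, 1); rewrite /dot /=; case: (m) => x y /= ? ?; congr pair; lia.
pose n : {mpoly C[2]} := 'X_[k] - a%:MP * 'X_[l].
have kn : k \in msupp n.
  rewrite mcoeff_msupp mcoeffB mcoeffCM !mcoeffX eqxx [l == k]eq_sym (negPf kl).
  by rewrite mulr0 subr0 oner_neq0.
have n0 : n != 0 by apply: contraTneq kn => ->; rewrite msupp0.
have nE : n%:F = (mono C m - ratC a) * mono C (N, N).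
  by rewrite mulrBl monoM kE lE /n tofracB tofracM.
have := rgeM H (@rge_rval _ w (mono C (N, N))).
rewrite -nE /rge tofrac_eq0 (rval_poly w n0) => /(_ n0).
have := pval_le w kn; rewrite kw rval_mono.
have -> : dot w (m + (N, N)) = dot w m + dot w (N, N) by rewrite /dot /=; ring.
by rewrite wm; move: (pval _ _) (dot _ _) => x y; lia.
Qed.

Lemma toric_along (p q : int * int) phi : wedge p q = 1 ->
  (regular_along (toric C p q) phi -> rge p 0 phi) /\
  (regular_along (swap (toric C p q)) phi -> rge q 0 phi).
Proof.
move=> pq.
have nz (v : int * int) : prim v -> (v.2, - v.1) != 0 /\ (- v.2, v.1) != 0.
  move/prim_neq0 => v0; split; apply: contraNneq v0 => -[A B]; apply/eqP;
  by case: v A B => x y /= A B; congr pair; lia.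
have [pp qp] := wedge_prim pq.
split; apply: regular_along_rge.
- by move=> _; rewrite rval_toric1 pq.
- by move=> _; rewrite rval_toric2 wedgexx.
- by move=> a; apply: mono_residue; [exact: (proj2 (nz _ pp)) | rewrite /dot /=; ring].
- by move=> _; rewrite rval_toric2 pq.
- by move=> _; rewrite rval_toric1 wedgexx.
- by move=> a; apply: mono_residue; [exact: (proj1 (nz _ qp)) | rewrite /dot /=; ring].
Qed.

Lemma represents_toric (p q : int * int) : wedge p q = 1 ->
  represents p (toric C p q) /\ represents q (swap (toric C p q)).
Proof.
move=> pq; have ct := coords_toric C pq.
split; apply: represents_of.
- exact: ct.
- by move=> phi; exact: (proj1 (toric_along _ pq)).
- by move=> _; rewrite rval_toric1 pq.
- exact: coords_swap.
- by move=> phi; exact: (proj2 (toric_along _ pq)).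
- by move=> _; rewrite rval_toric2 pq.
Qed.

End Curves.

(** * Chains of iterated blow-ups *)

(** The pairs of neighbours of a cyclic sequence. *)
Definition cpairs (T : Type) (l : seq T) : seq (T * T) := zip l (rot 1 l).

Lemma zip_rot (S T : Type) k (s : seq S) (t : seq T) : size s = size t ->
  zip (rot k s) (rot k t) = rot k (zip s t).
Proof.
move=> st; have [kl|lk] := leqP (size s) k.
  by rewrite !rot_oversize // ?size_zip -?st ?minnn.
have sz : size (take k s) = size (take k t) by rewrite !size_take st.
have sd : size (drop k s) = size (drop k t) by rewrite !size_drop st.
have E : zip s t = zip (take k s) (take k t) ++ zip (drop k s) (drop k t).
  by rewrite -(zip_cat _ _ sz) !cat_take_drop.
have szk : size (zip (take k s) (take k t)) = k.
  by rewrite size_zip -sz minnn size_take lk.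
by rewrite /rot (zip_cat _ _ sd) E (drop_size_cat _ szk) (take_size_cat _ szk).
Qed.

Lemma cpairs_rot (T : Type) k (l : seq T) : cpairs (rot k l) = rot k (cpairs l).
Proof. by rewrite /cpairs rot_rot zip_rot // size_rot. Qed.

Lemma cpairs_cons2 (T : Type) (u v : T) l :
  cpairs (u :: v :: l) = (u, v) :: zip (v :: l) (rcons l u).
Proof. by rewrite /cpairs rot1_cons. Qed.

Lemma cpairs_cons3 (T : Type) (u w v : T) l :
  cpairs (u :: w :: v :: l) = (u, w) :: (w, v) :: zip (v :: l) (rcons l u).
Proof. by rewrite /cpairs rot1_cons. Qed.

Lemma count1_eq (T : eqType) (a : pred T) (s : seq T) x y : count a s = 1%N ->
  x \in s -> y \in s -> a x -> a y -> x = y.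
Proof.
rewrite -size_filter => H xs ys ax ay.
have: x \in filter a s by rewrite mem_filter ax.
have: y \in filter a s by rewrite mem_filter ay.
by case: (filter a s) H => [|z [|]] // _; rewrite !inE => /eqP -> /eqP ->.
Qed.

(** The half-open cones of neighbours partition the plane minus the origin; in
    particular a pair of neighbours occurs only once. *)
Definition cfan (l : seq (int * int)) : Prop :=
  (forall c, c \in cpairs l -> wedge c.1 c.2 = 1) /\
  (forall w, w != 0 -> count (fun c => incone c.1 c.2 w) (cpairs l) = 1%N).

Lemma cfan_rot k l : cfan l -> cfan (rot k l).
Proof.
move=> [A B]; split=> [c|w w0]; rewrite cpairs_rot ?mem_rot; first exact: A.
have /permP -> : perm_eq (rot k (cpairs l)) (cpairs l) by rewrite perm_rot.
exact: B.
Qed.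

Lemma cfan_insert u v l : cfan (u :: v :: l) -> cfan [:: u, u + v, v & l].
Proof.
rewrite /cfan cpairs_cons2 cpairs_cons3 => -[A B].
have uv : wedge u v = 1 by apply: (A (u, v)); rewrite inE eqxx.
split=> [c|w /B <- /=].
  rewrite !inE => /or3P[/eqP ->|/eqP ->|H] /=.
  - by rewrite wedgeDr wedgexx add0r.
  - by rewrite wedgeDl wedgexx addr0.
  - by apply: A; rewrite inE H orbT.
have := incone_mediant_disjoint w uv; rewrite (incone_mediant w uv) addnA.
by case: incone; case: incone.
Qed.

(** The sum u + v is in the half-open cones of (u, v) and of (p, q). *)
Lemma cfan_cone l u v p q : cfan l -> (u, v) \in cpairs l -> (p, q) \in cpairs l ->
  0 <= wedge u q -> 0 <= wedge p u -> 0 <= wedge v q -> 0 <= wedge p v ->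
  (p, q) = (u, v).
Proof.
move=> [A B] uvl pql uq pu vq pv.
have uv : wedge u v = 1 by exact: (A _ uvl).
have pq : wedge p q = 1 by exact: (A _ pql).
have w0 : u + v != 0.
  apply: contra_eqN uv => /eqP E; have := wedgeDr u v u.
  by rewrite E wedgexx add0r => <-; rewrite /wedge /= !mulr0 subr0.
apply: (count1_eq (B _ w0) pql uvl) => /=; rewrite /incone wedgeDl wedgeDr; last first.
  by rewrite !wedgexx uv.
rewrite (addr_ge0 pu pv) andbT lt_neqAle addr_ge0 // andbT eq_sym.
apply/eqP => E; have [uq0 vq0] : wedge u q = 0 /\ wedge v q = 0 by lia.
move: uv; rewrite (coneE u pq) (coneE v pq) uq0 vq0 wedge_linl !wedge_linr.
by rewrite !wedgexx !mul0r !mulr0.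
Qed.

Section BlowupChains.
Variable C : fieldType.
Hypothesis char0 : [pchar C] =i pred0.
Hypothesis closedC : forall p : {poly C}, (1 < size p)%N -> exists x, root p x.
Implicit Types (P Q : point C) (phi psi : ratfun C) (p q s : int * int).
Implicit Types (X : surface C) (ch : seq ((int * int) * curve C)).

(** P is in the closure of the center of the monomial valuation s. *)
Definition contains P s : Prop := forall phi, regular_at P phi -> rge s 0 phi.

(** In particular no two neighbouring chain curves both pass through P. *)
Definition noncorner P : Prop :=
  forall s s', contains P s -> contains P s' -> wedge s s' = 0.

Definition corner p q : point C := (toric C p q, (0, 0)).

Lemma noncorner_sub P Q : (forall phi, regular_at P phi -> regular_at Q phi) ->
  noncorner P -> noncorner Q.
Proof.
move=> H N s s' cs cs'; apply: N => phi /H; [exact: cs | exact: cs'].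
Qed.

Lemma rval_unit s phi : phi != 0 -> rge s 0 phi -> rge s 0 phi^-1 -> rval s phi = 0.
Proof.
move=> p0 A B; have := A p0; have := B; rewrite /rge invr_eq0 => /(_ p0).
by rewrite (rvalV s p0); lia.
Qed.

Lemma corner_contains p q s : wedge p q = 1 -> contains (corner p q) s ->
  0 <= wedge s q /\ 0 <= wedge p s.
Proof.
move=> pq H.
have X0 : (toric C p q).1 != 0 by exact: mono_neq0.
have Y0 : (toric C p q).2 != 0 by exact: mono_neq0.
have /H := reg_poly (corner p q) 'X_ord0; rewrite psubst_Xl => /(_ X0).
have /H := reg_poly (corner p q) 'X_ord_max; rewrite psubst_Xr => /(_ Y0).
by rewrite rval_toric1 rval_toric2.
Qed.

Lemma contains_corner p q : wedge p q = 1 ->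
  contains (corner p q) p /\ contains (corner p q) q.
Proof.
move=> pq; have dT := proj1 (coords_toric C pq); split=> phi H.
  by apply: (proj1 (toric_along char0 closedC phi pq)); exists 0.
apply: (proj2 (toric_along char0 closedC phi pq)); exists 0.
exact/(same_point_swap (P := corner p q) dT phi).
Qed.

(** At any other point of a toric chart one of the two coordinates is a unit,
    and has value 0 under every valuation nonnegative on the local ring. *)
Lemma toric_point p q (t : C * C) : wedge p q = 1 ->
  t = (0, 0) \/ noncorner (toric C p q, t).
Proof.
case: t => a b pq; set P : point C := (toric C p q, (a, b)).
have dT : dominant P.1 := proj1 (coords_toric C pq).
have unit (z : ratfun C) c : regular_at P z -> van_at P (z - ratC c) -> c != 0 ->
    forall s, contains P s -> rval s z = 0.
  move=> rz vz c0 s cs; have [|z0 iz] := reg_inv dT rz.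
    move=> v; have := vanB dT v vz; rewrite opprB addrC subrK => /(van_const dT) E.
    by rewrite E eqxx in c0.
  exact: rval_unit z0 (cs _ rz) (cs _ iz).
have [->|a0] := eqVneq a 0; last first.
  right=> s s' cs cs'.
  have rX : regular_at P (toric C p q).1 by rewrite -psubst_Xl; exact: (reg_poly P).
  have E r : contains P r -> wedge r q = 0.
    by rewrite -(rval_toric1 C p q r); exact: unit rX (van_l P) a0 r.
  rewrite (coneE s pq) (coneE s' pq) (E _ cs) (E _ cs') wedge_linl !wedge_linr.
  by rewrite !wedgexx !mul0r !mulr0 ?addr0 ?mulr0.
have [->|b0] := eqVneq b 0; first by left.
right=> s s' cs cs'.
have rY : regular_at P (toric C p q).2 by rewrite -psubst_Xr; exact: (reg_poly P).
have E r : contains P r -> wedge p r = 0.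
  by rewrite -(rval_toric2 C p q r); exact: unit rY (van_r P) b0 r.
rewrite (coneE s pq) (coneE s' pq) (E _ cs) (E _ cs') wedge_linl !wedge_linr.
by rewrite !wedgexx !mul0r !mulr0 ?addr0 ?mulr0.
Qed.

(** ** Points over a corner *)

(** The points over a corner, computed in the toric coordinates or in the
    swapped ones. *)
Lemma over_corner p q P b : wedge p q = 1 -> coords P.1 ->
  same_point P (corner p q) -> exists c,
    same_point (blowup_chart1 P, (0, b)) (toric C (p + q) q, (0, c)) \/
    same_point (blowup_chart1 P, (0, b)) (toric C p (p + q), (c, 0)).
Proof.
move=> pq [domP _] PT.
have dT : dominant (corner p q).1 := proj1 (coords_toric C pq).
have [nX|nY] := blowup_dichotomy domP dT PT b.
  have [c Hc] := blowup_transfer domP dT PT nX; exists c; left.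
  by rewrite toric_blowup1 in Hc.
pose T' : point C := (swap (toric C p q), (0, 0)).
have dT' : dominant T'.1 := dominant_swap dT.
have PT' : same_point P T'.
  by apply: same_point_trans PT (same_point_sym _); exact: (same_point_swap (P := corner p q)).
have [c Hc] := blowup_transfer domP dT' PT' nY; exists c; right.
have pq' : wedge p (p + q) = 1 by rewrite wedgeDr wedgexx add0r.
have dT2 := proj1 (coords_toric C pq').
apply: same_point_trans Hc _.
have -> : blowup_chart1 T' = swap (toric C p (p + q)).
  by rewrite -toric_blowup2 blowup_chart2E.
exact: (same_point_swap (P := (toric C p (p + q), (c, 0)))).
Qed.

(** The points of the exceptional curve lie on the curve p + q of one of the two
    toric charts, and its equation is in the maximal ideal of the corner, on
    which the valuation p + q is positive. *)
Lemma represents_exceptional p q P : wedge p q = 1 -> coords P.1 ->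
  same_point P (corner p q) -> represents (p + q) (exceptional P).
Proof.
move=> pq cP PT; have dP := proj1 cP.
have dT : dominant (corner p q).1 := proj1 (coords_toric C pq).
have pq1 : wedge (p + q) q = 1 by rewrite wedgeDl wedgexx addr0.
have pq2 : wedge p (p + q) = 1 by rewrite wedgeDr wedgexx add0r.
have R phi : regular_along (exceptional P) phi -> rge (p + q) 0 phi.
  move=> [b H]; have [c [S|S]] := over_corner b pq cP PT.
    by apply: (proj1 (toric_along char0 closedC phi pq1)); exists c; exact/S.
  apply: (proj2 (toric_along char0 closedC phi pq2)); exists c.
  have dT2 := proj1 (coords_toric C pq2).
  exact/(same_point_swap (P := (toric C p (p + q), (c, 0))) dT2)/S.
apply: (represents_of char0 (coords_blowup cP) R).
have [regP _] := blowup_over dP 0.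
have -> : (exceptional P).1 = P.1.1 - ratC P.2.1 by rewrite /exceptional blowup_chart1E.
have : van_at (corner p q) (P.1.1 - ratC P.2.1).
  by apply/(same_point_van _ dP dT PT); exact: van_l.
move=> /van_decomp [A [B [rA rB ->]]].
have K phi : regular_at (corner p q) phi -> rge (p + q) 0 phi.
  by move=> H; apply: R; exists 0; apply: regP; exact/PT.
rewrite /= !ratC0 !subr0; apply: rgeD; rewrite -[1]add0r.
  apply: (rgeM (K _ rA)) => _.
  by rewrite (rval_toric1 C p q) wedgeDl wedgexx pq.
apply: (rgeM (K _ rB)) => _.
by rewrite (rval_toric2 C p q) wedgeDr wedgexx pq.
Qed.

(** ** Points of a blown-up surface *)

(** The coordinates of a chart separate its points. *)
Lemma same_chart_point (e : chart C) t t' : dominant e ->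
  same_point (e, t) (e, t') -> t = t'.
Proof.
move=> dome S.
have H (z : ratfun C) a b : van_at (e, t) (z - ratC a) -> van_at (e, t') (z - ratC b) -> a = b.
  move=> A B; have {}A : van_at (e, t') (z - ratC a).
    exact/(same_point_van (P := (e, t)) (Q := (e, t')) _ dome dome S).
  have := vanB (dome : dominant (e, t').1) B A.
  rewrite opprB addrC addrA subrK -rmorphB => /(van_const (dome : dominant (e, t').1)) /eqP.
  by rewrite subr_eq0 => /eqP.
move: (H _ _ _ (van_l (e, t)) (van_l (e, t'))) (H _ _ _ (van_r (e, t)) (van_r (e, t'))).
by case: t {S H} => a b; case: t' => a' b' /= -> ->.
Qed.

(** A point of the second kind of charts is treated by exchanging the two
    coordinates. *)
Lemma blowup_point X P Q : (forall e, X e -> coords e) -> blowup X P Q.1 ->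
  (exists Q0, [/\ X Q0.1, same_point Q Q0 & ~ same_point Q0 P]) \/
  (exists P' b, [/\ coords P'.1, same_point P' P &
     same_point Q (blowup_chart1 P', (0, b))]).
Proof.
move=> cX; case: Q => c [a b] /= [[Xc nP]|[e [t [Xe etP]]]].
  by left; exists (c, (a, b)); split; [exact: Xc | by [] | exact: nP].
have ce := cX e Xe; have dome := proj1 ce.
have key (P' : point C) a' b' : coords P'.1 -> same_point P' (e, t) ->
    same_point (c, (a, b)) (blowup_chart1 P', (a', b')) ->
    (forall t', exists t'', same_point (P'.1, t') (e, t'')) ->
    (exists Q0, [/\ X Q0.1, same_point (c, (a, b)) Q0 & ~ same_point Q0 P]) \/
    (exists P' b0, [/\ coords P'.1, same_point P' P &
      same_point (c, (a, b)) (blowup_chart1 P', (0, b0))]).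
  move=> cP' P'e S sw; have [a0|a0] := eqVneq a' 0.
    right; exists P', b'.
    by split; [exact: cP' | exact: same_point_trans P'e etP | move: S; rewrite a0; apply].
  left; have [t' t't S'] := blowup_away (proj1 cP') b' a0.
  have [t'' S''] := sw t'; exists (e, t''); split; first exact: Xe.
    exact: same_point_trans S (same_point_trans S' S'').
  move=> K; case/eqP: t't; case: P' cP' P'e S sw S' S'' => [e' u] /= cP' P'e S sw S' S''.
  apply: (same_chart_point (proj1 cP')); apply: same_point_trans S'' _.
  apply: same_point_trans K _; apply: same_point_sym.
  exact: same_point_trans P'e etP.
case=> cE.
  apply: (key (e, t) a b ce) => [||t']; [by [] | by rewrite cE | by exists t'].
apply: (key (swap e, swap t) b a (coords_swap ce)).
- exact: (same_point_swap (P := (e, t))).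
- rewrite cE blowup_chart2E /=.
  have dB : dominant (blowup_chart1 (swap e, swap t)).
    exact: (dominant_blowup (P := (swap e, swap t)) (dominant_swap dome)).
  exact: (same_point_swap (P := (_, (b, a))) dB).
- move=> t'; exists (swap t'); case: t' => a' b' /=.
  exact: (same_point_swap (P := (e, (b', a'))) dome).
Qed.

(** ** Invariants of iterated blow-ups *)

(** The last clause, about all the points of X, makes the induction work: two
    neighbouring curves meet at a corner only, and no other corner appears. *)
Definition chain_inv X ch : Prop :=
  [/\ forall e, X e -> coords e,
      forall c, c \in ch -> represents c.1 c.2,
      cfan (map fst ch)
    & forall P, X P.1 -> noncorner P \/
        exists p q, (p, q) \in cpairs (map fst ch) /\ same_point P (corner p q)].

Lemma blowup_coords X P : (forall e, X e -> coords e) ->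
  forall e, blowup X P e -> coords e.
Proof.
move=> cX e [[/cX //]|[e' [t [/cX ce _ [->|->]]]]].
  exact: (coords_blowup (P := (e', t))).
by rewrite blowup_chart2E; apply/coords_swap/coords_blowup/coords_swap.
Qed.

Lemma lies_on_contains P s D : represents s D -> lies_on P D -> contains P s.
Proof. by move=> [_ R _] H phi /H/R. Qed.

Lemma contains_lies_on P s D : represents s D -> contains P s -> lies_on P D.
Proof. by move=> [_ R _] H phi /H/R. Qed.

(** P is not a noncorner, as u and v are not proportional, and the cone of its
    corner contains u and v. *)
Lemma intersection_corner X u D v E ch P :
  chain_inv X [:: (u, D), (v, E) & ch] -> X P.1 -> lies_on P D -> lies_on P E ->
  wedge u v = 1 /\ same_point P (corner u v).
Proof.
move=> [cX cR F cP] XP PD PE.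
have Pu : contains P u by apply: lies_on_contains PD; apply: (cR (u, D)); rewrite inE eqxx.
have Pv : contains P v by apply: lies_on_contains PE; apply: (cR (v, E)); rewrite !inE eqxx orbT.
have uvl : (u, v) \in cpairs (map fst [:: (u, D), (v, E) & ch]).
  by rewrite /= cpairs_cons2 inE eqxx.
have uv : wedge u v = 1 by exact: (proj1 F _ uvl).
split=> //; have [N|[p [q [pql S]]]] := cP P XP; first by have := N _ _ Pu Pv; rewrite uv.
have pq : wedge p q = 1 by exact: (proj1 F _ pql).
have C_ s : contains P s -> contains (corner p q) s by move=> H phi /S/H.
have [uq pu] := corner_contains pq (C_ _ Pu).
have [vq pv] := corner_contains pq (C_ _ Pv).
by have [<- <-] := cfan_cone F uvl pql uq pu vq pv.
Qed.

(** The corner of u and v is replaced by the two corners over it; the other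
    points over it are noncorners. *)
Lemma chain_inv_intersection X u D v E ch P :
  chain_inv X [:: (u, D), (v, E) & ch] -> X P.1 -> lies_on P D -> lies_on P E ->
  chain_inv (blowup X P) [:: (u, D), (u + v, exceptional P), (v, E) & ch].
Proof.
move=> I XP PD PE; have [uv PT] := intersection_corner I XP PD PE.
have [cX cR F cP] := I; have cPP := cX _ XP.
have uv1 : wedge u (u + v) = 1 by rewrite wedgeDr wedgexx add0r.
have uv2 : wedge (u + v) v = 1 by rewrite wedgeDl wedgexx addr0.
split.
- exact: blowup_coords.
- move=> c; rewrite !inE => /or4P[/eqP ->|/eqP ->|/eqP ->|H].
  + by apply: (cR (u, D)); rewrite inE eqxx.
  + exact: represents_exceptional.
  + by apply: (cR (v, E)); rewrite !inE eqxx orbT.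
  + by apply: cR; rewrite !inE H !orbT.
- exact: cfan_insert.
move=> Q /(blowup_point cX) [[Q0 [XQ0 QQ0 Q0P]]|[P' [b [cP' P'P QB]]]].
  have [N|[p [q [pql S]]]] := cP Q0 XQ0.
    by left; apply: noncorner_sub N => phi /QQ0.
  right; exists p, q; split; last exact: same_point_trans QQ0 S.
  move: pql; rewrite /= cpairs_cons2 cpairs_cons3 !inE => /orP[/eqP[pu qv]|->].
    case: Q0P; apply: same_point_trans S _; rewrite pu qv.
    exact: same_point_sym.
  by rewrite !orbT.
have [c S] := over_corner b uv cP' (same_point_trans P'P PT).
have {S} [S|S] := S.
  have [c0|N] := toric_point (0, c) uv2; last first.
    by left; apply: noncorner_sub N => phi /S/QB.
  right; exists (u + v), v; rewrite /= cpairs_cons3 !inE eqxx orbT.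
  by split; [by [] | apply: same_point_trans QB _; rewrite /corner -c0].
have [c0|N] := toric_point (c, 0) uv1; last first.
  by left; apply: noncorner_sub N => phi /S/QB.
right; exists u, (u + v); rewrite /= cpairs_cons3 !inE eqxx.
by split; [by [] | apply: same_point_trans QB _; rewrite /corner -c0].
Qed.

Lemma cpairs_mem (l : seq (int * int)) p q : (p, q) \in cpairs l -> p \in l /\ q \in l.
Proof.
move=> H; split.
  by have := map_f fst H; rewrite -/(unzip1 _) unzip1_zip ?size_rot.
by have := map_f snd H; rewrite -/(unzip2 _) unzip2_zip ?size_rot // mem_rot.
Qed.

(** A corner is on two distinct chain curves, so that P is a noncorner; this
    passes to the points over P, whose local rings are larger. *)
Lemma chain_inv_other X ch P : chain_inv X ch -> X P.1 ->
  (forall e e', e \in ch -> e' \in ch ->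
     lies_on P e.2 -> lies_on P e'.2 -> e = e') ->
  chain_inv (blowup X P) ch.
Proof.
move=> [cX cR F cP] XP H; split=> //; first exact: blowup_coords.
have NP : noncorner P.
  have [//|[p [q [pql S]]]] := cP P XP.
  have pq : wedge p q = 1 by exact: (proj1 F _ pql).
  have [/mapP [[p' D] pD /= pp'] /mapP [[q' E] qE /= qq']] := cpairs_mem pql.
  have [Tp Tq] := contains_corner pq.
  have PD : lies_on P D.
    by apply: contains_lies_on (cR _ pD) _ => phi /S; rewrite -pp'; exact: Tp.
  have PE : lies_on P E.
    by apply: contains_lies_on (cR _ qE) _ => phi /S; rewrite -qq'; exact: Tq.
  have /(congr1 fst) /= E' := H _ _ pD qE PD PE.
  by move: pq; rewrite pp' qq' E' wedgexx.
move=> Q /(blowup_point cX) [[Q0 [XQ0 QQ0 Q0P]]|[P' [b [cP' P'P QB]]]].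
  have [N|[p [q [pql S]]]] := cP Q0 XQ0.
    by left; apply: noncorner_sub N => phi /QQ0.
  by right; exists p, q; split; [exact: pql | exact: same_point_trans QQ0 S].
left; apply: noncorner_sub NP => phi /P'P K; apply/QB.
exact: (proj1 (blowup_over (proj1 cP') b)).
Qed.

(** The three affine planes of CP^2 are toric. *)
Lemma toric_cp2 : [/\ toric C (1, 0) (0, 1) = (rx C, ry C),
  toric C (0, 1) (-1, -1) = (ry C / rx C, 1 / rx C)
  & toric C (-1, -1) (1, 0) = (1 / ry C, rx C / ry C)].
Proof.
rewrite /toric /mono /= !opprK !oppr0 !expr1z !expr0z !exprN1 !mul1r !mulr1.
by split=> //; congr (_, _); exact: mulrC.
Qed.

Lemma chain_inv_cp2 : chain_inv (@cp2 C)
  [:: ((1, 0), (rx C, ry C)); ((0, 1), (ry C, rx C)); ((-1, -1), (1 / rx C, ry C / rx C))].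
Proof.
have [T1 T2 T3] := toric_cp2.
have R1 := represents_toric char0 closedC (erefl : wedge (1, 0) (0, 1) = 1).
have R2 := represents_toric char0 closedC (erefl : wedge (0, 1) (-1, -1) = 1).
have cT (p q : int * int) : wedge p q = 1 -> forall P, P.1 = toric C p q ->
    noncorner P \/ same_point P (corner p q).
  by move=> pq [e t] /= ->; have [->|] := toric_point t pq; [right | left].
split.
- by move=> e [->|->|->]; rewrite -?T1 -?T2 -?T3; exact: coords_toric.
- move=> c; rewrite !inE => /or3P[/eqP->|/eqP->|/eqP->] /=.
  + by rewrite -T1; exact: (proj1 R1).
  + by have := proj2 R1; rewrite T1.
  + by have := proj2 R2; rewrite T2.
- split=> [c|[a b] w0]; first by rewrite !inE => /or3P[] /eqP->.
  have: (a != 0) || (b != 0).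
    by apply: contraNT w0; rewrite negb_or !negbK => /andP[/eqP -> /eqP ->].
  by rewrite /cpairs /= /incone /wedge /=; lia.
- move=> P [E|E|E].
  + have [|S] := cT (1, 0) (0, 1) erefl P (etrans E (esym T1)); first by left.
    by right; exists (1, 0), (0, 1).
  + have [|S] := cT (0, 1) (-1, -1) erefl P (etrans E (esym T2)); first by left.
    by right; exists (0, 1), (-1, -1).
  + have [|S] := cT (-1, -1) (1, 0) erefl P (etrans E (esym T3)); first by left.
    by right; exists (-1, -1), (1, 0).
Qed.

Theorem iterated_blowup_inv X ch : iterated_blowup X ch -> chain_inv X ch.
Proof.
elim=> {X ch} [|X ch k _ [cX cR F cP]|X u D v E ch P _ I XP PD PE|X ch P _ I XP H].
- exact: chain_inv_cp2.
- split=> // [c||P XP]; first by rewrite mem_rot; exact: cR.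
    by rewrite map_rot; exact: cfan_rot.
  have [N|[p [q [pql S]]]] := cP P XP; [by left | right].
  by exists p, q; rewrite map_rot cpairs_rot mem_rot.
- exact: chain_inv_intersection.
- exact: chain_inv_other.
Qed.

Theorem chain_curve_represents (s : primvec) (D : curve C) :
  chain_curve s D -> represents (val s) D.
Proof. by move=> [X [ch [/iterated_blowup_inv [_ R _ _] /R]]]. Qed.

(** ** Existence of the chain curves *)

(** l is the chain of an iterated blow-up having all the toric planes of its
    cones among its charts. *)
Definition toric_blowup (l : seq (int * int)) : Prop := exists X ch,
  [/\ iterated_blowup X ch, map fst ch = l
    & forall p q, (p, q) \in cpairs l -> X (toric C p q)].

Lemma toric_blowup_rot k l : toric_blowup l -> toric_blowup (rot k l).
Proof.
move=> [X [ch [I E T]]]; exists X, (rot k ch); split.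
- exact: IB_rot.
- by rewrite map_rot E.
- by move=> p q; rewrite cpairs_rot mem_rot; exact: T.
Qed.

(** The toric planes of the other cones do not contain the corner of u and v,
    so that they remain charts of the blow-up. *)
Lemma toric_blowup_insert u v l :
  toric_blowup [:: u, v & l] -> toric_blowup [:: u, u + v, v & l].
Proof.
move=> [X [ch []]]; case: ch => [|[u' D] [|[v' E] ch]] I //= [eu ev El] T.
subst u' v'.
have inv := iterated_blowup_inv I; have [cX cR F _] := inv.
rewrite /= El in F.
have uvl : (u, v) \in cpairs [:: u, v & l] by rewrite cpairs_cons2 inE eqxx.
have uv : wedge u v = 1 by exact: (proj1 F _ uvl).
have [cu cv] := contains_corner uv.
exists (blowup X (corner u v)), [:: (u, D), (u + v, exceptional (corner u v)), (v, E) & ch].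
have XT : X (corner u v).1 by exact: T uvl.
split; [| by rewrite /= El |].
  apply: IB_intersection I XT _ _.
    by apply: contains_lies_on cu; apply: (cR (u, D)); rewrite inE eqxx.
  by apply: contains_lies_on cv; apply: (cR (v, E)); rewrite !inE eqxx orbT.
move=> p q; rewrite cpairs_cons3 !inE => /or3P[/eqP[-> ->]|/eqP[-> ->]|pql].
- right; exists (toric C u v), (0, 0); split=> //.
  by rewrite toric_blowup2; right.
- right; exists (toric C u v), (0, 0); split=> //.
  by rewrite toric_blowup1; left.
have pql' : (p, q) \in cpairs [:: u, v & l] by rewrite cpairs_cons2 inE pql orbT.
left; split=> [|t S]; first exact: T.
have pq : wedge p q = 1 by exact: (proj1 F _ pql').
have [N|C0] : noncorner (toric C p q, t) \/ same_point (toric C p q, t) (corner p q).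
  by have [->|] := toric_point t pq; [right | left].
  have := N u v (fun phi H => cu _ (proj1 (S phi) H))
    (fun phi H => cv _ (proj1 (S phi) H)).
  by rewrite uv.
have K s : contains (corner u v) s -> contains (corner p q) s.
  by move=> H phi /C0/S/H.
have [uq pu] := corner_contains pq (K _ cu).
have [vq pv] := corner_contains pq (K _ cv).
have [E1 E2] := cfan_cone F uvl pql' uq pu vq pv.
(* the pair (u, v) would occur twice among the neighbours *)
have w0 : u != 0 by have [pu' _] := wedge_prim uv; exact: prim_neq0.
have := proj2 F u w0; rewrite cpairs_cons2 /= {1}/incone wedgexx uv /= => /eqP.
rewrite -[1%N in X in _ == X]addn0 eqn_add2l -leqn0 leqNgt -has_count.
by case/hasP; exists (p, q) => //=; rewrite /incone E1 E2 uv wedgexx.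
Qed.

(** Euclid's algorithm on the coordinates in the cone. *)
Lemma toric_blowup_reaches u v l (a b : nat) : toric_blowup [:: u, v & l] ->
  prim (lin u a%:Z v b%:Z) -> exists2 l', toric_blowup l' & lin u a%:Z v b%:Z \in l'.
Proof.
have [n] := ubnP (a + b)%N; elim: n u v l a b => // n IH u v l a b abn TB pw.
have lin10 : lin u 1 v 0 = u by rewrite /lin !mulr0 !addr0 !mulr1 -surjective_pairing.
have lin01 : lin u 0 v 1 = v by rewrite /lin !mulr0 !add0r !mulr1 -surjective_pairing.
have [b0|b0] := posnP b.
  have a1 : a%:Z = 1.
    by apply: (@prim_scale u) => //; move: pw; rewrite b0 /lin !mulr0 !addr0.
  by exists [:: u, v & l] => //; rewrite b0 a1 lin10 inE eqxx.
have [a0|a0] := posnP a.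
  have b1 : b%:Z = 1.
    by apply: (@prim_scale v) => //; move: pw; rewrite a0 /lin !mulr0 !add0r.
  by exists [:: u, v & l] => //; rewrite a0 b1 lin01 !inE eqxx orbT.
have TB' := toric_blowup_insert TB.
have [ab|ba] := leqP b a.
  have E : lin u a%:Z v b%:Z = lin u (a - b)%:Z (u + v) b%:Z.
    by rewrite /lin -subzn //=; congr pair; ring.
  by move: pw; rewrite E => pw; apply: (IH _ _ _ _ _ _ TB' pw); lia.
have E : lin u a%:Z v b%:Z = lin (u + v) a%:Z v (b - a)%:Z.
  by rewrite /lin -subzn ?(ltnW ba) //=; congr pair; ring.
have := toric_blowup_rot 1 TB'; rewrite rot1_cons /= => TB''.
by move: pw; rewrite E => pw; apply: (IH _ _ _ _ _ _ TB'' pw); lia.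
Qed.

Theorem chain_curve_exists (s : primvec) : exists D : curve C, chain_curve s D.
Proof.
have ps : prim (val s) by exact: (valP s).
pose l0 : seq (int * int) := [:: (1, 0); (0, 1); (-1, -1)].
have T0 : toric_blowup l0.
  exists (@cp2 C), [:: ((1, 0), (rx C, ry C)); ((0, 1), (ry C, rx C));
                     ((-1, -1), (1 / rx C, ry C / rx C))].
  split=> //; first exact: IB_cp2.
  have [T1 T2 T3] := toric_cp2.
  move=> p q; rewrite /cpairs /= !inE => /or3P[] /eqP[-> ->].
  - by rewrite T1; apply: Or31.
  - by rewrite T2; apply: Or32.
  - by rewrite T3; apply: Or33.
have [l TB sl] : exists2 l, toric_blowup l & val s \in l.
  have [i i3 /andP[A B]] : exists2 i, (i < 3)%N & incone (cp2_fan i) (cp2_fan i.+1) (val s).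
    by have [_ _ H _] := fan_cp2; exact: H (prim_neq0 ps).
  have [_ cw _ _] := fan_cp2; have {cw} cw := cw i i3.
  have [l E] : exists l, rot i l0 = [:: cp2_fan i, cp2_fan i.+1 & l].
    case: i i3 {A B cw} => [|[|[|//]]] _;
      [by exists [:: (-1, -1)] | by exists [:: (1, 0)] | by exists [:: (0, 1)]].
  have := toric_blowup_rot i T0; rewrite E => TB.
  move: ps; rewrite (coneE (val s) cw) -(gez0_abs B) -(gez0_abs (ltW A)).
  exact: toric_blowup_reaches TB.
have [X [ch [I E _]]] := TB; move: sl; rewrite -E => /mapP [[s' D] sD /= ss'].
by exists D, X, ch; split; [exact: I | move: sD; rewrite -ss'; apply].
Qed.

End BlowupChains.

(** * The action of Symp on the chain curves *)

Section Action.
Variable C : fieldType.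
Hypothesis char0 : [pchar C] =i pred0.
Hypothesis closedC : forall p : {poly C}, (1 < size p)%N -> exists x, root p x.
Implicit Types (f g : symp C) (w : int * int) (s : primvec) (phi : ratfun C).

Lemma symp_brk f : brk (symp_map f).1 (symp_map f).2 = (symp_map f).1 * (symp_map f).2.
Proof. exact/symplectic_brk/sympP. Qed.

Lemma trop_mul f g w : trop (f * g)%g w = trop f (trop g w).
Proof.
have [f1 f2] := dominant_neq0 (@symp_dominant _ f).
exact: (trop_comp (@symp_dominant _ g) char0 (symp_brk g) w f1 f2).
Qed.

Lemma trop_invK f : cancel (trop f) (trop (f^-1)%g).
Proof. by move=> w; rewrite -trop_mul mulVg; exact: trop_id. Qed.

Lemma trop_Kinv f : cancel (trop (f^-1)%g) (trop f).
Proof. by move=> w; rewrite -trop_mul mulgV; exact: trop_id. Qed.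

Lemma rval_scale w (k : int) phi : 0 <= k -> rval (w.1 * k, w.2 * k) phi = rval w phi * k.
Proof.
move=> k0; have P (p : {mpoly C[2]}) : p != 0 -> pval (w.1 * k, w.2 * k) p = pval w p * k.
  have wtE m : wt (w.1 * k, w.2 * k) m = wt w m * k by rewrite /wt /=; ring.
  move=> p0; apply/le_anti/andP; split.
    by have [m mp <-] := pval_attained w p0; rewrite -wtE; exact: pval_le.
  have [m mp <-] := pval_attained (w.1 * k, w.2 * k) p0.
  by rewrite wtE; apply: (ler_wpM2r k0); exact: pval_le.
rewrite rval.unlock (P _ (den_neq0 phi)).
have [->|n0] := eqVneq (num phi) 0; last by rewrite (P _ n0) mulrBl.
suff pval0 v : pval v (0 : {mpoly C[2]}) = 0 by rewrite !pval0 !sub0r mulNr.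
by rewrite /pval msupp0 big_nil mlead0 wt0.
Qed.

(** trop f and its inverse are homogeneous, so that they preserve
    divisibility. *)
Lemma trop_prim f w : prim w -> prim (trop f w).
Proof.
move=> pw; set t := trop f w; pose g := gcdz t.1 t.2.
pose u := ((t.1 %/ g)%Z, (t.2 %/ g)%Z).
have tE : t = (u.1 * g, u.2 * g).
  by rewrite /u /= !divzK ?dvdz_gcdl ?dvdz_gcdr //; exact: surjective_pairing.
have g0 : 0 <= g by [].
rewrite /prim /coprimez -/g; apply/eqP; apply: (@prim_scale (trop (f^-1)%g u)) => //.
suff -> : ((trop (f^-1)%g u).1 * g, (trop (f^-1)%g u).2 * g) = w by [].
by rewrite -[RHS](trop_invK f) -/t tE /trop !rval_scale.
Qed.

Definition fstar f s : primvec :=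
  exist (fun v : int * int => coprimez v.1 v.2) (trop f (val s)) (trop_prim f (valP s)).

Lemma fstar_piecewise_linear f : piecewise_linear (fstar f).
Proof.
have L g : tropically_linear (trop g).
  have [g1 g2] := dominant_neq0 (@symp_dominant _ g).
  exact: (trop_linear char0 g1 g2 (symp_brk g)).
apply: (@piecewise_linear_of (trop f) (trop (f^-1)%g) (fstar f) (fstar (f^-1)%g)) => //.
  exact: trop_invK.
exact: trop_Kinv.
Qed.

Lemma fstar_mul f g : fstar (f * g)%g =1 fstar f \o fstar g.
Proof. by move=> s; apply/val_inj; exact: trop_mul. Qed.

(** The two vectors orthogonal to s show that t is proportional to s, and a
    vector of product 1 with s that the factor is nonnegative. *)
Lemma prim_halfplane (t s : int * int) : prim t -> prim s ->
  (forall m, 0 <= dot s m -> 0 <= dot t m) -> t = s.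
Proof.
move=> pt /coprimezP [[u v] /= uv] H.
have W : wedge s t = 0.
  have := H (- s.2, s.1); have := H (s.2, - s.1); rewrite /dot /wedge /=; lia.
have tE : t = (s.1 * dot t (u, v), s.2 * dot t (u, v)).
  rewrite [LHS]surjective_pairing -[t.1]mulr1 -[t.2]mulr1 -uv.
  congr pair; apply/eqP; rewrite -subr_eq0; apply/eqP.
    by transitivity (- v * wedge s t); [rewrite /dot /wedge /=; ring | rewrite W mulr0].
  by transitivity (u * wedge s t); [rewrite /dot /wedge /=; ring | rewrite W mulr0].
have c1 : dot t (u, v) = 1.
  apply: (@prim_scale s); last by rewrite -tE.
  by apply: H; rewrite /dot /=; lia.
by rewrite tE c1 !mulr1 -surjective_pairing.
Qed.

(** If f maps D onto E, the valuation t = trop f s is positive at the equation of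
    E, and the other coordinate of E has a transcendental residue; hence the
    local ring of E, which is that of the valuation s', is contained in that of
    t, and s' = t.  For the converse, all the conditions are transported by
    [rge_rsubst] from E to D. *)
Lemma maps_chain_curveP f s s' : maps_chain_curve f s s' <-> fstar f s = s'.
Proof.
have domf := @symp_dominant _ f; have brkf := symp_brk f.
have subC (z : ratfun C) a : rsubst f z - ratC a = rsubst f (z - ratC a).
  by rewrite (rsubstD domf) (rsubstN domf) (rsubstC domf).
split=> [[D [E [cD cE [E1 E2 E2a]]]]|<-].
  have [_ RD VD] := chain_curve_represents char0 closedC cD.
  have [_ RE _] := chain_curve_represents char0 closedC cE.
  have T k phi := rge_rsubst domf char0 brkf (val s) k phi.
  have wU : rge (trop f (val s)) 1 E.1 by exact: (proj1 (T _ _) (proj1 (VD _) E1)).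
  have wW : rge (trop f (val s)) 0 E.2 by exact: (proj1 (T _ _) (proj1 (RD _) E2)).
  have wWa a : ~ rge (trop f (val s)) 1 (E.2 - ratC a).
    by move=> H; apply: (E2a a); rewrite subC; apply/VD/T.
  apply/val_inj/prim_halfplane => [||m sm]; [exact: trop_prim (valP s) | exact: (valP s') |].
  have R : rge (trop f (val s)) 0 (mono C m).
    apply: (regular_along_rge char0 closedC wU wW wWa); apply/RE => _.
    by rewrite rval_mono.
  by have := R (mono_neq0 C m); rewrite rval_mono.
have [D cD] := chain_curve_exists char0 closedC s.
have [E cE] := chain_curve_exists char0 closedC (fstar f s).
exists D, E; split; [exact: cD | exact: cE |].
have [_ RD VD] := chain_curve_represents char0 closedC cD.
have [[domE _] RE VE] := chain_curve_represents char0 closedC cE.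
have T k phi := rge_rsubst domf char0 brkf (val s) k phi.
split.
- apply/VD/T/VE/(vanishes_alongP char0); exists 1, 1.
  by rewrite rmorph1 oner_neq0 psubst1 divr1 mulr1.
- apply/RD/T/RE/(regular_alongP char0); exists 'X_ord_max, 1.
  by rewrite rmorph1 oner_neq0 psubst1 divr1 psubst_Xr.
move=> a; rewrite subC => /VD/T/VE/(vanishes_alongP char0) [q [d [d0 H]]].
have D0 : psubst E d != 0.
  by apply: (psubst_neq0 domE); apply: contraNneq d0 => ->; rewrite rmorph0.
have : psubst E (('X_ord_max - a%:MP) * d - 'X_ord0 * q) = 0.
  rewrite !psubstB !psubstM !psubstB psubst_Xl psubst_Xr psubstC H -mulrA.
  by rewrite (mulfVK D0) subrr.
move/domE/(congr1 (@axis C)).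
rewrite axisB !axisM axisB rmorph0 axis_l axis_r axis_C mul0r subr0 => /eqP.
by rewrite mulf_eq0 (negPf d0) orbF polyXsubC_eq0.
Qed.

End Action.

Theorem mainTheorem3 (R : realType) :
  exists phi : symp R[i] -> thompson,
    (forall (f : symp R[i]) (s s' : primvec),
       maps_chain_curve f s s' <-> phi f s = s') /\
    (forall f g : symp R[i], phi (f * g)%g =1 phi f \o phi g).
Proof.
have char0 : [pchar R[i]] =i pred0 by exact: pchar_num.
have closedC (p : {poly R[i]}) : (1 < size p)%N -> exists x, root p x.
  by move=> p1; apply/closed_rootP; rewrite neq_ltn p1 orbT.
exists (fun f => Thompson (fstar_piecewise_linear char0 f)); split=> [f s s'|f g s].
  exact: (maps_chain_curveP char0 closedC).
exact: fstar_mul.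
Qed.
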